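(* Suppose the operator $\mathbf{K}$ satisfies the operator assumptions (K1)--(K3) with constants $\alpha,\beta$, the network satisfies the network assumptions (N1)--(N4) with constants $R_0,\sigma,\rho$ (and associated Friedrichs/Poincaré constant $\mu$), and $H\ge 4dR_0$. Let $\mathbf{f}\in\hat{\mathbf{V}}$, let $\mathbf{u}\in\mathbf{V}$ be the solution of $(\mathbf{K}\mathbf{u},\mathbf{v})=(\mathbf{f},\mathbf{v})$ for all $\mathbf{v}\in\mathbf{V}$, and for an integer $k\ge 1$ let $\mathbf{u}_H^k\in\mathbf{V}_H^{\mathrm{ms},k}$ be the localized orthogonal decomposition (LOD) approximation, i.e. the solution of $(\mathbf{K}\mathbf{u}_H^k,\mathbf{v})=(\mathbf{f},\mathbf{v})$ for all $\mathbf{v}\in\mathbf{V}_H^{\mathrm{ms},k}$. Then $$|\mathbf{u}-\mathbf{u}_H^{k}|_{\mathbf{K}}\le C_{\alpha,\beta,d,\mu,\sigma}\,k^{d/2}\left(H+\exp\!\left(-k\,(6C_1C_2)^{-1}\right)\right)|\mathbf{f}|_{\mathbf{M}^{-1}},$$ where $C_{\alpha,\beta,d,\mu,\sigma}$ is a constant depending only on $\alpha,\beta,d,\mu,\sigma$, and $C_1,C_2$ are the decomposition constants specified in the context.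
   Context: Network. Let $d$ be a positive integer, $\Omega=[0,l_1]\times\cdots\times[0,l_d]$, and let $\mathcal{G}=(\mathcal{N},\mathcal{E})$ be a connected graph with finite node set $\mathcal{N}\subset\Omega$ and edge set $\mathcal{E}$ of unordered node pairs; $x\sim y$ means $\{x,y\}\in\mathcal{E}$, and $|x-y|$ is the Euclidean distance. Let $\Gamma\subset\partial\Omega$ be the Dirichlet boundary segment. For $\omega\subset\Omega$ put $\mathcal{N}(\omega)=\mathcal{N}\cap\omega$. Let $\hat V$ be the space of real functions on $\mathcal{N}$, $V=\{v\in\hat V: v(x)=0 \text{ for } x\in\mathcal{N}(\Gamma)\}$, and $(u,v)=\sum_{x\in\mathcal{N}}u(x)v(x)$. For $x\in\mathcal{N}$ let $M_x,L_x:\hat V\to\hat V$ be the symmetric linear operators with $(M_xv,v)=\frac12\sum_{y\sim x}|x-y|v(x)^2$ and $(L_xv,v)=\frac12\sum_{y\sim x}\frac{(v(x)-v(y))^2}{|x-y|}$ (so $M_x$ is diagonal). Put $M_\omega=\sum_{x\in\mathcal{N}(\omega)}M_x$, $L_\omega=\sum_{x\in\mathcal{N}(\omega)}L_x$, $M=M_\Omega$, $L=L_\Omega$, $|v|_{M,\omega}=(M_\omega v,v)^{1/2}$, $|v|_{L,\omega}=(L_\omega v,v)^{1/2}$, $|v|_M=|v|_{M,\Omega}$, $|v|_L=|v|_{L,\Omega}$. Network assumptions. Let $B_R(x)=[x_1-R,x_1+R)\times\cdots\times[x_d-R,x_d+R)$, where the $i$-th factor is replaced by $[x_i-R,x_i+R]$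 if $x_i+R=l_i$. Boxes $B_R(x)$ below are those contained in $\Omega$; enlarged boxes $B_{R+R_0}(x)$ are understood as intersected with $\Omega$. There are a length-scale $R_0$, a uniformity constant $\sigma$ and a density $\rho$ such that: (N1, homogeneity) for all $R\ge R_0$, $x\in\Omega$: $\rho\le(2R)^{-d}|1|^2_{M,B_R(x)}\le\sigma\rho$; (N2, locality) $|x-y|<R_0$ for all $\{x,y\}\in\mathcal{E}$; (N3, boundary density) for every $y\in\Gamma$ there is $x\in\mathcal{N}(\Gamma)$ with $|x-y|<R_0$; (N4, connectivity) for all $R\ge R_0$, $x\in\Omega$ there is a connected subgraph of $\mathcal{G}$ containing all edges with one or both endpoints in $B_R(x)$ and only edges with endpoints in $B_{R+R_0}(x)$. Under these assumptions $\mu<\infty$ denotes a constant such that for all $R\ge R_0$ and $x\in\Omega$: if $B_R(x)$ contains boundary nodes (nodes of $\mathcal N(\Gamma)$), then $|v|_{M,B_R(x)}\le\mu R|v|_{L,B_{R+R_0}(x)}$ for all $v\in V$ (Friedrichs); and in all cases, for every $v\in\hat V$ there is a constant $c=c(R,x,v)$ with $|v-c|_{M,B_R(x)}\le\mu R|v|_{L,B_{R+R_0}(x)}$ (Poincaré). Such a $\mu$ exists. Mesh. $l_1,\dots,l_d$ are integer multiples of $H$, and $\mathcal{T}_H=\{B_{H/2}(x): x\in\Omega,\ H^{-1}x_i+1/2\in\mathbb{Z},\ i=1,\dots,d\}$ is a partition of $\Omega$ into boxes of side $H$. $\Gamma$ is a union of mesh element edges (or faces). For $\omega\subset\Omega$,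 $U(\omega)$ is the union of all $T\in\mathcal{T}_H$ with $\overline T\cap\overline\omega\ne\emptyset$; $U_1=U$, $U_j(\omega)=U_{j-1}(U(\omega))$; $U(x)=U(\{x\})$ for a point $x$. Interpolation. Let $\hat{\mathcal{Q}}_H$ be the continuous functions on $\Omega$ whose restriction to each $T\in\mathcal T_H$ is a linear combination of monomials $z^{a}$, $a\in\{0,1\}^d$. Let $\phi_1,\dots,\phi_m$ be its Lagrange basis with mesh nodes $y_1,\dots,y_m$, ordered so that $\phi_1,\dots,\phi_{m_0}$ ($m_0<m$) span the functions in $\hat{\mathcal Q}_H$ vanishing on $\Gamma$. Let $\varphi_i\in\hat V$ be the restriction of $\phi_i$ to $\mathcal{N}$. Let $T_k$ be the unique element containing $y_k$, and let $\psi_k$ be the linear combination of the $\varphi_\ell$ associated with vertices of $T_k$ (regarded on $\mathcal N(T_k)$) satisfying $(M_{T_k}\psi_k,\varphi_\ell)=\delta_{k\ell}$ for $\ell=1,\dots,m$. Define $\mathcal{I}v=\sum_{k=1}^{m_0}(M_{T_k}\psi_k,v)\varphi_k$. Vector-valued setting. For an integer $n\ge1$ let $\mathbf{V}=V^n$, $\hat{\mathbf{V}}=\hat V^n$, $(\mathbf{u},\mathbf{v})=\sum_{i=1}^n(u_i,v_i)$; $\mathbf{L}_\omega,\mathbf{M}_\omega,\mathbf{L},\mathbf{M},\mathcal{I}$ act componentwise (the vector version of $\mathcal I$ is written $\boldsymbol{\mathcal{I}}$), with seminorms $|\mathbf v|_{\mathbf L,\omega}=(\mathbf L_\omega\mathbf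 v,\mathbf v)^{1/2}$ etc.; $|\mathbf f|_{\mathbf M^{-1}}^2=(\mathbf M^{-1}\mathbf f,\mathbf f)$. Operator assumptions. $\mathbf{K}:\hat{\mathbf{V}}\to\hat{\mathbf{V}}$ is linear and: (K1) there are $0<\alpha\le\beta<\infty$ with $\alpha(\mathbf{L}\mathbf{v},\mathbf{v})\le(\mathbf{K}\mathbf{v},\mathbf{v})\le\beta(\mathbf{L}\mathbf{v},\mathbf{v})$ for all $\mathbf v\in\mathbf V$; (K2) $\mathbf{K}=\sum_{x\in\mathcal{N}}\mathbf{K}_x$ with $\mathbf{K}_x:\hat{\mathbf V}\to\hat{\mathbf V}$ symmetric positive semidefinite, such that $\mathbf{K}_x\mathbf v$ depends only on the values of $\mathbf v$ at $x$ and its adjacent nodes and is supported on $x$ and its adjacent nodes; (K3) the problem of finding $\mathbf u\in\mathbf V$ with $(\mathbf K\mathbf u,\mathbf v)=(\mathbf f,\mathbf v)$ for all $\mathbf v\in\mathbf V$ admits a unique solution, for $\mathbf f\in\hat{\mathbf V}$. Put $\mathbf K_\omega=\sum_{x\in\mathcal N(\omega)}\mathbf K_x$, $|\mathbf v|_{\mathbf K}=(\mathbf K\mathbf v,\mathbf v)^{1/2}$, $|\mathbf v|_{\mathbf K,\omega}=(\mathbf K_\omega\mathbf v,\mathbf v)^{1/2}$. LOD space. $\mathbf W=\{\mathbf v\in\mathbf V:\boldsymbol{\mathcal I}\mathbf v=0\}$; $\mathbf W(\omega)=\{\mathbf w\in\mathbf W:\mathbf w(x)=0 \text{ for } x\in\mathcal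 N(\Omega\setminus\omega)\}$. For $T\in\mathcal T_H$, $\mathbf v\in\mathbf V$, $\mathbf Q_T^k\mathbf v\in\mathbf W(U_k(T))$ solves $(\mathbf K\mathbf Q_T^k\mathbf v,\mathbf w)=(\mathbf K_T\mathbf v,\mathbf w)$ for all $\mathbf w\in\mathbf W(U_k(T))$. Let $\boldsymbol\varphi_1,\dots,\boldsymbol\varphi_{nm_0}$ enumerate the vector functions having one component equal to some $\varphi_i$, $1\le i\le m_0$, and the other components zero. Then $\mathbf V_H^{\mathrm{ms},k}=\operatorname{span}\{\boldsymbol\varphi_j-\sum_{T\in\mathcal T_H}\mathbf Q_T^k\boldsymbol\varphi_j: j=1,\dots,nm_0\}$. Decomposition constants. Let $\mathbf V_j=\{\mathbf v\in\mathbf V:\mathbf v(x)=0\text{ for }x\in\mathcal N(\Omega\setminus U(y_j))\}$ and $\mathbf W_j=(1-\boldsymbol{\mathcal I})\mathbf V_j\subset\mathbf W$, $j=1,\dots,m$. $C_1,C_2>0$ are constants, $C_2$ depending only on $\alpha,\beta,d$ and $C_1$ depending only on $\alpha,\beta,d,\mu,\sigma$, such that for every $\mathbf w\in\mathbf W$: $|\mathbf w|_{\mathbf K}^2\le C_2\sum_{j=1}^m|\mathbf w_j|_{\mathbf K}^2$ for every decomposition $\mathbf w=\sum_{j=1}^m\mathbf w_j$ with $\mathbf w_j\in\mathbf W_j$, and $\sum_{j=1}^m|(1-\boldsymbol{\mathcal I})(\varphi_j\mathbf w)|_{\mathbf K}^2\le C_1|\mathbf w|_{\mathbf K}^2$,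 where $\varphi_j\mathbf w=[\varphi_jw_1,\dots,\varphi_jw_n]$. Such constants exist.
   Formalization: The constant C may also depend on the fixed domain Ω (its side lengths l_1,…,l_d), not only on α, β, d, μ, σ; by scaling, a bound uniform over all Ω would give error ≤ C k^{d/2} H |f| for every fixed k, which fails, e.g. for d=1, k=1 with mesh-periodic coefficients. *)

(* Defs.v *)
From HB Require Import structures.
From mathcomp Require Import all_boot all_order all_algebra.
From mathcomp Require Import all_classical all_reals all_analysis.

Set Implicit Arguments.
Unset Strict Implicit.
Unset Printing Implicit Defensive.

Import Order.TTheory GRing.Theory Num.Theory.
Import numFieldNormedType.Exports.

Local Open Scope classical_set_scope.
Local Open Scope ring_scope.

Section Geometry.
Context {R : realType} {d : nat}.
Implicit Types (l x y z : 'rV[R]_d) (H r : R).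

(* The library norm on row vectors is the maximum norm. *)
Definition enorm z : R := Num.sqrt (\sum_i z 0 i ^+ 2).

Definition domain l : set 'rV[R]_d := [set z | forall i, 0 <= z 0 i <= l 0 i].

(* [_ < _ ?<= if b] is [<=] when [b] holds and [<] otherwise: the box is
   half-open, except where it touches an upper face of the domain. *)
Definition box l r x : set 'rV[R]_d :=
  [set z | forall i, x 0 i - r <= z 0 i /\
     z 0 i < x 0 i + r ?<= if (x 0 i + r == l 0 i)].

Definition frontier (A : set 'rV[R]_d) : set 'rV[R]_d :=
  closure A `\` interior A.

Definition elt_center l H x :=
  domain l x /\ forall i, H^-1 * x 0 i + 2^-1 \is a Num.int.

Definition mesh l H : set (set 'rV[R]_d) :=
  [set box l (H / 2) x | x in elt_center l H].

Definition elt_vertex l H (T : set 'rV[R]_d) : set 'rV[R]_d :=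
  [set z | exists2 x, elt_center l H x & T = box l (H / 2) x /\
    forall i, z 0 i = x 0 i - H / 2 \/ z 0 i = x 0 i + H / 2].

Definition mesh_node l H : set 'rV[R]_d :=
  [set z | exists2 T, mesh l H T & elt_vertex l H T z].

(* Closed faces of codimension one of the mesh elements. *)
Definition mesh_face l H : set (set 'rV[R]_d) :=
  [set F | exists x i,
     elt_center l H x /\
     (F = closure (box l (H / 2) x) `&` [set z | z 0 i = x 0 i - H / 2] \/
      F = closure (box l (H / 2) x) `&` [set z | z 0 i = x 0 i + H / 2])].

Definition mesh_boundary l H (Gamma : set 'rV[R]_d) :=
  Gamma `<=` frontier (domain l) /\
  exists2 S, S `<=` mesh_face l H & Gamma = \bigcup_(F in S) F.

Definition patch l H (w : set 'rV[R]_d) : set 'rV[R]_d :=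
  [set z | exists T,
     [/\ mesh l H T, closure T `&` closure w !=set0 & T z]].

Definition patchn l H (j : nat) (w : set 'rV[R]_d) := iter j (patch l H) w.

Definition Qhat l H (q : 'rV[R]_d -> R) :=
  {within domain l, continuous q} /\
  forall T, mesh l H T -> exists c : {ffun 'I_d -> bool} -> R,
    forall z, T z -> q z = \sum_a c a * \prod_i z 0 i ^+ a i.

(* [nb_free] of the [nb_nodes] basis functions, the first ones, span the
   subspace of functions vanishing on [Gamma]. *)
Record lagrange_basis l H (Gamma : set 'rV[R]_d) := LagrangeBasis {
  nb_nodes : nat;
  nb_free : nat;
  nb_free_lt : (nb_free < nb_nodes)%N;
  mnode : 'I_nb_nodes -> 'rV[R]_d;
  mnode_inj : injective mnode;
  mnode_range : range mnode = mesh_node l H;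
  phi : 'I_nb_nodes -> 'rV[R]_d -> R;
  phi_Qhat : forall i, Qhat l H (phi i);
  phi_delta : forall i j, phi i (mnode j) = (i == j)%:R;
  phi_span : forall q, Qhat l H q ->
    ((forall z, Gamma z -> q z = 0) <->
     exists c : 'I_nb_nodes -> R, forall z, domain l z ->
       q z = \sum_(i < nb_nodes | (i < nb_free)%N) c i * phi i z)
}.

Record network l := Network {
  node :> finType;
  pos : node -> 'rV[R]_d;
  pos_inj : injective pos;
  pos_domain : forall x : node, domain l (pos x);
  adj : rel node;
  adj_sym : symmetric adj;
  adj_irr : irreflexive adj;
  adj_connected : forall x y : node, connect adj x y
}.

End Geometry.

Section Scalar.
Context {R : realType} {d : nat} {l : 'rV[R]_d} (N : network l).

(* [R^o] is R as a vector space over itself, so that the space of node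
   functions is a [vectType] and its endomorphisms form 'End(nodefun). *)
Definition nodefun := {ffun N -> R^o}.
Implicit Types (u v : nodefun) (x y : N) (z : 'rV[R]_d) (w : set 'rV[R]_d).

Definition dist x y : R := enorm (pos x - pos y).

Definition dot u v : R := \sum_x u x * v x.

Definition mass_fun x v : nodefun :=
  [ffun t => if t == x then 2^-1 * (\sum_(y | adj x y) dist x y) * v x else 0].

Lemma mass_fun_linear x : linear (mass_fun x).
Proof.
move=> a u v; apply/ffunP => z; rewrite !ffunE; case: ifP => _.
  by rewrite mulrDr scalerAr.
by rewrite scaler0 addr0.
Qed.

HB.instance Definition _ x := GRing.isLinear.Build R nodefun nodefun *:%R
  (mass_fun x) (mass_fun_linear x).

Definition lap_fun x v : nodefun :=
  [ffun t => if t == x then 2^-1 * \sum_(y | adj x y) (v x - v y) / dist x y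
             else if adj x t then 2^-1 * ((v t - v x) / dist x t) else 0].

Lemma lap_fun_linear x : linear (lap_fun x).
Proof.
have E (a s t s' t' c : R) : (a * s + s' - (a * t + t')) / c =
    a * ((s - t) / c) + (s' - t') / c.
  by rewrite opprD addrACA -mulrBr mulrDl -mulrA.
move=> a u v; apply/ffunP => z; rewrite !ffunE; case: ifP => _.
  under eq_bigr do rewrite !ffunE E.
  by rewrite big_split /= -mulr_sumr mulrDr mulrCA.
case: ifP => _; first by rewrite E mulrDr mulrCA.
by rewrite scaler0 addr0.
Qed.

HB.instance Definition _ x := GRing.isLinear.Build R nodefun nodefun *:%R
  (lap_fun x) (lap_fun_linear x).

Definition mass_at x : 'End(nodefun) := linfun (mass_fun x).
Definition lap_at x : 'End(nodefun) := linfun (lap_fun x).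

Lemma mass_atE x v : mass_at x v = mass_fun x v. Proof. by rewrite lfunE. Qed.
Lemma lap_atE x v : lap_at x v = lap_fun x v. Proof. by rewrite lfunE. Qed.

(* M_x and L_x are determined by being symmetric and by their quadratic
   forms, which are the following. *)
Lemma mass_at_form x v :
  dot (mass_at x v) v = 2^-1 * \sum_(y | adj x y) dist x y * v x ^+ 2.
Proof.
rewrite /dot (bigD1 x) //= big1 => [|z /negPf zx].
  by rewrite mass_atE ffunE eqxx addr0 -mulr_suml -!mulrA expr2.
by rewrite mass_atE ffunE zx mul0r.
Qed.

Lemma mass_at_sym x u v : dot (mass_at x u) v = dot u (mass_at x v).
Proof.
apply: eq_bigr => z _; rewrite !mass_atE !ffunE.
by case: eqP => [->|_]; rewrite ?mul0r ?mulr0 // mulrCA mulrA.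
Qed.

Lemma lap_at_bilin x u v : dot (lap_at x u) v =
  2^-1 * \sum_(y | adj x y) (u x - u y) * (v x - v y) / dist x y.
Proof.
rewrite /dot (bigD1 x) //= lap_atE ffunE eqxx.
have -> : \sum_(t | t != x) lap_fun x u t * v t =
    2^-1 * \sum_(t | adj x t) (u t - u x) / dist x t * v t.
  rewrite mulr_sumr (bigID (adj x)) /= [X in _ + X]big1 => [|z]; last first.
    by move=> /andP[/negPf zx /negPf xz]; rewrite ffunE zx xz mul0r.
  rewrite addr0; apply: eq_big => [z|z /andP[/negPf zx xz]].
    by have [->|//] := eqVneq z x; rewrite adj_irr.
  by rewrite ffunE zx xz -!mulrA.
rewrite -mulrA mulr_suml -mulrDr -big_split /=; congr (_ * _).
apply: eq_bigr => y _; rewrite [RHS]mulrAC mulrBr; congr (_ + _).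
by rewrite -mulNr -mulNr opprB.
Qed.

Lemma lap_at_form x v : dot (lap_at x v) v =
  2^-1 * \sum_(y | adj x y) (v x - v y) ^+ 2 / dist x y.
Proof. by rewrite lap_at_bilin; under eq_bigr do rewrite -expr2. Qed.

Lemma lap_at_sym x u v : dot (lap_at x u) v = dot u (lap_at x v).
Proof.
have dotC (a b : nodefun) : dot a b = dot b a.
  by apply: eq_bigr => z _; rewrite mulrC.
rewrite [RHS]dotC !lap_at_bilin; congr (_ * _).
by apply: eq_bigr => y _; rewrite (mulrC (u x - u y)).
Qed.

Definition mass w : 'End(nodefun) := \sum_(x | pos x \in w) mass_at x.
Definition lap w : 'End(nodefun) := \sum_(x | pos x \in w) lap_at x.

Definition semin (A : 'End(nodefun)) v : R := Num.sqrt (dot (A v) v).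

Definition vanishes (Gamma : set 'rV[R]_d) v := forall x, Gamma (pos x) -> v x = 0.

Definition cstf (c : R) : nodefun := [ffun _ => c].

Section Assumptions.
Variables (Gamma : set 'rV[R]_d) (R0 sigma rho mu : R).

Definition homogeneity := forall r z, R0 <= r -> domain l z ->
  box l r z `<=` domain l ->
  rho <= (2 * r) ^- d * semin (mass (box l r z)) (cstf 1) ^+ 2 <= sigma * rho.

Definition locality := forall x y, adj x y -> dist x y < R0.

Definition boundary_density := forall z, Gamma z ->
  exists x, Gamma (pos x) /\ enorm (pos x - z) < R0.

(* The subgraph has node set [S] and edge relation [e]. *)
Definition connectivity := forall r z, R0 <= r -> domain l z ->
  box l r z `<=` domain l ->
  exists (S : {set N}) (e : rel N),
    [/\ symmetric e,
        forall x y, e x y -> [/\ adj x y, x \in S & y \in S],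
        forall x y, x \in S -> y \in S -> connect e x y,
        forall x y, adj x y -> box l r z (pos x) \/ box l r z (pos y) -> e x y &
        forall x y, e x y ->
          (box l (r + R0) z `&` domain l) (pos x) /\
          (box l (r + R0) z `&` domain l) (pos y)].

Definition network_assumptions :=
  [/\ 0 < R0, 0 < rho & [/\ homogeneity, locality, boundary_density & connectivity]].

Definition friedrichs := forall r z, R0 <= r -> domain l z ->
  box l r z `<=` domain l ->
  (exists x, Gamma (pos x) /\ box l r z (pos x)) ->
  forall v, vanishes Gamma v ->
    semin (mass (box l r z)) v <=
      mu * r * semin (lap (box l (r + R0) z `&` domain l)) v.

Definition poincare := forall r z, R0 <= r -> domain l z ->
  box l r z `<=` domain l ->
  forall v, exists c : R,
    semin (mass (box l r z)) (v - cstf c) <=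
      mu * r * semin (lap (box l (r + R0) z `&` domain l)) v.

End Assumptions.
End Scalar.

Arguments dot {R d l N}.
Arguments cstf {R d l N}.

Section Interpolation.
Context {R : realType} {d : nat} {l : 'rV[R]_d} (N : network l).
Context {H : R} {Gamma : set 'rV[R]_d} (B : lagrange_basis l H Gamma).

Definition varphi (i : 'I_(nb_nodes B)) : nodefun N :=
  [ffun x => phi i (pos x)].

Variables (Tk : 'I_(nb_nodes B) -> set 'rV[R]_d)
          (psi : 'I_(nb_nodes B) -> nodefun N).

(* Only the values of [psi k] on the nodes in [Tk k] are constrained; no other
   values enter [interp]. *)
Definition dual_basis := forall k,
  [/\ mesh l H (Tk k), Tk k (mnode k),
      exists c : 'I_(nb_nodes B) -> R, forall x, Tk k (pos x) ->
        psi k x = \sum_(j | mnode j \in elt_vertex l H (Tk k)) c j * varphi j x &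
      forall j, dot (mass N (Tk k) (psi k)) (varphi j) = (k == j)%:R].

Definition interp (v : nodefun N) : nodefun N :=
  \sum_(k < nb_nodes B | (k < nb_free B)%N) dot (mass N (Tk k) (psi k)) v *: varphi k.

End Interpolation.

Section Vector.
Context {R : realType} {d : nat} {l : 'rV[R]_d} (N : network l) (n : nat).

Definition vnodefun := {ffun 'I_n -> nodefun N}.
Implicit Types (u v f : vnodefun) (A : 'End(nodefun N)) (K : 'End(vnodefun)).

Definition vdot u v : R := \sum_i dot (u i) (v i).

Definition cw_fun A v : vnodefun := [ffun i => A (v i)].

Lemma cw_fun_linear A : linear (cw_fun A).
Proof. by move=> a u v; apply/ffunP => i; rewrite !ffunE linearP. Qed.

HB.instance Definition _ A := GRing.isLinear.Build R vnodefun vnodefun *:%R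
  (cw_fun A) (cw_fun_linear A).

Definition cw A : 'End(vnodefun) := linfun (cw_fun A).

Definition vsemin K v : R := Num.sqrt (vdot (K v) v).

(* [M^-1] is the inverse of the (invertible) linear map M. *)
Definition minv_norm f : R := vsemin ((cw (mass N (domain l)))^-1)%VF f.

Section Operator.
Variables (Gamma : set 'rV[R]_d) (alpha beta : R).
Variables (K : 'End(vnodefun)) (Kx : N -> 'End(vnodefun)).

Definition vvanishes v := forall i, vanishes Gamma (v i).

Definition spectral_equiv :=
  [/\ 0 < alpha, alpha <= beta &
      forall v, vvanishes v ->
        alpha * vdot (cw (lap N (domain l)) v) v <= vdot (K v) v <=
        beta * vdot (cw (lap N (domain l)) v) v].

Definition star (x : N) : {set N} := [set z | (z == x) || adj x z].

Definition local_splitting :=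
  K = \sum_x Kx x /\
  forall x,
    [/\ forall u v, vdot (Kx x u) v = vdot u (Kx x v),
        forall v, 0 <= vdot (Kx x v) v,
        forall u v, (forall z i, z \in star x -> u i z = v i z) ->
          Kx x u = Kx x v &
        forall v z i, z \notin star x -> Kx x v i z = 0].

Definition solves f u :=
  vvanishes u /\ forall v, vvanishes v -> vdot (K u) v = vdot f v.

Definition unique_solvability := forall f, exists! u, solves f u.

Definition operator_assumptions :=
  [/\ spectral_equiv, local_splitting & unique_solvability].

Definition Kloc (w : set 'rV[R]_d) : 'End(vnodefun) :=
  \sum_(x | pos x \in w) Kx x.

Section LOD.
Context {H : R} (B : lagrange_basis l H Gamma).
Variables (Tk : 'I_(nb_nodes B) -> set 'rV[R]_d)
          (psi : 'I_(nb_nodes B) -> nodefun N).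

Definition vinterp v : vnodefun := [ffun i => interp Tk psi (v i)].

Definition inW v := vvanishes v /\ vinterp v = 0.

Definition supported (w : set 'rV[R]_d) v :=
  forall x i, ~ w (pos x) -> v i x = 0.

Definition inWloc w v := inW v /\ supported w v.

Definition is_corrector (k : nat) (Q : set 'rV[R]_d -> vnodefun -> vnodefun) :=
  forall T v, mesh l H T -> vvanishes v ->
    inWloc (patchn l H k T) (Q T v) /\
    forall w, inWloc (patchn l H k T) w ->
      vdot (K (Q T v)) w = vdot (Kloc T v) w.

Definition vphi (p : 'I_n * 'I_(nb_nodes B)) : vnodefun :=
  [ffun i => if i == p.1 then varphi N p.2 else 0].

Definition lod_basis (Q : set 'rV[R]_d -> vnodefun -> vnodefun) : seq vnodefun :=
  [seq vphi p - \sum_(T \in mesh l H) Q T (vphi p)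
     | p : 'I_n * 'I_(nb_nodes B) <- enum {: 'I_n * 'I_(nb_nodes B)}%type & (p.2 < nb_free B)%N].

Definition lod_space (Q : set 'rV[R]_d -> vnodefun -> vnodefun) : {vspace vnodefun} :=
  <<lod_basis Q>>%VS.

Definition lod_solution Q f u :=
  u \in lod_space Q /\ forall v, v \in lod_space Q -> vdot (K u) v = vdot f v.

Definition inWj (j : 'I_(nb_nodes B)) v :=
  exists2 z, vvanishes z /\ supported (patch l H [set mnode j]) z &
             v = z - vinterp z.

Definition pmul (g : nodefun N) v : vnodefun :=
  [ffun i => [ffun x => g x * v i x]].

Definition decomposition_constants (C1 C2 : R) :=
  [/\ 0 < C1, 0 < C2 &
    forall w, inW w ->
      (forall wj : 'I_(nb_nodes B) -> vnodefun,
         (forall j, inWj j (wj j)) -> w = \sum_j wj j ->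
         vsemin K w ^+ 2 <= C2 * \sum_j vsemin K (wj j) ^+ 2) /\
      \sum_(j < nb_nodes B)
         vsemin K (pmul (varphi N j) w - vinterp (pmul (varphi N j) w)) ^+ 2
      <= C1 * vsemin K w ^+ 2].

End LOD.
End Operator.
End Vector.

(* Main.v *)
Require Import Defs.
From mathcomp Require Import all_boot all_order all_algebra.
From mathcomp Require Import all_classical all_reals all_analysis.
From mathcomp Require Import ring lra zify.

Set Implicit Arguments.
Unset Strict Implicit.
Unset Printing Implicit Defensive.

Import Order.TTheory GRing.Theory Num.Theory.
Import numFieldNormedType.Exports.

Local Open Scope classical_set_scope.
Local Open Scope ring_scope.

(** Why the estimate holds.  Let [I] be the interpolation operator, [W] its kernel
    in the space of functions vanishing on [Gamma], and [q m] in [W] the ideal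
    corrector of the mesh element [m] for the function [v = I u], that is, the
    energy representer on [W] of the energy of [v] on that element.  A Galerkin
    solution is the best approximation in the energy norm, so it suffices to
    estimate [u - vl] for [vl = v - \sum_m qk m], where [qk m] are the localized
    correctors of [v].  Here

      [u - vl = w0 - \sum_m (q m - qk m)],  [w0 = u - v + \sum_m q m].

    The function [w0] lies in [W] and represents [f] there, so its energy norm is
    of order [H] times the dual norm of [f], because a function of [W] is smaller
    in mass than in energy by a factor [H] ([interp0_mass]).

    The second term decays exponentially in the number of layers.  The spaces
    [W_j] split [W] with the constants [C1] and [C2], hence one step of the
    additive Schwarz iteration contracts the energy norm by [exp(-1/(C1 C2))]
    ([correction_step_contract]).  A step enlarges the support by at most five
    layers of mesh elements ([iterate_support]), so [k %/ 6] steps started at zero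
    stay in the patch of [k] layers ([iterate_inWloc]).  This gives local functions
    [x m] close to [q m].  As [qk m] is the best local approximation of [q m], the
    difference [x m - qk m] is no larger than [q m - x m]; it is local, and the
    finite overlap of the patches bounds the sum of these differences with a factor
    of order [k ^ (d / 2)] ([patchn_overlap]).  The errors [q m - x m] themselves
    sum up, by linearity, to the iteration error for [\sum_m q m]
    ([localization_error]).

    What remains are bounds that are uniform in the network and the mesh.  The
    energy of [v = I u] is controlled by that of [u] ([interp_energy]), and the
    energy norm of [u] by the dual norm of [f], by a Friedrichs inequality on the
    whole domain ([global_friedrichs]), obtained by chaining Poincare constants over
    overlapping cubes ([chain_cst]).  The same chains on the scale [H] show that all
    coefficients of [I u] near an element are close to one constant, also those
    dropped at the Dirichlet boundary ([coef_near]); both interpolation estimates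
    follow.  They need a bound on the dual functions that define [I], and this is
    the statement that the mass of a multilinear function on an element controls
    its vertex values ([vertex_bound]).  For [d > 1] a corner cube of side
    [H / (2 d)], which the condition [4 d R0 <= H] allows, proves it
    ([corner_bound]).  For [d = 1] such a cube is half of the element, and a
    function vanishing at the midpoint could escape if all the mass sat there; the
    Poincare or the Friedrichs inequality excludes this ([off_mass_bound]). *)

Local Notation patch := Defs.patch.

(** * Positive semidefinite forms *)

Section Forms.
Context {R : realType} {E : vectType R}.
Implicit Types (u v w : E) (P : E -> Prop) (b : E -> E -> R).

Definition psd_form b :=
  [/\ forall a u v w, b (a *: u + v) w = a * b u w + b v w,
      forall u v, b u v = b v u & forall u, 0 <= b u u].

Definition submodule P := P 0 /\ forall a u v, P u -> P v -> P (a *: u + v).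

Lemma submoduleD P u v : submodule P -> P u -> P v -> P (u + v).
Proof. by move=> [_ h] hu hv; rewrite -[u]scale1r; apply: h. Qed.

Lemma submoduleZ P a u : submodule P -> P u -> P (a *: u).
Proof. by move=> [h0 h] hu; rewrite -[X in P X]addr0; apply: h. Qed.

Lemma submoduleB P u v : submodule P -> P u -> P v -> P (u - v).
Proof. by move=> [_ h] hu hv; rewrite addrC -scaleN1r; apply: h. Qed.

Lemma submodule_sum P I (r : seq I) (Q : pred I) (F : I -> E) : submodule P ->
  (forall i, Q i -> P (F i)) -> P (\sum_(i <- r | Q i) F i).
Proof.
move=> hP hF; elim/big_ind: _ => // [|x y]; first exact: (proj1 hP).
exact: submoduleD.
Qed.

(** A subspace of largest dimension among those inside [P] absorbs every
    vector of [P]. *)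
Lemma submodule_vspace P : submodule P ->
  exists U : {vspace E}, forall v, v \in U <-> P v.
Proof.
move=> hP.
pose ok n := `[< exists U : {vspace E}, \dim U = n /\ forall v, v \in U -> P v >].
have ok0 : exists n, ok n.
  exists 0%N; apply/asboolP; exists 0%VS; rewrite dimv0; split=> // v.
  by rewrite memv0 => /eqP ->; exact: (proj1 hP).
have okle n : ok n -> (n <= \dim {: E})%N.
  by move=> /asboolP[U [<- _]]; apply/dimvS/subvf.
case: (ex_maxnP ok0 okle) => n /asboolP[U [dU PU]] maxn.
exists U => v; split=> [/PU //|Pv].
have /maxn : ok (\dim (U + <[v]>)%VS).
  apply/asboolP; exists (U + <[v]>)%VS; split=> // w.
  move=> /memv_addP[x xU [y /vlineP[k ->] ->]].
  by apply: submoduleD => //; [exact: PU | exact: submoduleZ].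
rewrite -dU => dle.
have /eqP -> : (U == (U + <[v]>)%VS) by rewrite eqEdim addvSl.
by rewrite (subvP (addvSr _ _)) // memv_line.
Qed.

Section Form.
Variables (b : E -> E -> R).
Hypothesis hb : psd_form b.

Lemma formPl a u v w : b (a *: u + v) w = a * b u w + b v w.
Proof. by case: hb. Qed.

Lemma formC u v : b u v = b v u. Proof. by case: hb. Qed.

Lemma form_ge0 u : 0 <= b u u. Proof. by case: hb. Qed.

Lemma formDl u v w : b (u + v) w = b u w + b v w.
Proof. by rewrite -[u in LHS]scale1r formPl mul1r. Qed.

Lemma form0l w : b 0 w = 0.
Proof. by apply/(addrI (b 0 w)); rewrite -formDl !addr0. Qed.

Lemma formZl a u w : b (a *: u) w = a * b u w.
Proof. by rewrite -[_ *: _]addr0 formPl form0l addr0. Qed.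

Lemma formBl u v w : b (u - v) w = b u w - b v w.
Proof. by rewrite formDl -scaleN1r formZl mulN1r. Qed.

Lemma formDr u v w : b w (u + v) = b w u + b w v.
Proof. by rewrite formC formDl !(formC w). Qed.

Lemma formZr a u w : b w (a *: u) = a * b w u.
Proof. by rewrite formC formZl formC. Qed.

Lemma formBr u v w : b w (u - v) = b w u - b w v.
Proof. by rewrite formC formBl !(formC w). Qed.

Lemma form_suml I (r : seq I) (Q : pred I) (F : I -> E) w :
  b (\sum_(i <- r | Q i) F i) w = \sum_(i <- r | Q i) b (F i) w.
Proof.
by apply: (big_morph (fun u => b u w)) => [u v|]; rewrite ?formDl ?form0l.
Qed.

Lemma form_sumr I (r : seq I) (Q : pred I) (F : I -> E) w :
  b w (\sum_(i <- r | Q i) F i) = \sum_(i <- r | Q i) b w (F i).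
Proof. by rewrite formC form_suml; apply: eq_bigr => i _; rewrite formC. Qed.

Lemma form_CS u v : b u v ^+ 2 <= b u u * b v v.
Proof.
have key (t : R) : 0 <= b u u + t * (2 * b u v) + t ^+ 2 * b v v.
  have := form_ge0 (u + t *: v).
  by rewrite formDl !formDr !formZl !formZr (formC v u); lra.
have := form_ge0 v; rewrite le0r => /orP[/eqP v0|v0].
  have [->|x0] := eqVneq (b u v) 0; first by rewrite v0 expr0n /= mulr0.
  have := key (- (b u u + 1) / b u v); rewrite v0 mulr0 addr0.
  have -> : - (b u u + 1) / b u v * (2 * b u v) = - (b u u + 1) * 2 by field.
  by have := form_ge0 u; lra.
have := key (- b u v / b v v).
have -> : b u u + - b u v / b v v * (2 * b u v) +
    (- b u v / b v v) ^+ 2 * b v v = b u u - b u v ^+ 2 / b v v.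
  by field; rewrite gt_eqF.
by rewrite subr_ge0 ler_pdivrMr.
Qed.

(** Young's inequality, the form of Cauchy-Schwarz that can be summed. *)
Lemma form_young t u v : 0 < t ->
  2 * b u v <= t * b u u + t^-1 * b v v.
Proof.
move=> t0; have := form_ge0 (t *: u - v).
rewrite formBl !formBr !formZl !formZr (formC v u) => h.
rewrite -(ler_pM2l t0) mulrDr (mulrA t t^-1) divff ?gt_eqF // mul1r; lra.
Qed.

Lemma form_eq0l u v : b u u = 0 -> b u v = 0.
Proof.
move=> u0; have := form_CS u v; rewrite u0 mul0r => h.
by apply/eqP; rewrite -sqrf_eq0 eq_le h sqr_ge0.
Qed.

Lemma form_normD u v : Num.sqrt (b (u + v) (u + v)) <=
  Num.sqrt (b u u) + Num.sqrt (b v v).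
Proof.
have [u0 v0] := (sqrtr_ge0 (b u u), sqrtr_ge0 (b v v)).
rewrite -(@ler_pXn2r _ 2) ?nnegrE ?addr_ge0 //.
rewrite sqr_sqrtr ?form_ge0 // sqrrD !sqr_sqrtr ?form_ge0 //.
rewrite formDl !formDr (formC v u).
have : b u v <= Num.sqrt (b u u) * Num.sqrt (b v v).
  rewrite (le_trans (ler_norm _)) // -sqrtrM ?form_ge0 //.
  by rewrite -sqrtr_sqr ler_sqrt ?form_CS // mulr_ge0 ?form_ge0.
lra.
Qed.

Section Definite.
Variables (P : E -> Prop).
Hypothesis hP : submodule P.
Hypothesis bP : forall u, P u -> b u u = 0 -> u = 0.

Lemma form_inj u v : P u -> P v -> (forall w, P w -> b u w = b v w) -> u = v.
Proof.
move=> Pu Pv e; have Puv : P (u - v) by exact: submoduleB.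
by apply/subr0_eq/bP; rewrite // formBl e // subrr.
Qed.

(** The Gram matrix of a basis of [P] has trivial kernel, hence is invertible. *)
Lemma riesz (g : E -> R) : (forall a u v, g (a *: u + v) = a * g u + g v) ->
  exists2 u, P u & forall w, P w -> b u w = g w.
Proof.
move=> gl; have [U UP] := submodule_vspace hP.
pose X := vbasis U; pose n := \dim U.
have XP (i : 'I_n) : P X`_i by apply/UP/vbasis_mem/mem_nth; rewrite size_tuple.
pose comb (c : 'rV[R]_n) := \sum_(i < n) c 0 i *: X`_i.
have combP c : P (comb c).
  by apply: submodule_sum => // i _; apply: submoduleZ.
pose G : 'M[R]_n := \matrix_(i, j) b X`_i X`_j.
have GE c (j : 'I_n) : (c *m G) 0 j = b (comb c) X`_j.
  rewrite !mxE form_suml; apply: eq_bigr => i _.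
  by rewrite mxE formZl.
have freeX : free X by exact: basis_free (vbasisP U).
have Ginv : row_free G.
  apply: inj_row_free => c cG.
  have c0 : comb c = 0.
    apply: bP => //; rewrite {2}/comb form_sumr big1 // => j _.
    by rewrite formZr -GE cG mxE mulr0.
  apply/rowP => i; rewrite mxE.
  by move/freeP: freeX => /(_ (fun i => c 0 i) c0) ->.
pose c := (\row_j g X`_j) *m invmx G.
have cG : c *m G = \row_j g X`_j.
  by rewrite /c mulmxKV // -row_free_unit.
exists (comb c) => // w Pw.
have gs I (r : seq I) (F : I -> E) :
    g (\sum_(i <- r) F i) = \sum_(i <- r) g (F i).
  have g0 : g 0 = 0.
    by have := gl 1 0 0; rewrite !scaler0 addr0 mul1r => /eqP; lra.
  apply: (big_morph g) => [u v|//].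
  by rewrite -[u in LHS]scale1r gl mul1r.
have gZ a u : g (a *: u) = a * g u.
  have g0 : g 0 = 0.
    by have := gl 1 0 0; rewrite !scaler0 addr0 mul1r => /eqP; lra.
  by rewrite -[_ *: _]addr0 gl g0 addr0.
have /UP wU := Pw; rewrite (coord_vbasis wU).
rewrite form_sumr gs; apply: eq_bigr => j _.
by rewrite formZr gZ -GE cG mxE.
Qed.

End Definite.
End Form.
End Forms.

(** * Additive subspace corrections *)

Section Schwarz.
Context {R : realType} {E : vectType R} (b : E -> E -> R).
Hypothesis hb : psd_form b.
Variables (W : E -> Prop) (J : finType) (Wj : J -> E -> Prop) (C1 C2 : R).
Hypothesis Wj_sub : forall j, submodule (Wj j).
Hypothesis WjW : forall j u, Wj j u -> W u.
Hypothesis W_def : forall u, W u -> b u u = 0 -> u = 0.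

Definition subspace_proj (P : J -> E -> E) := forall j e,
  Wj j (P j e) /\ forall w, Wj j w -> b (P j e) w = b e w.

Lemma subspace_proj_exists : exists P, subspace_proj P.
Proof.
have h (je : J * E) : exists u, Wj je.1 u /\
    forall w, Wj je.1 w -> b u w = b je.2 w.
  have [||u Pu uP] := riesz hb (Wj_sub je.1) _ (g := b je.2).
  - by move=> u /WjW /W_def.
  - by move=> a u v; rewrite formDr // formZr.
  by exists u.
by have [P hP] := choice h; exists (fun j e => P (j, e)) => j e; exact: (hP (j, e)).
Qed.

Variable P : J -> E -> E.
Hypothesis hP : subspace_proj P.

Lemma subspace_projD j u v : P j (u + v) = P j u + P j v.
Proof.
have [[[hu eu] [hv ev]] [hw ew]] := (hP j u, hP j v, hP j (u + v)).
have bd x : Wj j x -> b x x = 0 -> x = 0 by move=> /WjW /W_def.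
apply: (form_inj hb (Wj_sub j) bd hw); first exact: submoduleD.
by move=> w Ww; rewrite ew // !formDl // eu // ev.
Qed.

Lemma subspace_proj_eq0 j e : (forall w, Wj j w -> b e w = 0) -> P j e = 0.
Proof.
have [h1 h2] := hP j e => e0.
by apply: W_def; [exact: WjW h1 | rewrite h2 // e0].
Qed.

Definition correction_step (e : E) := e - C2^-1 *: \sum_j P j e.

Lemma correction_stepD u v :
  correction_step (u + v) = correction_step u + correction_step v.
Proof.
rewrite /correction_step (eq_bigr (fun j => P j u + P j v)) => [|j _].
  by rewrite big_split /= scalerDr opprD addrACA.
exact: subspace_projD.
Qed.

Hypotheses (W_sub : submodule W) (C1_gt0 : 0 < C1) (C2_gt0 : 0 < C2).

Lemma correction_stepW e : W e -> W (correction_step e).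
Proof.
move=> We; apply: submoduleB => //; apply: submoduleZ => //.
by apply: submodule_sum => // j _; apply: WjW (proj1 (hP j e)).
Qed.

Hypothesis upper : forall wj : J -> E, (forall j, Wj j (wj j)) ->
  b (\sum_j wj j) (\sum_j wj j) <= C2 * \sum_j b (wj j) (wj j).
Hypothesis lower : forall w, W w -> exists wj : J -> E,
  [/\ forall j, Wj j (wj j), w = \sum_j wj j &
      \sum_j b (wj j) (wj j) <= C1 * b w w].

(** On [W] the operator [correction_step] is self-adjoint, with its numerical range
    between 0 and [1 - 1/(C1 C2)]: [upper] keeps the range nonnegative and [lower] keeps it
    away from 1. Cauchy-Schwarz for the form of this operator turns the bound on
    the range into a bound on its norm, without the square root that estimating
    the energy of one step directly would cost. *)
Lemma correction_step_contract e : W e ->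
  b (correction_step e) (correction_step e) <=
    expR (- (C1 * C2)^-1) ^+ 2 * b e e.
Proof.
move=> We; set q := expR _.
have PW j x : Wj j (P j x) by case: (hP j x).
have PE j x w : Wj j w -> b (P j x) w = b x w by case: (hP j x) => _; apply.
pose p (x y : E) := \sum_j b x (P j y).
have pE x y : p x y = \sum_j b (P j x) (P j y).
  by apply: eq_bigr => j _; rewrite PE.
have pC x y : p x y = p y x.
  by rewrite !pE; apply: eq_bigr => j _; rewrite formC.
pose s (x y : E) := b x y - C2^-1 * p x y.
have sP : psd_form s.
  split=> [a u v w|u v|u].
  - rewrite /s /p formPl // (eq_bigr (fun j => a * b u (P j w) + b v (P j w))).
      by rewrite big_split -mulr_sumr /=; ring.
    by move=> j _; rewrite formPl.
  - by rewrite /s (formC hb u v) (pC u v).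
  rewrite /s subr_ge0 mulrC ler_pdivrMr // mulrC.
  have h1 : p u u ^+ 2 <= b u u * (C2 * p u u).
    rewrite {1}/p -form_sumr //.
    apply: le_trans (form_CS hb _ _) _; apply: ler_wpM2l; first exact: form_ge0.
    by rewrite pE; exact: upper.
  have p0 : 0 <= p u u by rewrite pE sumr_ge0 // => j _; exact: form_ge0.
  move: p0; rewrite le0r => /orP[/eqP ->|p0].
    by rewrite mulr_ge0 ?form_ge0 // ltW.
  by rewrite -(ler_pM2r p0); lra.
have q1 : 1 - (C1 * C2)^-1 <= q by exact: expR_ge1Dx.
have sle x : W x -> s x x <= q * b x x.
  move=> Wx; have [wj [wjW xE wjle]] := lower Wx.
  have h1 : 2 * b x x <= C1 * p x x + b x x.
    have {1}-> : b x x = \sum_j b (P j x) (wj j).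
      by rewrite {2}xE form_sumr //; apply: eq_bigr => j _; rewrite PE.
    rewrite mulr_sumr.
    apply: (@le_trans _ _ (\sum_j (C1 * b (P j x) (P j x) + C1^-1 * b (wj j) (wj j)))).
      by apply: ler_sum => j _; exact: form_young.
    rewrite big_split /= -!mulr_sumr pE lerD2l.
    by rewrite mulrC ler_pdivrMr // mulrC.
  have h2 : (C1 * C2)^-1 * b x x <= C2^-1 * p x x.
    rewrite invfM -mulrA mulrCA ler_pM2l ?invr_gt0 //.
    by rewrite mulrC ler_pdivrMr // mulrC; lra.
  rewrite /s; have := form_ge0 hb x; nra.
have tW := correction_stepW We.
set t := correction_step e in tW *.
have tE y : b t y = s e y.
  rewrite /t /correction_step formBl // formZl // form_suml // /s; congr (_ - _ * _).
  by rewrite pE; apply: eq_bigr => j _; rewrite (formC hb _ y) -(PE j y) // (formC hb).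
have := form_ge0 hb t; rewrite le0r => /orP[/eqP ->|t0].
  by rewrite mulr_ge0 ?sqr_ge0 // form_ge0.
have h : b t t ^+ 2 <= (q * b e e) * (q * b t t).
  rewrite {1}tE; apply: le_trans (form_CS sP _ _) _.
  by apply: ler_pM; rewrite ?(form_ge0 sP) // sle.
by rewrite -(ler_pM2r t0); move: h; lra.
Qed.

Lemma correction_iter_contract e n : W e ->
  W (iter n correction_step e) /\
  b (iter n correction_step e) (iter n correction_step e) <=
    (expR (- (C1 * C2)^-1) ^+ n) ^+ 2 * b e e.
Proof.
move=> We; elim: n => [|n [Wn IH]] /=; first by rewrite expr0 expr1n mul1r.
split; first exact: correction_stepW.
apply: le_trans (correction_step_contract Wn) _.
rewrite (exprS _ n) exprMn -[leRHS]mulrA.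
by apply: ler_wpM2l; rewrite ?sqr_ge0.
Qed.

End Schwarz.

(** * Cells of the mesh *)

Section Rows.
Context {R : realType} {d : nat}.
Implicit Types (x y z : 'rV[R]_d) (A : set 'rV[R]_d).

Lemma ball_rowP z e y : 0 < e ->
  ball z e y <-> forall i, `|z 0 i - y 0 i| < e.
Proof.
move=> e0; split=> [[_ h] i|h]; first exact: (h 0 i).
by split=> // i j; rewrite ord1; exact: h.
Qed.

Lemma closure_rowP A z : closure A z <->
  forall e, 0 < e -> exists2 y, A y & forall i, `|z 0 i - y 0 i| < e.
Proof.
split=> [h e e0|h B /nbhs_ballP[e /= e0 eB]].
  have [y [Ay /ball_rowP zy]] := h _ (nbhsx_ballx z e e0).
  by exists y => //; exact: zy.
have [y Ay zy] := h e e0; exists y; split=> //.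
by apply: eB; apply/ball_rowP.
Qed.

Lemma le_enorm z i : `|z 0 i| <= enorm z.
Proof.
rewrite /enorm -sqrtr_sqr ler_sqrt ?sumr_ge0 // => [|j _]; last exact: sqr_ge0.
by rewrite (bigD1 i) //= lerDl sumr_ge0 // => j _; exact: sqr_ge0.
Qed.

Lemma enorm_ge0 z : 0 <= enorm z. Proof. exact: sqrtr_ge0. Qed.

Lemma enorm_gt0 z : z != 0 -> 0 < enorm z.
Proof.
move=> z0; rewrite lt_neqAle enorm_ge0 andbT eq_sym.
apply: contra z0 => /eqP e0; apply/eqP/rowP => i; rewrite mxE.
by apply/eqP; rewrite -normr_le0 -e0 le_enorm.
Qed.

Lemma enormC x y : enorm (x - y) = enorm (y - x).
Proof.
congr Num.sqrt; apply: eq_bigr => i _.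
by rewrite -opprB mxE sqrrN.
Qed.

Lemma frontier_domain (l : 'rV[R]_d) z : frontier (domain l) z ->
  exists i, z 0 i <= 0 \/ l 0 i <= z 0 i.
Proof.
move=> [_ nint]; apply: contrapT => h; apply: nint.
have hz i : 0 < z 0 i /\ z 0 i < l 0 i.
  by split; rewrite ltNge; apply/negP => hi; apply: h; exists i; [left|right].
rewrite /interior /=.
apply: (@filter_forall _ _ (fun i (y : 'rV[R]_d) => 0 <= y 0 i <= l 0 i)
  (nbhs z) _) => i.
have c : (fun y : 'rV[R]_d => y 0 i) @ z --> z 0 i by exact: coord_continuous.
near=> y; apply/andP; split; apply: ltW; near: y.
- exact: (cvgr_gt _ c _ (proj1 (hz i))).
- exact: (cvgr_lt _ c _ (proj2 (hz i))).
Unshelve. all: by end_near. Qed.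

End Rows.

Section Cells.
Context {R : realType} {d : nat}.
Variables (l : 'rV[R]_d) (H : R) (p : 'I_d -> nat).
Hypothesis H_gt0 : 0 < H.
Hypothesis p_gt0 : forall i, (0 < p i)%N.
Hypothesis lE : forall i, l 0 i = (p i)%:R * H.
Implicit Types (x y z : 'rV[R]_d).

(** The index [m] stands for the mesh element with lower corner [m * H].  Since
    every index of this type is valid, sums over the mesh become sums over a
    finite type. *)
Definition cell := {dffun forall i : 'I_d, 'I_(p i)}.
Implicit Types m : cell.

Definition ccenter m : 'rV[R]_d := \row_i (((m i : nat)%:R + 2^-1) * H).

Definition elt m := box l (H / 2) (ccenter m).

Definition inside r x z := forall i, `|z 0 i - x 0 i| <= r.

Lemma eltP m z : elt m z <-> forall i, (m i : nat)%:R * H <= z 0 i /\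
  (z 0 i < ((m i).+1)%:R * H \/
   ((m i).+1 = p i /\ z 0 i = ((m i).+1)%:R * H)).
Proof.
have lo i : ccenter m 0 i - H / 2 = (m i : nat)%:R * H by rewrite mxE; lra.
have hi i : ccenter m 0 i + H / 2 = ((m i).+1)%:R * H.
  by rewrite mxE -(natr1 (m i)); lra.
have top i : (((m i).+1)%:R * H == l 0 i) = ((m i).+1 == p i).
  by rewrite lE (inj_eq (mulIf (lt0r_neq0 H_gt0))) eqr_nat.
split=> [h i|h i].
  have [h1 h2] := h i; rewrite lo in h1; split=> //.
  move: h2; rewrite hi top /Order.lteif; case: eqP => [e|_ ->]; last by left.
  by rewrite le_eqVlt => /orP[/eqP ->|->]; [right|left].
have [h1 h2] := h i; rewrite lo hi top; split=> //; rewrite /Order.lteif.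
by case: eqP => [_|ne]; case: h2 => [/ltW//|[//] _ ->].
Qed.

Lemma elt_inside m z : elt m z -> inside (H / 2) (ccenter m) z.
Proof.
move=> /eltP h i; have [h1 h2] := h i; rewrite mxE.
have {}h2 : z 0 i <= (m i).+1%:R * H by case: h2 => [/ltW//|[_ ->]].
by rewrite ler_norml; apply/andP; rewrite -(natr1 (m i)) in h2; split; lra.
Qed.

Lemma elt_domain m z : elt m z -> domain l z.
Proof.
move=> /eltP h i; have [h1 h2] := h i.
have {}h2 : z 0 i <= (m i).+1%:R * H by case: h2 => [/ltW//|[_ ->]].
have h3 : ((m i).+1%:R : R) <= (p i)%:R by rewrite ler_nat.
have h4 : (0 : R) <= (m i : nat)%:R by [].
rewrite lE; apply/andP; split; nra.
Qed.

Lemma locate z : domain l z -> exists m, elt m z.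
Proof.
move=> dz.
have h i : exists k : 'I_(p i), (k : nat)%:R * H <= z 0 i /\
    (z 0 i < (k.+1)%:R * H \/ (k.+1 = p i /\ z 0 i = (k.+1)%:R * H)).
  have /andP[z0 zl] := dz i; rewrite lE in zl.
  have /andP[t1 t2] := trunc_itv (divr_ge0 z0 (ltW H_gt0)).
  rewrite ler_pdivlMr // in t1; rewrite ltr_pdivrMr // in t2.
  have [tp|tp] := ltnP (Num.trunc (z 0 i / H)) (p i).
    by exists (Ordinal tp); split=> //; left.
  have pp : ((p i).-1 < p i)%N by rewrite prednK.
  exists (Ordinal pp) => /=; rewrite prednK //.
  have ez : z 0 i = (p i)%:R * H.
    apply/eqP; rewrite eq_le zl; apply: le_trans t1.
    by rewrite ler_pM2r // ler_nat.
  split; last by right.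
  by rewrite ez ler_pM2r // ler_nat leq_pred.
pose m : cell := finfun (fun i => projT1 (cid (h i))).
exists m; apply/eltP => i; rewrite ffunE; exact: projT2 (cid (h i)).
Qed.

Lemma elt_disj m m' z : elt m z -> elt m' z -> m = m'.
Proof.
have le m1 m2 i : elt m1 z -> elt m2 z -> (m1 i <= m2 i)%N.
  move=> /eltP/(_ i)[a1 a2] /eltP/(_ i)[b1 b2]; rewrite leqNgt; apply/negP => lt.
  have {}lt : ((m2 i).+1%:R : R) <= (m1 i : nat)%:R by rewrite ler_nat.
  case: b2 => [b2|[b2 b3]]; first by nra.
  have lt2 : (m1 i <= m2 i)%N by rewrite -ltnS b2 ltn_ord.
  have {}lt2 : ((m1 i : nat)%:R : R) <= (m2 i : nat)%:R by rewrite ler_nat.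
  by move: lt; rewrite -(natr1 (m2 i)); lra.
move=> h h'; apply/ffunP => i; apply/val_inj/eqP.
by rewrite eqn_leq !le.
Qed.

Lemma ccenter_elt m : elt m (ccenter m).
Proof.
apply/eltP => i; rewrite mxE -(natr1 (m i)); have := H_gt0; split; first by nra.
by left; nra.
Qed.

Lemma elt_inj : injective elt.
Proof.
by move=> m m' e; apply: (@elt_disj m m' (ccenter m)); rewrite -?e; exact: ccenter_elt.
Qed.

Lemma elt_centerP x : elt_center l H x <-> exists m, x = ccenter m.
Proof.
split=> [[dx xi]|[m ->]]; last first.
  split=> [|i]; first exact/elt_domain/ccenter_elt.
  rewrite mxE mulrCA mulVf ?gt_eqF // mulr1 -addrA.
  have -> : 2^-1 + 2^-1 = 1 :> R by lra.
  by rewrite natr1 rpred_nat.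
have [m mx] := locate dx; exists m; apply/rowP => i; rewrite mxE.
have /andP[xi0 xl] := dx i; rewrite lE in xl.
have /intrP[k ke] := xi i.
have xe : x 0 i = (k%:~R - 2^-1) * H.
  by rewrite -ke addrK mulrAC mulVf ?mul1r // gt_eqF.
move/eltP/(_ i): mx => [h1 h2].
have {}h2 : x 0 i <= (m i).+1%:R * H by case: h2 => [/ltW//|[_ ->]].
rewrite xe ler_pM2r // in h1; rewrite xe ler_pM2r // in h2.
rewrite xe; congr (_ * _).
suff -> : k = (m i).+1 by rewrite -pmulrn -(natr1 (m i)); lra.
have k1 : ((m i)%:Z < k).
  by rewrite -(ltr_int R) -pmulrn; lra.
have k2 : (k < (m i).+2%:Z).
  by rewrite -(ltr_int R) -pmulrn -(natr1 (m i).+1) -(natr1 (m i)); lra.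
lia.
Qed.

Lemma meshP T : mesh l H T <-> exists m, T = elt m.
Proof.
split=> [[x /elt_centerP[m ->] <-]|[m ->]]; first by exists m.
by exists (ccenter m) => //; apply/elt_centerP; exists m.
Qed.

Lemma elt_mesh m : mesh l H (elt m). Proof. by apply/meshP; exists m. Qed.

Lemma fsum_mesh (V : nmodType) (F : set 'rV[R]_d -> V) :
  \sum_(T \in mesh l H) F T = \sum_m F (elt m).
Proof.
rewrite (fsbigE [seq elt m | m <- enum {: cell}]).
- rewrite big_map [LHS]big_mkcond big_enum /=; apply: eq_bigr => m _.
  by rewrite ifT //; apply/mem_set/elt_mesh.
- by rewrite map_inj_uniq ?enum_uniq //; exact: elt_inj.
- by move=> T /= /mapP[m _ ->]; exact: elt_mesh.
- by move=> T /meshP[m ->] /mapP; case; exists m; rewrite ?mem_enum.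
Qed.

(** A point of [closure A] at distance more than [r] from [x] would have a point of
    [A] too close to it. *)
Lemma closure_inside (A : set 'rV[R]_d) r x : (forall z, A z -> inside r x z) ->
  forall z, closure A z -> inside r x z.
Proof.
move=> h z /closure_rowP cz i; rewrite leNgt; apply/negP => lt.
have [y Ay zy] := cz (`|z 0 i - x 0 i| - r) ltac:(by rewrite subr_gt0).
have := h y Ay i; have := zy i; have := ler_distD (y 0 i) (z 0 i) (x 0 i).
by move=> a b c; move: (le_lt_trans a (ltr_leD b c)); rewrite subrK ltxx.
Qed.

Lemma closure_elt m z : closure (elt m) z <-> inside (H / 2) (ccenter m) z.
Proof.
split=> [|h]; first by apply: closure_inside => y; exact: elt_inside.
apply/closure_rowP => e e0.
pose t := Num.min 1 (e / H).
have t0 : 0 < t by rewrite lt_min ltr01 divr_gt0.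
have t1 : t <= 1 by rewrite ge_min lexx.
have te : t * H <= e by rewrite -ler_pdivlMr // ge_min lexx orbT.
exists (z + t *: (ccenter m - z)).
  apply/eltP => i; have := h i; rewrite !mxE -(natr1 (m i)) ler_norml => /andP[h1 h2].
  by split; [|left]; have := H_gt0; nra.
move=> i; have := h i; rewrite !mxE => hi.
rewrite opprD addrA subrr sub0r normrN normrM (gtr0_norm t0) distrC.
apply: le_lt_trans (_ : t * (H / 2) < _); first by rewrite ler_pM2l.
by have := H_gt0; nra.
Qed.

Lemma patchP A z : patch l H A z <->
  exists m, elt m z /\ exists2 y, inside (H / 2) (ccenter m) y & closure A y.
Proof.
split=> [[T [/meshP[m ->] [y [/closure_elt Ty Ay]] Tz]]|[m [mz [y my Ay]]]].
  by exists m; split=> //; exists y.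
exists (elt m); split=> //; first exact: elt_mesh.
by exists y; split=> //; apply/closure_elt.
Qed.

Lemma patch_inside A r x : (forall z, A z -> inside r x z) ->
  forall z, patch l H A z -> inside (r + H) x z.
Proof.
move=> h z /patchP[m [mz [y my Ay]]] i.
have := closure_inside h Ay i; have := my i; have := elt_inside mz i.
rewrite !ler_norml => /andP[a1 a2] /andP[b1 b2] /andP[c1 c2].
by apply/andP; split; lra.
Qed.

Lemma patchn_inside k m z : patchn l H k (elt m) z ->
  inside ((k%:R + 2^-1) * H) (ccenter m) z.
Proof.
elim: k z => [|k IH] z.
  by move=> /elt_inside; rewrite add0r mulrC.
rewrite /patchn /= => /(patch_inside IH).
suff -> : (k%:R + 2^-1) * H + H = (k.+1%:R + 2^-1) * H by [].
by rewrite -(natr1 k); lra.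
Qed.

(** By induction on [k], through the cell whose index is one step closer to [m] in
    every coordinate; this cell and [m'] share a vertex. *)
Lemma patchn_cell k m m' : (forall i, (m' i <= m i + k)%N /\ (m i <= m' i + k)%N) ->
  elt m' `<=` patchn l H k (elt m).
Proof.
elim: k m' => [|k IH] m' h.
  suff -> : m' = m by [].
  by apply/ffunP => i; apply/val_inj/eqP; have [] := h i; rewrite eqn_leq !addn0 => -> ->.
pose near i : nat := if (m' i < m i)%N then (m' i).+1 else
  if (m i < m' i)%N then (m' i).-1 else m' i.
have nearP i : (near i < p i)%N.
  rewrite /near; have := ltn_ord (m i); have := ltn_ord (m' i).
  by case: ifP => ?; [|case: ifP => ?]; lia.
pose m1 : cell := finfun (fun i => Ordinal (nearP i)).
have m1E i : m1 i = near i :> nat by rewrite ffunE.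
have m1k : elt m1 `<=` patchn l H k (elt m).
  apply: IH => i; have := h i; rewrite m1E /near.
  by case: ifP => ?; [|case: ifP => ?]; lia.
move=> z mz; rewrite /patchn /=; apply/patchP; exists m'; split=> //.
(* A common vertex of [m1] and [m']. *)
pose y : 'rV[R]_d := \row_i (((maxn (m' i) (m1 i))%:R) * H).
exists y => [i|].
  rewrite !mxE m1E.
  have [->|->] : maxn (m' i) (near i) = m' i \/ maxn (m' i) (near i) = (m' i).+1.
    by rewrite /near; case: ifP => ?; [|case: ifP => ?]; lia.
  - by rewrite ler_norml; have := H_gt0; nra.
  - by rewrite ler_norml -(natr1 (m' i)); have := H_gt0; nra.
apply: (closure_subset m1k); apply/closure_elt => i; rewrite !mxE m1E.
have [->|->] : maxn (m' i) (near i) = near i \/ maxn (m' i) (near i) = (near i).+1.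
  by rewrite /near; case: ifP => ?; [|case: ifP => ?]; lia.
- by rewrite ler_norml; have := H_gt0; nra.
- by rewrite ler_norml -(natr1 (near i)); have := H_gt0; nra.
Qed.

End Cells.

(** * Multilinear finite element functions *)

Section Multilinear.
Context {R : realType} {d : nat}.

Lemma continuous_bigsum (T : topologicalType) (I : Type) (r : seq I)
    (F : I -> T -> R) : (forall i, continuous (F i)) ->
  continuous (fun z => \sum_(i <- r) F i z).
Proof.
move=> h z; elim: r => [|i r IH].
  (under eq_fun do rewrite big_nil); exact: cvg_cst.
(under eq_fun do rewrite big_cons); apply: cvgD => //.
exact: h.
Qed.

Lemma continuous_bigprod (T : topologicalType) (I : Type) (r : seq I)
    (F : I -> T -> R) : (forall i, continuous (F i)) ->
  continuous (fun z => \prod_(i <- r) F i z).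
Proof.
move=> h z; elim: r => [|i r IH].
  (under eq_fun do rewrite big_nil); exact: cvg_cst.
(under eq_fun do rewrite big_cons); apply: cvgM => //.
exact: h.
Qed.

Definition multilin (c : {ffun 'I_d -> bool} -> R) (z : 'rV[R]_d) :=
  \sum_a c a * \prod_i z 0 i ^+ a i.

Lemma continuous_multilin c : continuous (multilin c).
Proof.
apply: (@continuous_bigsum _ _ _
  (fun a (z : 'rV[R]_d) => c a * \prod_i z 0 i ^+ a i)) => a z.
apply: (@continuousM _ _ (fun=> c a) (fun z : 'rV[R]_d => \prod_i z 0 i ^+ a i)).
  exact: cst_continuous.
apply: (@continuous_bigprod _ _ _ (fun i (z : 'rV[R]_d) => z 0 i ^+ a i)) => i.
case: (a i) => /=.
  rewrite (_ : (fun z : 'rV[R]_d => _) = (fun z : 'rV[R]_d => z 0 i)).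
    exact: coord_continuous.
  by apply/funext => y; rewrite expr1.
rewrite (_ : (fun z : 'rV[R]_d => _) = (fun z : 'rV[R]_d => 1)).
  exact: cst_continuous.
by apply/funext => y; rewrite expr0.
Qed.

Variables (l : 'rV[R]_d) (H : R) (p : 'I_d -> nat).
Hypothesis H_gt0 : 0 < H.
Hypothesis p_gt0 : forall i, (0 < p i)%N.
Hypothesis lE : forall i, l 0 i = (p i)%:R * H.
Implicit Types (x y z : 'rV[R]_d) (m : cell p) (b : {ffun 'I_d -> bool}).

Definition vtx m b : 'rV[R]_d := \row_i ((m i + b i)%:R * H).

Definition wt1 (k : nat) (c : bool) (t : R) :=
  if c then t / H - k%:R else 1 - (t / H - k%:R).

(** The weight of the vertex [b] in multilinear interpolation on the cell [m]. *)
Definition wt m b z := \prod_i wt1 (m i) (b i) (z 0 i).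

Lemma wt_sum m z : \sum_b wt m b z = 1.
Proof.
rewrite /wt -(bigA_distr_bigA (fun i c => wt1 (m i) c (z 0 i))) big1 // => i _.
by rewrite big_bool /wt1 /= addrC subrK.
Qed.

(** The sum over the vertices factors into one-dimensional sums, in each of which
    linear interpolation is exact for the monomials of degree zero and one. *)
Lemma multilin_interp c m z :
  multilin c z = \sum_b wt m b z * multilin c (vtx m b).
Proof.
have H0 : H != 0 by rewrite gt_eqF.
rewrite /multilin; under [RHS]eq_bigr do rewrite mulr_sumr.
rewrite exchange_big /=; apply: eq_bigr => a _.
under [RHS]eq_bigr do rewrite mulrCA -big_split /=.
rewrite -[RHS]mulr_sumr; congr (_ * _).
pose F i (e : bool) := wt1 (m i) e (z 0 i) * ((m i + e)%:R * H) ^+ a i.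
rewrite (eq_bigr (fun b => \prod_i F i (b i))) => [|b _]; last first.
  by apply: eq_bigr => i _; rewrite /F mxE.
rewrite -bigA_distr_bigA; apply: eq_bigr => i _.
rewrite big_bool /F /wt1 /= addn1 addn0 -(natr1 (m i)).
by case: (a i); rewrite /= ?expr1 ?expr0; field.
Qed.

Lemma vtx_closure m b : closure (elt l H m) (vtx m b).
Proof.
apply/closure_elt => // i; rewrite !mxE natrD ler_norml.
by case: (b i) => /=; have := H_gt0; nra.
Qed.

Lemma vtx_domain m b : domain l (vtx m b).
Proof.
move=> i; rewrite lE mxE; have h : (m i + b i <= p i)%N.
  by have := ltn_ord (m i); case: (b i); lia.
by rewrite ler_pM2r // ler_nat h mulr_ge0 // ltW.
Qed.

(** A mesh function is continuous up to the vertices, which in general lie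
    outside the half-open element, so its polynomial there is the interpolant of
    its vertex values. *)
Lemma Qhat_interp q m z : Qhat l H q -> elt l H m z ->
  q z = \sum_b wt m b z * q (vtx m b).
Proof.
move=> [qc qT] mz; have [c qE] := qT _ (elt_mesh H_gt0 p_gt0 lE m).
have {}qE y : elt l H m y -> q y = multilin c y by exact: qE.
rewrite qE // (multilin_interp c m); apply: eq_bigr => b _; congr (_ * _).
set v := vtx m b; apply/esym/eqP; rewrite -subr_eq0 -normr_le0.
apply/ler_addgt0Pl => e e0; rewrite addr0.
have e2 : 0 < e / 2 by rewrite divr_gt0.
have /subspace_continuousP/(_ v (vtx_domain m b)) qv := qc.
have /cvgrPdist_lt/(_ _ e2) pv := @continuous_multilin c v.
move/cvgrPdist_lt/(_ _ e2) in qv.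
have cl := (closure_rowP _ _).1 (@vtx_closure m b).
have [r /= r0 hr] : exists2 r, 0 < r & forall y, (forall i, `|v 0 i - y 0 i| < r) ->
    `|multilin c v - multilin c y| < e / 2 /\ (domain l y -> `|q v - q y| < e / 2).
  have {}qv : \forall t \near nbhs v, domain l t -> `|q v - q t| < e / 2 by [].
  have [r /= r0 h] := (nbhs_ballP _ _).1 (filterI pv qv); exists r => // y hy.
  by apply: h; apply/ball_rowP.
have [y my vy] := cl r r0.
have [h1 h2] := hr y vy.
have {}h2 := h2 (elt_domain H_gt0 lE my).
rewrite -(qE y) // in h1; apply: le_trans (_ : `|q v - q y| + `|q y - multilin c v| <= _).
  exact: ler_distD.
by rewrite distrC in h1; lra.
Qed.

(** The basis function of the mesh node [y], as a formula that does not refer to an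
    element: its Lipschitz bound holds also for edges between elements. *)
Definition hat y z : R := \prod_i Num.max 0 (1 - `|z 0 i - y 0 i| / H).

Lemma elt_coord m z i : elt l H m z -> 0 <= z 0 i / H - (m i : nat)%:R <= 1.
Proof.
move=> /(elt_inside H_gt0 lE)/(_ i); rewrite mxE ler_norml => /andP[h1 h2].
apply/andP; split; first by rewrite subr_ge0 ler_pdivlMr //; lra.
by rewrite lerBlDr ler_pdivrMr //; lra.
Qed.

Lemma wt_ge0 m b z : elt l H m z -> 0 <= wt m b z.
Proof.
move=> mz; apply: prodr_ge0 => i _; have := elt_coord i mz.
by rewrite /wt1; case: (b i) => /andP[h1 h2] //; rewrite subr_ge0.
Qed.

Lemma wt_hat m b z : elt l H m z -> wt m b z = hat (vtx m b) z.
Proof.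
move=> mz; apply: eq_bigr => i _; rewrite mxE natrD.
have /andP[t0 t1] := elt_coord i mz; rewrite /wt1.
have -> : z 0 i - ((m i : nat)%:R + (b i : nat)%:R) * H =
   (z 0 i / H - (m i : nat)%:R - (b i : nat)%:R) * H.
  by field; rewrite gt_eqF.
rewrite normrM (gtr0_norm H_gt0) mulfK ?gt_eqF //.
case: (b i) => /=.
  by rewrite ler0_norm ?max_r; lra.
by rewrite subr0 ger0_norm ?max_r; lra.
Qed.

Lemma hat_neq0 y z : hat y z != 0 -> forall i, `|z 0 i - y 0 i| < H.
Proof.
move=> h i; rewrite ltNge; apply: contra h => h.
rewrite /hat (bigD1 i) //= max_l ?mul0r // subr_le0.
by rewrite ler_pdivlMr // mul1r.
Qed.

Lemma prod_dist_le (I : Type) (r : seq I) (F G : I -> R) :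
  (forall i, 0 <= F i <= 1) -> (forall i, 0 <= G i <= 1) ->
  `|\prod_(i <- r) F i - \prod_(i <- r) G i| <= \sum_(i <- r) `|F i - G i|.
Proof.
move=> hF hG; elim: r => [|i r IH]; first by rewrite !big_nil subrr normr0.
rewrite !big_cons.
have -> : F i * \prod_(j <- r) F j - G i * \prod_(j <- r) G j =
    (F i - G i) * \prod_(j <- r) F j +
    G i * (\prod_(j <- r) F j - \prod_(j <- r) G j) by ring.
apply: le_trans (ler_normD _ _) _; rewrite !normrM; apply: lerD.
  rewrite ler_piMr // ger0_norm; last by apply: prodr_ge0 => j _; case/andP: (hF j).
  by apply: prodr_ile1 => j _.
have /andP[g0 g1] := hG i; rewrite (ger0_norm g0).
by apply: le_trans IH; rewrite ler_piMl.
Qed.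

Lemma hat_lip x y z : `|hat y x - hat y z| <= \sum_i `|x 0 i - z 0 i| / H.
Proof.
have b01 (t : R) : 0 <= t -> 0 <= Num.max 0 (1 - t) <= 1.
  by move=> t0; rewrite le_max lexx ge_max ler01 /= lerBlDr lerDl.
apply: le_trans (prod_dist_le _ _ _) _; rewrite /=.
- by move=> i; apply: b01; rewrite divr_ge0 // ltW.
- by move=> i; apply: b01; rewrite divr_ge0 // ltW.
apply: ler_sum => i _.
have max_lip (s t : R) : `|Num.max 0 (1 - s) - Num.max 0 (1 - t)| <= `|s - t|.
  by case: (leP 0 (1 - s)) => ?; case: (leP 0 (1 - t)) => ?;
     case: (ger0P (s - t)) => ?; rewrite ler_norml; apply/andP; split; lra.
apply: le_trans (max_lip _ _) _.
rewrite -mulrBl normrM (gtr0_norm (_ : 0 < H^-1)) ?invr_gt0 //.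
rewrite ler_pM2r ?invr_gt0 //.
by apply: le_trans (ler_dist_dist _ _) _; rewrite opprB addrA subrK.
Qed.

End Multilinear.

(** * The Lagrange basis *)

Section Basis.
Context {R : realType} {d : nat}.
Variables (l : 'rV[R]_d) (H : R) (p : 'I_d -> nat).
Hypothesis H_gt0 : 0 < H.
Hypothesis p_gt0 : forall i, (0 < p i)%N.
Hypothesis lE : forall i, l 0 i = (p i)%:R * H.
Context {Gamma : set 'rV[R]_d} (B : lagrange_basis l H Gamma).
Implicit Types (x y z : 'rV[R]_d) (m : cell p) (b : {ffun 'I_d -> bool}).
Implicit Types (k : 'I_(nb_nodes B)).

Lemma vtxE m b x : x = ccenter H m ->
  (forall i, vtx H m b 0 i = if b i then x 0 i + H / 2 else x 0 i - H / 2).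
Proof. by move=> -> i; rewrite !mxE natrD; case: (b i) => /=; lra. Qed.

Lemma elt_vertexP m y :
  elt_vertex l H (elt l H m) y <-> exists b, y = vtx H m b.
Proof.
split=> [[x /(elt_centerP H_gt0 p_gt0 lE)[m' ->] [e h]]|[b ->]].
  have em : m = m' by exact: (elt_inj H_gt0 lE e).
  exists [ffun i => y 0 i == ccenter H m' 0 i + H / 2]; apply/rowP => i.
  rewrite (vtxE _ (congr1 _ (esym em))) ffunE.
  by case: eqP => // ne; case: (h i).
exists (ccenter H m); first by apply/(elt_centerP H_gt0 p_gt0 lE); exists m.
split=> // i; rewrite (vtxE b (erefl _)).
by case: (b i); [right|left].
Qed.

Lemma mesh_nodeP y : mesh_node l H y <-> exists m b, y = vtx H m b.
Proof.
split=> [[T /(meshP H_gt0 p_gt0 lE)[m ->] /elt_vertexP[b ->]]|[m [b ->]]].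
  by exists m, b.
by exists (elt l H m); [exact: elt_mesh | apply/elt_vertexP; exists b].
Qed.

Lemma node_vtx k : exists m b, mnode k = vtx H m b.
Proof. by apply/mesh_nodeP; rewrite -(mnode_range B); exists k. Qed.

Lemma vtx_inj m : injective (vtx H m).
Proof.
move=> b b' /rowP e; apply/ffunP => i; have := e i; rewrite !mxE.
move/(mulIf (lt0r_neq0 H_gt0))/eqP; rewrite eqr_nat eqn_add2l.
by case: (b i); case: (b' i).
Qed.

(** The coordinates of mesh nodes are integer multiples of [H], so a node at distance
    less than [H] from a point of the closed cell is one of its vertices. *)
Lemma node_near_vtx k m z : inside (H / 2) (ccenter H m) z ->
  (forall i, `|z 0 i - mnode k 0 i| < H) -> exists b, mnode k = vtx H m b.
Proof.
move=> mz near; have [m' [b' ke]] := node_vtx k.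
have h i : (m' i + b' i = m i)%N \/ (m' i + b' i = m i + 1)%N.
  have := mz i; have := near i; rewrite ke !mxE.
  rewrite ler_norml ltr_norml => /andP[a1 a2] /andP[c1 c2].
  have := H_gt0.
  have : ((m' i + b' i)%:R < (m i + 2)%:R :> R).
    by rewrite -(ltr_pM2r H_gt0) natrD; lra.
  have : ((m i)%:R < (m' i + b' i + 1)%:R :> R).
    by rewrite -(ltr_pM2r H_gt0) natrD; lra.
  by rewrite !ltr_nat; lia.
exists [ffun i => (m' i + b' i == m i + 1)%N]; rewrite ke; apply/rowP => i.
rewrite !mxE ffunE; congr (_%:R * _).
by case: (h i) => ->; case: eqP; lia.
Qed.

Lemma vtx_node_exists (mb : cell p * {ffun 'I_d -> bool}) : exists k, mnode k = vtx H mb.1 mb.2.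
Proof.
have : mesh_node l H (vtx H mb.1 mb.2) by apply/mesh_nodeP; exists mb.1, mb.2.
by rewrite -(mnode_range B) => -[k _ e]; exists k.
Qed.

Definition vnode m b : 'I_(nb_nodes B) := projT1 (cid (vtx_node_exists (m, b))).

Lemma mnode_vnode m b : mnode (vnode m b) = vtx H m b.
Proof. exact: projT2 (cid (vtx_node_exists (m, b))). Qed.

Lemma mnode_eq_vtx k m b : (mnode k == vtx H m b) = (k == vnode m b).
Proof. by rewrite -mnode_vnode (inj_eq (@mnode_inj R d l H Gamma B)). Qed.

Lemma phi_elt k m z : elt l H m z ->
  phi k z = \sum_b wt H m b z * (k == vnode m b)%:R.
Proof.
move=> mz; rewrite (Qhat_interp H_gt0 p_gt0 lE (phi_Qhat k) mz).
by apply: eq_bigr => b _; rewrite -mnode_vnode phi_delta.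
Qed.

Lemma phi_comb (a : 'I_(nb_nodes B) -> R) m z : elt l H m z ->
  \sum_k a k * phi k z = \sum_b wt H m b z * a (vnode m b).
Proof.
move=> mz; under eq_bigr do rewrite (phi_elt _ mz) mulr_sumr.
rewrite exchange_big /=; apply: eq_bigr => b _.
rewrite (bigD1 (vnode m b)) //= eqxx mulr1 big1 ?addr0 1?mulrC // => k /negPf ->.
by rewrite !mulr0.
Qed.

Lemma phi_sum z : domain l z -> \sum_k @phi R d l H Gamma B k z = 1.
Proof.
move=> /(locate H_gt0 p_gt0 lE)[m mz]; rewrite -(wt_sum H m z).
under eq_bigr do rewrite -[phi _ _]mul1r.
by rewrite (phi_comb (fun=> 1) mz); under eq_bigr do rewrite mulr1.
Qed.

Lemma phi_hat k z : domain l z -> phi k z = hat H (mnode k) z.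
Proof.
move=> /(locate H_gt0 p_gt0 lE)[m mz]; rewrite (phi_elt _ mz).
have [[b kb]|nk] := pselect (exists b, mnode k = vtx H m b).
  rewrite (bigD1 b) //= -mnode_eq_vtx kb eqxx mulr1 big1 ?addr0 => [|b' nb].
    exact: wt_hat.
  by rewrite -mnode_eq_vtx kb (inj_eq (@vtx_inj m)) eq_sym (negPf nb) mulr0.
rewrite big1 => [|b _]; last first.
  rewrite -mnode_eq_vtx; case: eqP => [e|_]; last by rewrite mulr0.
  by case: nk; exists b.
apply/esym/eqP/negPn/negP => /(hat_neq0 H_gt0) hz; apply: nk.
exact: node_near_vtx (elt_inside H_gt0 lE mz) hz.
Qed.

Lemma phi_near k z : domain l z -> phi k z != 0 ->
  forall i, `|z 0 i - mnode k 0 i| < H.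
Proof. by move=> dz; rewrite phi_hat //; exact: hat_neq0. Qed.

Lemma phi_lip k x z : domain l x -> domain l z ->
  `|phi k x - phi k z| <= d%:R / H * enorm (x - z).
Proof.
move=> dx dz; rewrite !phi_hat //; apply: le_trans (hat_lip H_gt0 _ _ _) _.
apply: (@le_trans _ _ (\sum_(i < d) enorm (x - z) / H)).
  apply: ler_sum => i _; rewrite ler_pM2r ?invr_gt0 //.
  by have := le_enorm (x - z) i; rewrite !mxE.
by rewrite sumr_const card_ord -mulr_natl; lra.
Qed.

Lemma phi_supp_card z : domain l z ->
  (#|[set k | @phi R d l H Gamma B k z != 0%R]%SET| <= 2 ^ d)%N.
Proof.
move=> /(locate H_gt0 p_gt0 lE)[m mz].
have -> : (2 ^ d = #|{: {ffun 'I_d -> bool}}|)%N.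
  by rewrite card_ffun card_bool card_ord.
rewrite -cardsT; apply: leq_trans (leq_imset_card (vnode m) _).
apply/subset_leq_card/fintype.subsetP => k; rewrite inE => hk.
apply/imsetP; apply: contrapT => nk; move/eqP: hk; apply.
rewrite (phi_elt _ mz) big1 // => b _.
by case: eqP => [e|_]; rewrite ?mulr0 //; case: nk; exists b.
Qed.

Lemma dual_cell k T : mesh l H T -> T (mnode k) ->
  exists m b, T = elt l H m /\ k = vnode m b.
Proof.
move=> /(meshP H_gt0 p_gt0 lE)[m ->] mk; exists m.
have [|b kb] := node_near_vtx (elt_inside H_gt0 lE mk) (k := k).
  by move=> i; rewrite subrr normr0.
by exists b; split=> //; apply/eqP; rewrite -mnode_eq_vtx kb.
Qed.

Lemma phi_free_Gamma k z : (k < nb_free B)%N -> domain l z -> Gamma z ->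
  phi k z = 0.
Proof.
move=> kf dz Gz; have [_ h] := phi_span B (phi_Qhat k); apply: h Gz.
exists (fun j => (j == k)%:R) => y dy.
rewrite (bigD1 k) //= eqxx mul1r big1 ?addr0 // => j /andP[_ /negPf ->].
by rewrite mul0r.
Qed.

(** Otherwise this basis function would be a combination of the free ones, which
    all vanish at its node. *)
Lemma nonfree_Gamma k : ~~ (k < nb_free B)%N -> exists2 z, Gamma z & phi k z != 0.
Proof.
move=> kf; apply: contrapT => h.
have /(phi_span B (phi_Qhat k))[c cE] : forall z, Gamma z -> phi k z = 0.
  move=> z Gz; apply/eqP/negPn/negP => ne; apply: h; by exists z.
have dk : domain l (mnode k).
  by have [m [b ->]] := node_vtx k; exact: vtx_domain.
move: (cE _ dk); rewrite phi_delta eqxx big1 => [/eqP|j jf].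
  by rewrite oner_eq0.
by rewrite phi_delta; case: eqP => [e|_]; rewrite ?mulr0 //; rewrite -e jf in kf.
Qed.

Hypothesis hG : mesh_boundary l H Gamma.

Lemma Gamma_domain z : Gamma z -> domain l z.
Proof.
move=> /(proj1 hG) [/closure_rowP cl _] i.
have key e : 0 < e -> - e <= z 0 i <= l 0 i + e.
  move=> /cl[y /(_ i)/andP[y0 yl] /(_ i)].
  by rewrite ltr_norml => /andP[h1 h2]; apply/andP; split; lra.
apply/andP; split; apply/ler_addgt0Pl => e /key/andP[h1 h2]; lra.
Qed.

(** A mesh node carrying a non-free basis function sees a face of [Gamma]. The
    density of the boundary nodes around the centre of this face gives a boundary
    node in the half-open element itself, not just in its closure. *)
Lemma nonfree_cell (N : network l) R0 k : boundary_density N Gamma R0 ->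
  4 * R0 <= H -> ~~ (k < nb_free B)%N ->
  exists2 m : cell p, inside (3 / 2 * H) (mnode k) (ccenter H m) &
    exists x : N, Gamma (pos x) /\ elt l H m (pos x).
Proof.
move=> dens RH /nonfree_Gamma[z Gz kz].
have zk := phi_near (Gamma_domain Gz) kz.
have [Gf [S SF GE]] := hG.
have [F SF0 Fz] : (\bigcup_(F in S) F) z by rewrite -GE.
have FG : F `<=` Gamma by rewrite GE => y Fy; exists F.
have [x' [i [/(elt_centerP H_gt0 p_gt0 lE)[m ->] Fe]]] := SF _ SF0.
exists m.
  move=> j; have zm : inside (H / 2) (ccenter H m) z.
    by apply/(closure_elt H_gt0 lE); case: Fe Fz => -> [].
  have := zm j; have := zk j; rewrite ler_norml ltr_norml ler_norml.
  by move=> /andP[a1 a2] /andP[b1 b2]; apply/andP; split; lra.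
pose s : R := if `[< F = closure (box l (H / 2) (ccenter H m)) `&`
   [set z | z 0 i = ccenter H m 0 i - H / 2] >] then - (H / 2) else H / 2.
pose y : 'rV[R]_d := \row_j (ccenter H m 0 j + (if j == i then s else 0)).
have yE j : y 0 j = ccenter H m 0 j + (if j == i then s else 0) by rewrite mxE.
have [sE Fy] : (s = - (H / 2) \/ s = H / 2) /\ F y.
  have ym : (s = - (H / 2) \/ s = H / 2) -> closure (elt l H m) y.
    move=> hs; apply/(closure_elt H_gt0 lE) => j; rewrite yE [X in X - _]addrC addrK.
    by have := H_gt0; case: eqP => _; [case: hs => ->|]; rewrite ler_norml; lra.
  have yi : y 0 i = ccenter H m 0 i + s by rewrite yE eqxx.
  move: ym yi; rewrite /s; case: asboolP => [e|ne] ym yi.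
    by split; [left | rewrite e; split; [apply: ym; left | rewrite /= yi]].
  case: Fe => // e.
  by split; [right | rewrite e; split; [apply: ym; right | rewrite /= yi]].
have Gy : Gamma y by exact: FG.
have [x [Gx xy]] := dens y Gy; exists x; split=> //.
have xyi j : `|pos x 0 j - y 0 j| < H / 4.
  apply: le_lt_trans (_ : enorm (pos x - y) < _); last by lra.
  by have := le_enorm (pos x - y) j; rewrite !mxE.
have dx := pos_domain x.
have mlt j : (0 : R) <= (m j : nat)%:R by [].
have mle j : ((m j).+1%:R : R) <= (p j)%:R by rewrite ler_nat.
have HH := H_gt0.
(* The face lies in the boundary of the domain, and its centre only touches it in
   the coordinate [i]; so [m] is the first or the last cell in this direction. *)
have side : (m i = 0%N :> nat /\ s = - (H / 2)) \/ ((m i).+1 = p i /\ s = H / 2).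
  have [j yj] := frontier_domain (Gf _ Gy).
  move: yj; rewrite !mxE; case: eqP => [->|_]; last first.
    rewrite lE; have := mlt j; have := mle j; rewrite -(natr1 (m j)).
    by move=> ? ? [?|?]; nra.
  rewrite lE; have := mlt i; have := mle i; rewrite -(natr1 (m i)) => m1 m2.
  case: sE => sE; rewrite sE => -[yj|yj].
  - left; split=> //; apply/eqP; rewrite -(eqr_nat R) eq_le mlt andbT.
    by rewrite -(ler_pM2r H_gt0); lra.
  - by nra.
  - by nra.
  right; split=> //; apply/eqP; rewrite -(eqr_nat R) eq_le mle /=.
  by rewrite -(ler_pM2r H_gt0) -(natr1 (m i)); lra.
apply/(eltP H_gt0 lE) => j; have := xyi j; rewrite !mxE ltr_norml => /andP[].
rewrite -(natr1 (m j)); case: eqP => [->|_] h1 h2; last first.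
  by split; [lra|left; lra].
have /andP[x0 xl] := dx i; rewrite lE in xl.
case: side => -[e se]; rewrite se in h1 h2.
  by move: h1 h2; rewrite e mul0r add0r => h1 h2; split=> //; left; lra.
rewrite -e -(natr1 (m i)) in xl; split; first lra.
by case: (ltrP (pos x 0 i) (((m i : nat)%:R + 1) * H)) => hx; [left|right; split=> //; lra].
Qed.

End Basis.

(** * Mass and energy of a network *)

Section Energies.
Context {R : realType} {d : nat} {l : 'rV[R]_d} (N : network l).
Implicit Types (A : set 'rV[R]_d) (u v w : nodefun N) (x y : N).

Definition nmass x : R := 2^-1 * \sum_(y | adj x y) dist x y.

Definition nenergy v x : R :=
  2^-1 * \sum_(y | adj x y) (v x - v y) ^+ 2 / dist x y.

Definition massq A v : R := \sum_(x | pos x \in A) nmass x * v x ^+ 2.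

Definition energy A v : R := \sum_(x | pos x \in A) nenergy v x.

Lemma dist_ge0 x y : 0 <= dist x y. Proof. exact: enorm_ge0. Qed.

Lemma dist_gt0 x y : adj x y -> 0 < dist x y.
Proof.
move=> xy; apply: enorm_gt0; rewrite subr_eq0 (inj_eq (@pos_inj _ _ _ N)).
by apply: contraTneq xy => ->; rewrite adj_irr.
Qed.

Lemma distC x y : dist x y = dist y x. Proof. exact: enormC. Qed.

Lemma nmass_ge0 x : 0 <= nmass x.
Proof. by rewrite mulr_ge0 ?invr_ge0 // sumr_ge0 // => y _; exact: dist_ge0. Qed.

Lemma nenergy_ge0 v x : 0 <= nenergy v x.
Proof.
rewrite mulr_ge0 ?invr_ge0 // sumr_ge0 // => y _.
by rewrite divr_ge0 ?sqr_ge0 ?dist_ge0.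
Qed.

Lemma dotC u v : dot u v = dot v u.
Proof. by apply: eq_bigr => x _; rewrite mulrC. Qed.

Lemma dotPl a u v w : dot (a *: u + v) w = a * dot u w + dot v w.
Proof.
rewrite /dot mulr_sumr -big_split /=; apply: eq_bigr => x _.
by rewrite !ffunE mulrDl mulrA.
Qed.

Lemma dot0l w : dot 0 w = 0.
Proof. by rewrite /dot big1 // => x _; rewrite ffunE mul0r. Qed.

Lemma dot_suml (I : Type) (r : seq I) (P : pred I) (F : I -> nodefun N) w :
  dot (\sum_(i <- r | P i) F i) w = \sum_(i <- r | P i) dot (F i) w.
Proof.
apply: (big_morph (fun u => dot u w)) => [u v|]; last exact: dot0l.
by have := dotPl 1 u v w; rewrite scale1r mul1r.
Qed.

Lemma dot_mass A u v :
  dot (mass N A u) v = \sum_(x | pos x \in A) nmass x * u x * v x.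
Proof.
rewrite /mass sum_lfunE dot_suml; apply: eq_bigr => x _.
rewrite /dot (bigD1 x) //= big1 => [|z /negPf zx].
  by rewrite mass_atE ffunE eqxx addr0.
by rewrite mass_atE ffunE zx mul0r.
Qed.

Lemma dot_massq A v : dot (mass N A v) v = massq A v.
Proof. by rewrite dot_mass; apply: eq_bigr => x _; rewrite -mulrA -expr2. Qed.

Lemma dot_energy A v : dot (lap N A v) v = energy A v.
Proof.
rewrite /lap sum_lfunE dot_suml; apply: eq_bigr => x _.
exact: lap_at_form.
Qed.

Lemma massq_ge0 A v : 0 <= massq A v.
Proof. by apply: sumr_ge0 => x _; rewrite mulr_ge0 ?nmass_ge0 ?sqr_ge0. Qed.

Lemma energy_ge0 A v : 0 <= energy A v.
Proof. by apply: sumr_ge0 => x _; exact: nenergy_ge0. Qed.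

Lemma sum_in_subset A A' (F : N -> R) : (forall x, 0 <= F x) -> A `<=` A' ->
  \sum_(x | pos x \in A) F x <= \sum_(x | pos x \in A') F x.
Proof.
move=> F0 AA'; rewrite [leLHS]big_mkcond [leRHS]big_mkcond; apply: ler_sum => x _.
case: ifP => [xA|_]; last by case: ifP.
by rewrite ifT //; apply/mem_set/AA'/set_mem.
Qed.

Lemma massqS A A' v : A `<=` A' -> massq A v <= massq A' v.
Proof. by apply: sum_in_subset => x; rewrite mulr_ge0 ?nmass_ge0 ?sqr_ge0. Qed.

Lemma energyS A A' v : A `<=` A' -> energy A v <= energy A' v.
Proof. by apply: sum_in_subset => x; exact: nenergy_ge0. Qed.

Lemma massq_shift A v (c c' : R) :
  massq A (v - cstf c) <= 2 * massq A (v - cstf c') +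
    2 * (c - c') ^+ 2 * massq A (cstf 1).
Proof.
rewrite /massq !mulr_sumr -big_split /=; apply: ler_sum => x _.
rewrite !ffunE expr1n mulr1; have n0 := nmass_ge0 x.
set t : R := v x; have h : (t - c) ^+ 2 <= 2 * (t - c') ^+ 2 + 2 * (c - c') ^+ 2.
  by have := sqr_ge0 ((t - c') + (c - c')); nra.
by have := ler_wpM2l n0 h; lra.
Qed.

Lemma semin_mass A v : semin (mass N A) v ^+ 2 = massq A v.
Proof. by rewrite /semin sqr_sqrtr dot_massq // massq_ge0. Qed.

Lemma semin_lap A v : semin (lap N A) v ^+ 2 = energy A v.
Proof. by rewrite /semin sqr_sqrtr dot_energy // energy_ge0. Qed.

Lemma subf0 v : v - cstf 0 = v.
Proof. by apply/ffunP => x; rewrite !ffunE subr0. Qed.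

End Energies.

Section Cover.
Context {R : realType} {d : nat} {l : 'rV[R]_d} (N : network l).
Variables (H : R) (p : 'I_d -> nat).
Hypothesis H_gt0 : 0 < H.
Hypothesis p_gt0 : forall i, (0 < p i)%N.
Hypothesis lE : forall i, l 0 i = (p i)%:R * H.

Lemma sum_cells (F : N -> R) :
  \sum_(x | pos x \in domain l) F x =
  \sum_(m : cell p) \sum_(x | pos x \in elt l H m) F x.
Proof.
under [RHS]eq_bigr do rewrite big_mkcond.
rewrite exchange_big big_mkcond /=; apply: eq_bigr => x _.
have dx := @pos_domain _ _ _ N x; rewrite (mem_set dx).
have [m mx] := locate H_gt0 p_gt0 lE dx.
rewrite (bigD1 m) //= (mem_set mx) big1 ?addr0 // => m' /eqP nm.
by case: ifP => // /set_mem m'x; case: nm; exact: (elt_disj H_gt0 lE m'x mx).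
Qed.

Definition cell_near (k : nat) (x : 'rV[R]_d) (m : cell p) : bool :=
  `[< inside (k%:R * H) x (ccenter H m) >].

(** In each coordinate the indices of such cells lie in a window of [2 k + 2]
    consecutive integers. *)
Lemma card_cell_near k x : (#|[pred m | cell_near k x m]| <= k.*2.+2 ^ d)%N.
Proof.
pose F i : pred 'I_(p i) := fun j : 'I_(p i) =>
  `|(((j : nat)%:R + 2^-1) * H - x 0 i)| <= k%:R * H.
have sub m : cell_near k x m -> m \in family F.
  move=> /asboolP h; apply/familyP => i; have := h i.
  by rewrite mxE.
apply: leq_trans (subset_leq_card (_ : [pred m | cell_near k x m] \subset family F)) _.
  by apply/fintype.subsetP => m mn; exact: (sub m mn).
rewrite card_family.
have -> : (k.*2.+2 ^ d = \prod_(i < d) k.*2.+2)%N by rewrite prod_nat_const card_ord.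
rewrite foldrE big_map big_enum /=.
apply: leq_prod => i _.
have [j0|nF] := pickP (F i); last by rewrite eq_card0.
move=> Fj0.
pose j1 := [arg min_(j < j0 | F i j) (j : nat)].
have [Fj1 j1min] : F i j1 /\ forall j, F i j -> (j1 <= j)%N.
  by rewrite /j1; case: arg_minnP.
have width j : F i j -> (j < j1 + k.*2.+2)%N.
  move: Fj1; rewrite /F !ler_norml => /andP[a1 a2] /andP[b1 b2].
  rewrite -(ltr_nat R) -(ltr_pM2r H_gt0) natrD -2!addn1 -muln2 !natrD natrM.
  by have := H_gt0; lra.
have inj : {in F i &, injective (fun j : 'I_(p i) => (j - j1)%N)}.
  move=> a b Fa Fb e; apply/val_inj => /=.
  by have := j1min _ Fa; have := j1min _ Fb; move: e => /=; lia.
pose g (j : 'I_(p i)) : 'I_(k.*2.+2) := inord (j - j1)%N.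
have ginj : {in F i &, injective g}.
  move=> a b Fa Fb /(congr1 val) /=; rewrite !inordK; first exact: inj.
    by have := width _ Fb; have := j1min _ Fb; lia.
  by have := width _ Fa; have := j1min _ Fa; lia.
by rewrite -(card_in_image ginj); apply: leq_trans (max_card _) _; rewrite card_ord.
Qed.

Lemma energy_overlap k (D : cell p -> set 'rV[R]_d) (v : nodefun N) :
  (forall m z, D m z -> inside (k%:R * H) z (ccenter H m)) ->
  \sum_m energy (D m) v <= (k.*2.+2 ^ d)%:R * energy (domain l) v.
Proof.
move=> hD; rewrite /energy; under eq_bigr do rewrite big_mkcond.
rewrite exchange_big /= mulr_sumr [leRHS]big_mkcond; apply: ler_sum => x _.
rewrite (mem_set (@pos_domain _ _ _ N x)) -big_mkcond /= sumr_const -[leLHS]mulr_natl.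
rewrite ler_wpM2r ?nenergy_ge0 // ler_nat.
apply: leq_trans (card_cell_near k (pos x)); apply: subset_leq_card.
apply/fintype.subsetP => m /asboolP mx.
by apply/asboolP/hD.
Qed.

End Cover.

(** * Poincare constants along chains of cubes *)

Section Chains.
Context {R : realType} {d : nat} {l : 'rV[R]_d} (N : network l).
Variables (Gamma : set 'rV[R]_d) (R0 sigma rho mu : R).
Hypotheses (R0_gt0 : 0 < R0) (rho_gt0 : 0 < rho).
Hypothesis homog : homogeneity N R0 sigma rho.
Implicit Types (z s : 'rV[R]_d) (v : nodefun N).

(** The centres of the cubes of half-side [r] that fit into the domain. *)
Definition admissible (r : R) z := forall i, r <= z 0 i <= l 0 i - r.

Lemma admissible_domain r z : 0 <= r -> admissible r z -> domain l z.
Proof. by move=> r0 h i; have /andP[a b] := h i; apply/andP; split; lra. Qed.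

Lemma box_inside r z y : box l r z y -> inside r z y.
Proof.
move=> h i; have [h1] := h i; rewrite /Order.lteif ler_norml.
by case: ifP => _ h2; apply/andP; split; lra.
Qed.

Lemma box_domain r z : admissible r z -> box l r z `<=` domain l.
Proof.
move=> h y /box_inside yz i; have /andP[a b] := h i; have := yz i.
by rewrite ler_norml => /andP[c e]; apply/andP; split; lra.
Qed.

Lemma boxS r r' z z' : admissible r z -> admissible r' z' ->
  (forall i, z 0 i - r <= z' 0 i - r' /\ z' 0 i + r' <= z 0 i + r) ->
  box l r' z' `<=` box l r z.
Proof.
move=> a a' h y yz i; have [h1 h2] := h i; have [y1 y2] := yz i.
have /andP[_ a2] := a i; have /andP[_ a2'] := a' i.
split; first lra.
move: y2; rewrite /Order.lteif; by case: eqP => e; case: eqP => e' y2; lra.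
Qed.

Lemma mass_bounds r z : R0 <= r -> admissible r z ->
  rho * (2 * r) ^+ d <= massq (box l r z) (cstf 1 : nodefun N) <=
  sigma * rho * (2 * r) ^+ d.
Proof.
move=> Rr a; have R00 := R0_gt0; have r0 : 0 < 2 * r by lra.
have rd : 0 < (2 * r) ^+ d by rewrite exprn_gt0.
have dz : domain l z by apply: (@admissible_domain r) => //; lra.
have := homog Rr dz (box_domain a); rewrite semin_mass.
by rewrite mulrC ler_pdivlMr // ler_pdivrMr.
Qed.

Lemma sigma_ge1 r z : R0 <= r -> admissible r z -> 1 <= sigma.
Proof.
move=> Rr a; have R00 := R0_gt0; have /andP[h1 h2] := mass_bounds Rr a.
have := le_trans h1 h2; rewrite ler_pM2r; last by rewrite exprn_gt0 //; lra.
by rewrite -{1}[rho]mul1r ler_pM2r.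
Qed.

(** The constants of two cubes whose centres are at most half a side apart can be
    compared on the cube of half the size in the middle. *)
Lemma overlap_cst r z z' v (c c' : R) : 2 * R0 <= r ->
  admissible r z -> admissible r z' -> inside r z z' ->
  (c - c') ^+ 2 * (rho * r ^+ d) <=
    2 * massq (box l r z) (v - cstf c) + 2 * massq (box l r z') (v - cstf c').
Proof.
move=> Rr a a' zz'; have R00 := R0_gt0.
pose s : 'rV[R]_d := \row_i ((z 0 i + z' 0 i) / 2).
have sa : admissible (r / 2) s.
  move=> i; rewrite mxE; have /andP[a1 a2] := a i; have /andP[a3 a4] := a' i.
  by apply/andP; split; lra.
have sub1 : box l (r / 2) s `<=` box l r z.
  apply: boxS => // i; rewrite mxE; have := zz' i; rewrite ler_norml.
  by move=> /andP[b1 b2]; split; lra.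
have sub2 : box l (r / 2) s `<=` box l r z'.
  apply: boxS => // i; rewrite mxE; have := zz' i; rewrite ler_norml.
  by move=> /andP[b1 b2]; split; lra.
have R2 : R0 <= r / 2 by lra.
have /andP[m1 _] := mass_bounds R2 sa.
have e : 2 * (r / 2) = r by lra.
rewrite e in m1.
apply: (@le_trans _ _ ((c - c') ^+ 2 * massq (box l (r / 2) s) (cstf 1 : nodefun N))).
  by rewrite ler_wpM2l ?sqr_ge0.
apply: (@le_trans _ _ (2 * massq (box l (r / 2) s) (v - cstf c) +
                       2 * massq (box l (r / 2) s) (v - cstf c'))).
  rewrite /massq !mulr_sumr -big_split /=; apply: ler_sum => x _.
  rewrite !ffunE expr1n mulr1; have n0 := nmass_ge0 x.
  set t : R := v x.
  have h : (c - c') ^+ 2 <= 2 * (t - c) ^+ 2 + 2 * (t - c') ^+ 2.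
    by have := sqr_ge0 ((t - c) + (t - c')); lra.
  by have := ler_wpM2l n0 h; lra.
by apply: lerD; rewrite ler_pM2l // massqS.
Qed.

Section Chain.
Variables (r D : R) (Z : set 'rV[R]_d) (v : nodefun N).
Hypothesis Rr : 2 * R0 <= r.
Hypothesis Za : forall z, Z z -> admissible r z.
Hypothesis Zconv : forall z z' t, Z z -> Z z' -> 0 <= t <= 1 ->
  Z (z + t *: (z' - z)).
Hypothesis Zc : forall z, Z z -> exists c, massq (box l r z) (v - cstf c) <= D.

(** The chain runs along the segment between the centres in [m.+1] equal steps, each
    of length at most [r], and compares the constants of consecutive cubes. *)
Lemma chain_cst (m : nat) z z' c c' : Z z -> Z z' ->
  inside (m.+1%:R * r) z z' ->
  massq (box l r z) (v - cstf c) <= D -> massq (box l r z') (v - cstf c') <= D ->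
  (c - c') ^+ 2 * (rho * r ^+ d) <= 4 * m.+1%:R ^+ 2 * D.
Proof.
have r0 : 0 < r by have := R0_gt0; have := Rr; lra.
have q0 : 0 < rho * r ^+ d by rewrite mulr_gt0 // exprn_gt0.
set q := rho * _ in q0 *.
move=> hz hz' zz' hc hc'.
have D0 : 0 <= D by exact: le_trans (massq_ge0 _ _) hc.
pose delta := Num.sqrt (4 * D / q).
have dE : delta ^+ 2 = 4 * D / q.
  have D4 : 0 <= 4 * D by rewrite mulr_ge0.
  by rewrite sqr_sqrtr // divr_ge0 // ltW.
have d0 : 0 <= delta by exact: sqrtr_ge0.
have step s s' a a' : Z s -> Z s' -> inside r s s' ->
    massq (box l r s) (v - cstf a) <= D ->
    massq (box l r s') (v - cstf a') <= D -> `|a - a'| <= delta.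
  move=> hs hs' ss' ha ha'.
  rewrite -(@ler_pXn2r _ 2) ?nnegrE // real_normK ?num_real //.
  rewrite dE ler_pdivlMr //; apply: le_trans (overlap_cst v a a' Rr _ _ ss') _.
  - exact: Za.
  - exact: Za.
  - lra.
suff : `|c - c'| <= m.+1%:R * delta.
  move=> h; have {}h : (c - c') ^+ 2 <= (m.+1%:R * delta) ^+ 2.
    by rewrite -real_normK ?num_real // ler_pXn2r ?nnegrE // mulr_ge0.
  move: h; rewrite exprMn dE mulrA ler_pdivlMr //; lra.
elim: m z c hz zz' hc => [|m IH] z c hz zz' hc.
  move: zz'; rewrite !mul1r => zz'; exact: (step z z' c c' hz hz' zz' hc hc').
pose t : R := m.+2%:R^-1.
have t01 : 0 <= t <= 1.
  by rewrite invr_ge0 ler0n invf_le1 ?ltr0n // ler1n.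
pose s := z + t *: (z' - z).
have hs : Z s by exact: Zconv.
have [a ha] := Zc hs.
have m2 : (m.+2%:R : R) != 0 by rewrite pnatr_eq0.
have ss' : inside (m.+1%:R * r) s z'.
  move=> i; rewrite !mxE; have := zz' i.
  have -> : z' 0 i - (z 0 i + t * (z' 0 i - z 0 i)) =
      (m.+1%:R * t) * (z' 0 i - z 0 i).
    by rewrite /t -(natr1 m.+1); field; rewrite gt_eqF // ltr_wpDl.
  move=> h; rewrite normrM ger0_norm; last first.
    by rewrite mulr_ge0 ?ler0n //; case/andP: t01.
  have -> : m.+1%:R * r = (m.+1%:R * t) * (m.+2%:R * r) by rewrite /t; field.
  by rewrite ler_wpM2l // mulr_ge0 ?ler0n //; case/andP: t01.
have zs : inside r z s.
  move=> i; rewrite !mxE.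
  have -> : z 0 i + t * (z' 0 i - z 0 i) - z 0 i = t * (z' 0 i - z 0 i) by ring.
  rewrite normrM ger0_norm; last by case/andP: t01.
  have -> : r = t * (m.+2%:R * r) by rewrite /t; field.
  by rewrite ler_wpM2l //; case/andP: t01.
have h1 := step z s c a hz hs zs hc ha.
have h2 := IH s a hs ss' ha.
apply: le_trans (ler_distD a c c') _.
by rewrite -(natr1 m.+1) mulrDl mul1r; lra.
Qed.

End Chain.

Lemma admissible_conv r z z' (t : R) : admissible r z -> admissible r z' ->
  0 <= t <= 1 -> admissible r (z + t *: (z' - z)).
Proof.
move=> a a' /andP[t0 t1] i; rewrite !mxE.
have /andP[a1 a2] := a i; have /andP[a3 a4] := a' i.
by apply/andP; split; nra.
Qed.

Hypothesis poin : poincare N R0 mu.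
Hypothesis fried : friedrichs N Gamma R0 mu.

Lemma poincare_sq r z v : R0 <= r -> admissible r z ->
  exists c, massq (box l r z) (v - cstf c) <=
    (mu * r) ^+ 2 * energy (box l (r + R0) z `&` domain l) v.
Proof.
move=> Rr a; have r0 : 0 <= r by have := R0_gt0; lra.
have [c hc] := poin Rr (admissible_domain r0 a) (box_domain a) v.
exists c; rewrite -semin_mass -semin_lap -exprMn ler_pXn2r // nnegrE.
  exact: sqrtr_ge0.
exact: le_trans (sqrtr_ge0 _) hc.
Qed.

Lemma friedrichs_sq r z v : R0 <= r -> admissible r z ->
  (exists x : N, Gamma (pos x) /\ box l r z (pos x)) -> vanishes Gamma v ->
  massq (box l r z) v <=
    (mu * r) ^+ 2 * energy (box l (r + R0) z `&` domain l) v.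
Proof.
move=> Rr a hx hv; have r0 : 0 <= r by have := R0_gt0; lra.
have hc := fried Rr (admissible_domain r0 a) (box_domain a) hx hv.
rewrite -semin_mass -semin_lap -exprMn ler_pXn2r // nnegrE.
  exact: sqrtr_ge0.
exact: le_trans (sqrtr_ge0 _) hc.
Qed.

End Chains.

(** * The Friedrichs inequality on the whole domain *)

Section GlobalFriedrichs.
Context {R : realType} {d : nat} {l : 'rV[R]_d}.
Hypothesis d_gt0 : (0 < d)%N.
Hypothesis l_gt0 : forall i, 0 < l 0 i.

Lemma shortest_side : exists i0 : 'I_d, forall i, l 0 i0 <= l 0 i.
Proof.
have [i0 _ h] := @Order.TotalTheory.arg_minP _ _ _ (Ordinal d_gt0) xpredT
  (fun i => l 0 i) isT.
by exists i0 => i; exact: h.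
Qed.

Lemma side_multiple (r : R) : 0 < r -> exists K : nat, forall i, l 0 i <= K%:R * r.
Proof.
move=> r0; exists (\max_(i < d) (Num.trunc (l 0%R i / r)%R).+1)%N => i.
have /andP[_ h] := trunc_itv (divr_ge0 (ltW (l_gt0 i)) (ltW r0)).
rewrite ltr_pdivrMr // in h; apply: le_trans (ltW h) _.
rewrite ler_pM2r // ler_nat.
exact: (leq_bigmax (F := fun i => (Num.trunc (l 0 i / r)).+1)).
Qed.

(** The cubes of half-side [r], half the shortest side of the domain, are connected
    by chains of a length that the shape of the domain bounds; one of them contains
    a boundary node, so there the constant is zero. Finitely many of these cubes,
    again in a number that depends on the domain only, cover the domain. *)
Lemma global_friedrichs : exists CF : R -> R -> R,
  forall (N : network l) Gamma (R0 sigma rho mu : R),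
  0 < R0 -> 0 < rho -> homogeneity N R0 sigma rho ->
  poincare N R0 mu -> friedrichs N Gamma R0 mu ->
  (forall i, 4 * R0 <= l 0 i) -> (exists x : N, Gamma (pos x)) ->
  forall v, vanishes Gamma v ->
    massq (domain l) v <= CF sigma mu * energy (N := N) (domain l) v.
Proof.
have [i0 i0min] := shortest_side.
pose r := l 0 i0 / 2; have r0 : 0 < r by rewrite divr_gt0 ?l_gt0.
have [K lK] := side_multiple r0.
pose nb := #|{ffun 'I_d -> 'I_K.+1}|.
exists (fun sigma mu => nb%:R *
  ((2 + 8 * sigma * 2 ^+ d * K.+1%:R ^+ 2) * (mu * r) ^+ 2)).
move=> N Gamma R0 sigma rho mu R00 rho0 hom poin fried lR [x0 Gx0] v hv.
have Rr : 2 * R0 <= r by have := lR i0; rewrite /r; lra.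
have Rr1 : R0 <= r by lra.
have lr i : 2 * r <= l 0 i by have := i0min i; rewrite /r; lra.
pose D := (mu * r) ^+ 2 * energy (N := N) (domain l) v.
have Ele z : (mu * r) ^+ 2 * energy (N := N) (box l (r + R0) z `&` domain l) v <= D.
  by rewrite ler_wpM2l ?sqr_ge0 // energyS.
pose Z := [set z | admissible (l := l) r z].
have Zc z : Z z -> exists c, massq (N := N) (box l r z) (v - cstf c) <= D.
  move=> az; have [c hc] := poincare_sq R00 poin v Rr1 az.
  by exists c; exact: le_trans hc (Ele z).
pose z0 : 'rV[R]_d := \row_i Num.min (Num.max (pos x0 0 i) r) (l 0 i - r).
have az0 : Z z0.
  move=> i; rewrite mxE le_min ge_min le_max lexx orbT /= lexx orbT andbT.
  by have := lr i; lra.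
have x0z0 : box l r z0 (pos x0).
  move=> i; rewrite mxE; have := lr i => li.
  have /andP[p0 pl] := pos_domain x0 i.
  have [hp|hp] := lerP (pos x0 0 i) (l 0 i - r).
    rewrite min_l; last by rewrite ge_max hp; lra.
    rewrite /Order.lteif; case: (lerP (pos x0 0 i) r) => h1; case: eqP => h3;
      by split; lra.
  rewrite min_r; last by rewrite le_max (ltW hp).
  by rewrite /Order.lteif subrK eqxx; split=> //; lra.
have f0 : massq (N := N) (box l r z0) (v - cstf 0) <= D.
  rewrite subf0; apply: le_trans (Ele z0).
  by apply: (friedrichs_sq R00 fried Rr1 az0 _ hv); exists x0.
pose zc (a : {ffun 'I_d -> 'I_K.+1}) : 'rV[R]_d :=
  \row_i Num.min (r + (a i : nat)%:R * r) (l 0 i - r).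
have azc a : Z (zc a).
  move=> i; rewrite mxE le_min ge_min lexx orbT andbT lerDl.
  by rewrite mulr_ge0 ?(ltW r0) //=; have := lr i; lra.
(* The last centre in each coordinate is moved back to [l 0 i - r], so that its cube
   still fits and covers the upper face. *)
have cover : massq (N := N) (domain l) v <= \sum_a massq (N := N) (box l r (zc a)) v.
  rewrite /massq; under [leRHS]eq_bigr do rewrite big_mkcond.
  rewrite exchange_big [leLHS]big_mkcond /=; apply: ler_sum => x _.
  have F0 a : 0 <= if pos x \in box l r (zc a) then nmass x * v x ^+ 2 else 0.
    by case: ifP => // _; rewrite mulr_ge0 ?nmass_ge0 ?sqr_ge0.
  have dx := @pos_domain _ _ _ N x; rewrite (mem_set dx).
  pose a : {ffun 'I_d -> 'I_K.+1} := [ffun i => inord (Num.trunc (pos x 0 i / r))].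
  have aE i : a i = Num.trunc (pos x 0 i / r) :> nat.
    rewrite ffunE inordK // ltnS -(ler_nat R).
    have /andP[p0 pl] := dx i.
    have /andP[h _] := trunc_itv (divr_ge0 p0 (ltW r0)).
    apply: le_trans h _; rewrite ler_pdivrMr //.
    exact: le_trans pl (lK i).
  rewrite (bigD1 a) //= ifT; first by rewrite lerDl sumr_ge0.
  apply/mem_set => i; rewrite mxE aE.
  have /andP[p0 pl] := dx i.
  have /andP[h1 h2] := trunc_itv (divr_ge0 p0 (ltW r0)).
  rewrite ler_pdivlMr // in h1; rewrite ltr_pdivrMr // -(natr1 (Num.trunc _)) in h2.
  have := lr i => li; rewrite /Order.lteif.
  set T := (Num.trunc _)%:R in h1 h2 *.
  case: (leP (r + T * r) (l 0 i - r)) => h3; last first.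
    by rewrite subrK eqxx; split=> //; lra.
  by case: eqP => h4; split; lra.
have q0 : 0 < rho * r ^+ d by rewrite mulr_gt0 // exprn_gt0.
have D0 : 0 <= D by exact: le_trans (massq_ge0 _ _) f0.
have s0 : 0 <= sigma by have := sigma_ge1 R00 rho0 hom Rr1 az0; lra.
have each a : massq (N := N) (box l r (zc a)) v <=
    (2 + 8 * sigma * 2 ^+ d * K.+1%:R ^+ 2) * D.
  have [c hc] := Zc _ (azc a).
  have ins : inside (K.+1%:R * r) z0 (zc a).
    move=> i; have /andP[b1 b2] := az0 i; have /andP[b3 b4] := azc a i.
    rewrite ler_norml -(natr1 K); have := lK i; have := lr i => ? ?.
    by apply/andP; split; lra.
  have h1 : (0 - c) ^+ 2 * (rho * r ^+ d) <= 4 * K.+1%:R ^+ 2 * D.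
    apply: (@chain_cst _ _ _ N R0 sigma rho R00 rho0 hom r D Z v Rr _ _ _ K z0 (zc a)) => //.
    by move=> z z' t; exact: admissible_conv.
  rewrite -[v]subf0; apply: le_trans (massq_shift _ v 0 c) _.
  have /andP[_ m1] := mass_bounds R00 hom Rr1 (azc a).
  have h2 : (0 - c) ^+ 2 * massq (N := N) (box l r (zc a)) (cstf 1) <=
      4 * K.+1%:R ^+ 2 * D * (sigma * 2 ^+ d).
    apply: le_trans (ler_wpM2l (sqr_ge0 _) m1) _.
    have -> : (0 - c) ^+ 2 * (sigma * rho * (2 * r) ^+ d) =
        (0 - c) ^+ 2 * (rho * r ^+ d) * (sigma * 2 ^+ d).
      by rewrite exprMn; ring.
    by rewrite ler_wpM2r // mulr_ge0 // exprn_ge0.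
  by lra.
apply: le_trans cover _; apply: le_trans (ler_sum _ (fun a _ => each a)) _.
by rewrite sumr_const -/nb -mulr_natl /D; lra.
Qed.

End GlobalFriedrichs.

(** * Vertex values are controlled by the mass on the element *)

Section EnergyLip.
Context {R : realType} {d : nat} {l : 'rV[R]_d} (N : network l).

(** Each edge on which a Lipschitz function varies has an end in [S], so half of
    its length is counted in the mass of [S]. *)
Lemma energy_lip (v : nodefun N) (S : pred N) (k : R) :
  (forall x y : N, adj x y -> `|v x - v y| <= k * dist x y) ->
  (forall x y : N, adj x y -> ~~ S x -> ~~ S y -> v x = v y) ->
  energy (domain l) v <= 2 * k ^+ 2 * \sum_(x | S x) nmass x.
Proof.
move=> vk vS.
pose s x : R := if S x then 1 else 0.
have s0 x : 0 <= s x by rewrite /s; case: ifP.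
have sE : \sum_(x | S x) nmass x = \sum_x \sum_(y | adj x y) 2^-1 * dist x y * s x.
  rewrite big_mkcond; apply: eq_bigr => x _; rewrite -mulr_suml -mulr_sumr -/(nmass x).
  by rewrite /s; case: ifP => _; rewrite ?mulr1 ?mulr0.
have sE' : \sum_(x | S x) nmass x = \sum_x \sum_(y | adj x y) 2^-1 * dist x y * s y.
  rewrite sE; under eq_bigr do rewrite big_mkcond; rewrite exchange_big /=.
  apply: eq_bigr => x _; rewrite [RHS]big_mkcond; apply: eq_bigr => y _.
  by rewrite adj_sym distC.
have -> : 2 * k ^+ 2 * \sum_(x | S x) nmass x =
    k ^+ 2 * \sum_x \sum_(y | adj x y) (2^-1 * dist x y * (s x + s y)).
  have -> : \sum_x \sum_(y | adj x y) 2^-1 * dist x y * (s x + s y) =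
      \sum_(x | S x) nmass x + \sum_(x | S x) nmass x.
    rewrite {1}sE sE' -big_split; apply: eq_bigr => x _; rewrite -big_split.
    by apply: eq_bigr => y _; rewrite mulrDr.
  by ring.
rewrite /energy [leLHS]big_mkcond mulr_sumr; apply: ler_sum => x _.
apply: (@le_trans _ _ (nenergy v x)); first by case: ifP => // _; exact: nenergy_ge0.
rewrite /nenergy mulr_sumr [leRHS]mulr_sumr; apply: ler_sum => y xy.
have d0 := dist_gt0 xy.
have h : (v x - v y) ^+ 2 / dist x y <= k ^+ 2 * dist x y * (s x + s y).
  have [Sx|Sx] := boolP (S x || S y); last first.
    move: Sx; rewrite negb_or => /andP[Sx Sy].
    rewrite (vS x y xy Sx Sy) subrr expr0n mul0r.
    by apply: mulr_ge0; [apply: mulr_ge0; rewrite ?sqr_ge0 // ltW|rewrite addr_ge0].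
  have s1 : 1 <= s x + s y.
    by rewrite /s; case: (S x) Sx; case: (S y) => //= _; rewrite ?addr0 ?add0r // lerDl.
  rewrite ler_pdivrMr //.
  apply: (@le_trans _ _ ((k * dist x y) ^+ 2)).
    by rewrite -real_normK ?num_real // ler_pXn2r ?nnegrE // (le_trans _ (vk x y xy)).
  by have := ler_wpM2l (sqr_ge0 (k * dist x y)) s1; rewrite !exprMn; lra.
by lra.
Qed.

End EnergyLip.

Section Corner.
Context {R : realType} {d : nat} {l : 'rV[R]_d} (N : network l).
Variables (R0 sigma rho mu : R).
Hypotheses (R0_gt0 : 0 < R0) (rho_gt0 : 0 < rho).
Hypothesis homog : homogeneity N R0 sigma rho.
Variables (H : R) (p : 'I_d -> nat).
Hypothesis H_gt0 : 0 < H.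
Hypothesis p_gt0 : forall i, (0 < p i)%N.
Hypothesis lE : forall i, l 0 i = (p i)%:R * H.
Hypothesis d_gt0 : (0 < d)%N.
Hypothesis RH : 4 * d%:R * R0 <= H.

Lemma RH4 : 4 * R0 <= H.
Proof.
apply: le_trans RH; rewrite -mulrA ler_pM2l // ler_peMl ?(ltW R0_gt0) //.
by rewrite ler1n.
Qed.

Lemma cell_admissible (m : cell p) r (z : 'rV[R]_d) :
  (forall i, (m i)%:R * H <= z 0 i - r /\ z 0 i + r <= ((m i)%:R + 1) * H) ->
  0 <= r -> admissible (l := l) r z.
Proof.
move=> h r0 i; have [h1 h2] := h i; rewrite lE.
have h3 : ((m i).+1%:R : R) <= (p i)%:R by rewrite ler_nat.
have h4 : (0 : R) <= (m i : nat)%:R by [].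
have HH := H_gt0; rewrite -(natr1 (m i)) in h3.
by apply/andP; split; nra.
Qed.

Lemma ccenter_admissible (m : cell p) : admissible (l := l) (H / 2) (ccenter H m).
Proof.
apply: (@cell_admissible m); last by rewrite divr_ge0 // ltW.
by move=> i; rewrite mxE; split; lra.
Qed.

Lemma mass_cell (m : cell p) :
  rho * H ^+ d <= massq (N := N) (elt l H m) (cstf 1) <= sigma * rho * H ^+ d.
Proof.
have r2 : R0 <= H / 2 by have := RH4; have := R0_gt0; lra.
have := mass_bounds R0_gt0 homog r2 (ccenter_admissible m).
by have -> : 2 * (H / 2) = H by lra.
Qed.

Lemma bernoulli (y : R) n : 0 <= y <= 1 -> 1 - n%:R * y <= (1 - y) ^+ n.
Proof.
move=> /andP[y0 y1]; elim: n => [|n IH]; first by rewrite expr0; lra.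
rewrite exprS -(natr1 n); have : 0 <= 1 - y by lra.
move=> /ler_wpM2l/(_ _ _ IH); apply: le_trans.
by have := mulr_ge0 (ler0n R n) (sqr_ge0 y); nra.
Qed.

(** A lower bound, on a corner cube of side [H / (2 d)], for the weight of the
    corner minus the weights of all other vertices. *)
Definition corner_gap : R := 2 * (1 - (2 * d%:R)^-1) ^+ d - 1.

Lemma corner_gap_gt0 : (1 < d)%N -> 0 < corner_gap.
Proof.
move=> d1; have dn : d = d.-1.+1 by rewrite prednK.
have : (0 < d.-1)%N by rewrite -ltnS -dn.
rewrite /corner_gap dn; set n := d.-1 => n0.
set y := (2 * n.+1%:R)^-1.
have ny : n.+1%:R * y = 2^-1 by rewrite /y invfM mulrCA divff ?mulr1 // pnatr_eq0.
have y0 : 0 < y by rewrite invr_gt0 mulr_gt0.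
have n1 : (1 : R) <= n%:R by rewrite ler1n.
rewrite -(natr1 n) in ny.
have y1 : 0 <= y <= 1 by apply/andP; split; nra.
have := bernoulli n y1; rewrite exprS => h.
have : (1 - y) * (1 - n%:R * y) <= (1 - y) * (1 - y) ^+ n.
  by rewrite ler_wpM2l //; case/andP: y1; lra.
have : 0 < n%:R * y * y by rewrite !mulr_gt0 //; lra.
by nra.
Qed.

(** Near the vertex of largest value, in a corner cube of side [H / (2 d)], the
    weight of this vertex exceeds one half, so the other vertices cannot cancel
    it; the corner cube is large enough to carry its share of the mass. *)
Lemma corner_bound (m : cell p) (g : {ffun 'I_d -> bool} -> R) (q : nodefun N) :
  0 <= corner_gap ->
  (forall x : N, elt l H m (pos x) -> q x = \sum_b wt H m b (pos x) * g b) ->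
  forall b, corner_gap ^+ 2 * (g b ^+ 2 * (rho * H ^+ d)) <=
    (2 * d%:R) ^+ d * massq (elt l H m) q.
Proof.
move=> gap0 qE b0.
have [b _ bmax] := @Order.TotalTheory.arg_maxP _ _ _ b0 xpredT
  (fun b => `|g b|) isT.
have {}bmax b' : `|g b'| <= `|g b| by exact: bmax.
have d0 : (0 : R) < d%:R by rewrite ltr0n.
have d1 : (1 : R) <= d%:R by rewrite ler1n.
pose r := H / (4 * d%:R).
have rH : 4 * d%:R * r = H by rewrite /r; field; rewrite gt_eqF.
have HH := H_gt0.
have r0 : 0 < r by rewrite divr_gt0 // mulr_gt0.
have Rr : R0 <= r by rewrite ler_pdivlMr ?mulr_gt0 // mulrC.
pose z : 'rV[R]_d := \row_i
  (if b i then ((m i)%:R + 1) * H - r else (m i)%:R * H + r).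
have rH4 : 4 * r <= H by rewrite -rH; nra.
have az : admissible (l := l) r z.
  apply: (@cell_admissible m); last exact: ltW.
  by move=> i; rewrite mxE; case: (b i); split; lra.
have sub : box l r z `<=` elt l H m.
  apply: boxS => //; first exact: ccenter_admissible.
  by move=> i; rewrite !mxE; case: (b i); split; lra.
have lam x : box l r z x -> (1 - (2 * d%:R)^-1) ^+ d <= wt H m b x.
  move=> xz; have xi := box_inside xz.
  have -> : (1 - (2 * d%:R)^-1) ^+ d = \prod_(i < d) (1 - (2 * d%:R)^-1 : R).
    by rewrite prodr_const card_ord.
  have y1 : (2 * d%:R)^-1 <= 1 :> R.
    by rewrite invf_le1 ?mulr_gt0 //; lra.
  have rHy : 2 * r / H = (2 * d%:R)^-1 by rewrite /r; field; rewrite !gt_eqF.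
  apply: ler_prod => i _; rewrite subr_ge0 y1 /=.
  have := xi i; rewrite mxE ler_norml /wt1 -rHy.
  have t1 : x 0 i = x 0 i / H * H by rewrite divfK // gt_eqF.
  have t2 : 2 * r = 2 * r / H * H by rewrite divfK // gt_eqF.
  case: (b i) => /andP[h1 h2].
    by rewrite -(ler_pM2r HH) !mulrBl mul1r -t1 -t2; lra.
  by rewrite lerD2l lerN2 -(ler_pM2r HH) !mulrBl -t1 -t2; lra.
have qge x : box l r z (pos x) ->
    corner_gap ^+ 2 * g b0 ^+ 2 <= q x ^+ 2.
  move=> xz; have mx := sub _ xz; have lx := lam _ xz.
  have wsum := wt_sum H m (pos x); rewrite (bigD1 b) //= in wsum.
  have h : corner_gap * `|g b| <= `|q x|.
    rewrite (qE x mx) (bigD1 b) //=.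
    set rest := \sum_(_ | _) _ * _.
    have hr : `|rest| <= (1 - wt H m b (pos x)) * `|g b|.
      rewrite -wsum addrAC subrr add0r mulr_suml.
      apply: le_trans (ler_norm_sum _ _ _) _; apply: ler_sum => b' _.
      by rewrite normrM ger0_norm ?ler_wpM2l ?(wt_ge0 H_gt0 lE).
    have : `|wt H m b (pos x) * g b| <= `|wt H m b (pos x) * g b + rest| + `|rest|.
      by rewrite -{1}[_ * g b](addrK rest) (le_trans (ler_normB _ _)).
    rewrite normrM ger0_norm ?(wt_ge0 H_gt0 lE) //.
    by have := normr_ge0 (g b); rewrite /corner_gap; nra.
  have h2 : corner_gap * `|g b0| <= `|q x|.
    by apply: le_trans h; rewrite ler_wpM2l.
  rewrite -[g b0 ^+ 2]real_normK ?num_real // -exprMn -[leRHS]real_normK ?num_real //.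
  by rewrite ler_pXn2r ?nnegrE ?mulr_ge0.
have /andP[m1 _] := mass_bounds R0_gt0 homog Rr az.
have h1 : corner_gap ^+ 2 * g b0 ^+ 2 * massq (N := N) (box l r z) (cstf 1) <=
    massq (elt l H m) q.
  apply: le_trans (massqS q sub).
  rewrite /massq mulr_sumr; apply: ler_sum => x /set_mem xz.
  by rewrite ffunE expr1n mulr1 mulrC ler_wpM2l ?nmass_ge0 // qge.
have e : (2 * d%:R) ^+ d * (rho * (2 * r) ^+ d) = rho * H ^+ d.
  by rewrite mulrCA -exprMn -rH; congr (_ * _ ^+ _); ring.
rewrite -e; set D := (2 * d%:R) ^+ d; set X := rho * _.
have -> : corner_gap ^+ 2 * (g b0 ^+ 2 * (D * X)) =
  D * (corner_gap ^+ 2 * g b0 ^+ 2 * X) by ring.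
apply: ler_wpM2l; first by rewrite exprn_ge0 // mulr_ge0 // ltW.
apply: le_trans h1; apply: ler_wpM2l => //.
by apply: mulr_ge0; exact: sqr_ge0.
Qed.

End Corner.

Lemma neighbour_index (a q : nat) : (a < q)%N -> (1 < q)%N -> exists j,
  [/\ (j < q)%N, j = a.+1 \/ j.+1 = a & (0 < maxn a j)%N /\ (maxn a j < q)%N].
Proof.
move=> aq q1; have [h|h] := ltnP a.+1 q.
  by exists a.+1; split=> //; [left | lia].
by exists a.-1; split; [|right|]; lia.
Qed.

Section Line.
Context {R : realType} {l : 'rV[R]_1} (N : network l).
Variables (Gamma : set 'rV[R]_1) (R0 sigma rho mu : R).
Hypotheses (R0_gt0 : 0 < R0) (rho_gt0 : 0 < rho).
Hypothesis homog : homogeneity N R0 sigma rho.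
Hypothesis loc : locality N R0.
Hypothesis poin : poincare N R0 mu.
Hypothesis fried : friedrichs N Gamma R0 mu.
Hypothesis GammaF : Gamma `<=` frontier (domain l).
Hypothesis Gamma_node : exists x : N, Gamma (pos x).
Variables (H : R) (p : 'I_1 -> nat).
Hypothesis H_gt0 : 0 < H.
Hypothesis p_gt0 : forall i, (0 < p i)%N.
Hypothesis lE : forall i, l 0 i = (p i)%:R * H.
Hypothesis RH : 4 * R0 <= H.
Variable m : cell p.

Let RH1 : 4 * 1%:R * R0 <= H. Proof. by rewrite mulr1. Qed.

Definition line_coord (x : N) : R := pos x 0 0 / H - (m 0 : nat)%:R.

Lemma line_coordE x : pos x 0 0 = (line_coord x + (m 0 : nat)%:R) * H.
Proof. by rewrite /line_coord subrK divfK // gt_eqF. Qed.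

Lemma line_coord_elt x : elt l H m (pos x) -> 0 <= line_coord x <= 1.
Proof. by move=> mx; exact: (elt_coord H_gt0 lE 0 mx). Qed.

Lemma line_coord_nelt x : ~ elt l H m (pos x) -> line_coord x < 0 \/ 1 <= line_coord x.
Proof.
move=> nx; apply: contrapT => h; apply: nx; apply/(eltP H_gt0 lE) => i.
have t0 : 0 <= line_coord x by rewrite leNgt; apply/negP => ?; apply: h; left.
have t1 : line_coord x < 1 by rewrite ltNge; apply/negP => ?; apply: h; right.
rewrite !(ord1 i) line_coordE -(natr1 (m 0)).
by have HH := H_gt0; split; [nra|left; nra].
Qed.

(** Equal to 1 on the middle quarter of the unit interval and to 0 outside the unit
    interval. In units of [H] each ramp has length [3 / 8], while edges are shorter
    than [1 / 4], so no edge jumps over a ramp. *)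
Definition plateau (t : R) : R :=
  Num.max 0 (Num.min 1 (Num.min (8 / 3 * t) (8 / 3 * (1 - t)))).

Lemma plateau1 t : 3 / 8 <= t <= 5 / 8 -> plateau t = 1.
Proof.
move=> /andP[h1 h2]; rewrite /plateau min_l ?max_r //.
by rewrite le_min; apply/andP; split; lra.
Qed.

Lemma plateau0 t : t <= 0 \/ 1 <= t -> plateau t = 0.
Proof.
move=> h; rewrite /plateau max_l // !ge_min; case: h => h.
  by apply/orP; right; apply/orP; left; lra.
by apply/orP; right; apply/orP; right; lra.
Qed.

Lemma plateau_lip s t : `|plateau s - plateau t| <= 8 / 3 * `|s - t|.
Proof.
have max0 (a b : R) : `|Num.max 0 a - Num.max 0 b| <= `|a - b|.
  have h1 := ler_norm (a - b); have h2 := ler_norm (b - a); rewrite distrC in h2.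
  by case: (leP 0 a) => ?; case: (leP 0 b) => ?; rewrite ler_norml;
    apply/andP; split; lra.
have min1 (a b : R) : `|Num.min 1 a - Num.min 1 b| <= `|a - b|.
  have h1 := ler_norm (a - b); have h2 := ler_norm (b - a); rewrite distrC in h2.
  by case: (leP 1 a) => ?; case: (leP 1 b) => ?; rewrite ler_norml;
    apply/andP; split; lra.
apply: le_trans (max0 _ _) _; apply: le_trans (min1 _ _) _.
have h1 := ler_norm (s - t); have h2 := ler_norm (t - s); rewrite distrC in h2.
by case: (leP (8 / 3 * s) (8 / 3 * (1 - s))) => ?;
  case: (leP (8 / 3 * t) (8 / 3 * (1 - t))) => ?; rewrite ler_norml;
  apply/andP; split; lra.
Qed.

Definition off_centre (x : N) : bool :=
  (pos x \in elt l H m) && ((line_coord x <= 3 / 8) || (5 / 8 <= line_coord x)).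

Definition off_mass : R := \sum_(x | off_centre x) nmass x.

Definition bump : nodefun N := [ffun x => plateau (line_coord x)].

Lemma bump_out x : ~ elt l H m (pos x) -> bump x = 0.
Proof.
move=> nx; rewrite ffunE plateau0 //.
by case: (line_coord_nelt nx) => h; [left; exact: ltW|right].
Qed.

Lemma bump_in x : elt l H m (pos x) -> ~~ off_centre x -> bump x = 1.
Proof.
move=> mx; rewrite /off_centre (mem_set mx) /= negb_or -!ltNge => /andP[h1 h2].
by rewrite ffunE plateau1 // !ltW.
Qed.

Lemma line_coord_dist x y : `|line_coord x - line_coord y| <= dist x y / H.
Proof.
have -> : line_coord x - line_coord y = (pos x 0 0 - pos y 0 0) / H.
  by rewrite /line_coord; lra.
rewrite normrM (gtr0_norm (_ : 0 < H^-1)) ?invr_gt0 // ler_pM2r ?invr_gt0 //.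
by have := le_enorm (pos x - pos y) 0; rewrite !mxE.
Qed.

Lemma bump_energy : energy (domain l) bump <= 2 * (8 / (3 * H)) ^+ 2 * off_mass.
Proof.
apply: energy_lip => [x y xy|x y xy Sx Sy].
  rewrite !ffunE; apply: le_trans (plateau_lip _ _) _.
  have h := line_coord_dist x y.
  have -> : 8 / (3 * H) * dist x y = 8 / 3 * (dist x y / H).
    by field; rewrite gt_eqF.
  by rewrite ler_pM2l //; lra.
have xyH : dist x y / H < 3 / 8.
  by rewrite ltr_pdivrMr //; have := loc xy; have := RH; have := R0_gt0; lra.
have hxy := le_lt_trans (line_coord_dist x y) xyH.
have [mx|nx] := pselect (elt l H m (pos x)); have [my|ny] := pselect (elt l H m (pos y)).
- by rewrite !bump_in.
- move: Sx; rewrite /off_centre (mem_set mx) /= negb_or -!ltNge => /andP[h1 h2].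
  by move: hxy; rewrite ltr_norml => /andP[h3 h4]; case: (line_coord_nelt ny); lra.
- move: Sy; rewrite /off_centre (mem_set my) /= negb_or -!ltNge => /andP[h1 h2].
  by move: hxy; rewrite ltr_norml => /andP[h3 h4]; case: (line_coord_nelt nx); lra.
- by rewrite !bump_out.
Qed.

Lemma off_mass_ge0 : 0 <= off_mass.
Proof. by apply: sumr_ge0 => x _; exact: nmass_ge0. Qed.

Lemma bump_cell (c : R) :
  (1 - c) ^+ 2 * massq (elt l H m) (cstf 1 : nodefun N) <=
  massq (elt l H m) (bump - cstf c) + (1 - c) ^+ 2 * off_mass.
Proof.
rewrite /massq /off_mass !mulr_sumr [X in _ <= _ + X]big_mkcond.
rewrite [leLHS]big_mkcond [X in _ <= X + _]big_mkcond -big_split /=.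
apply: ler_sum => x _; rewrite /off_centre; have n0 := nmass_ge0 x.
case: (boolP (pos x \in elt l H m)) => /= [mx|_]; last by rewrite addr0.
have [Sx|Sx] := boolP ((line_coord x <= 3 / 8) || (5 / 8 <= line_coord x)).
  by rewrite !ffunE expr1n mulr1 lerDr mulr_ge0 ?sqr_ge0.
have b1 : bump x = 1.
  by apply: bump_in; [exact: set_mem | rewrite /off_centre mx].
rewrite addr0 [cstf 1 x]ffunE expr1n mulr1 mulrC.
by rewrite [(bump - _) x]ffunE b1 !ffunE.
Qed.

Lemma massq_disjoint (A1 A2 A : set 'rV[R]_1) (v : nodefun N) :
  A1 `<=` A -> A2 `<=` A -> (forall z, A1 z -> A2 z -> False) ->
  massq A1 v + massq A2 v <= massq A v.
Proof.
move=> s1 s2 dis; rewrite /massq [leRHS]big_mkcond.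
rewrite [X in X + _]big_mkcond [X in _ + X]big_mkcond -big_split /=.
apply: ler_sum => x _; have n0 : 0 <= nmass x * v x ^+ 2.
  by rewrite mulr_ge0 ?nmass_ge0 ?sqr_ge0.
case: (boolP (pos x \in A1)) => [/set_mem x1|_].
  rewrite (mem_set (s1 _ x1)) ifF ?addr0 //; apply/negP => /set_mem x2.
  exact: dis x1 x2.
rewrite add0r; case: (boolP (pos x \in A2)) => [/set_mem x2|_].
  by rewrite (mem_set (s2 _ x2)).
by case: ifP.
Qed.

(** When [d = 1], a cube of half the side next to a vertex does not suffice: all the mass of
    the element could sit at its midpoint, where a function of opposite vertex
    values vanishes. The Poincare inequality on the element and a neighbour, or
    the Friedrichs inequality when there is no neighbour, excludes this: a plateau
    function around the midpoint has little energy if there is little mass away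
    from the midpoint. *)
Lemma off_mass_bound : rho * H <= (4 * (128 / 9 * mu ^+ 2) + 2) * off_mass.
Proof.
have HH := H_gt0; have R00 := R0_gt0; have RHl := RH.
have [/andP[mT _]] := (mass_cell R0_gt0 homog H_gt0 lE isT RH1 m, tt).
move=> _; rewrite expr1 in mT.
have S0 := off_mass_ge0; have E := bump_energy.
have m2 : 0 <= mu ^+ 2 := sqr_ge0 mu.
have [p1|p1] := eqVneq (p 0) 1%N.
  have m0 : m 0 = 0%N :> nat by have := ltn_ord (m 0); rewrite {2}p1; lia.
  have van : vanishes Gamma bump.
    move=> x /GammaF/frontier_domain[i]; rewrite (ord1 i) lE p1 => h.
    rewrite ffunE plateau0 //; move: h; rewrite line_coordE m0 addr0.
    by case=> h; [left|right]; nra.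
  have Gx : exists x : N, Gamma (pos x) /\ box l (H / 2) (ccenter H m) (pos x).
    have [x Gx] := Gamma_node; exists x; split=> //.
    have [m' m'x] := locate H_gt0 p_gt0 lE (@pos_domain _ _ _ N x).
    suff -> : m = m' by [].
    apply/ffunP => i; apply/val_inj; rewrite (ord1 i) /= m0.
    by have := ltn_ord (m' 0); rewrite {2}p1; lia.
  have r2 : R0 <= H / 2 by lra.
  have := friedrichs_sq R0_gt0 fried r2 (ccenter_admissible H_gt0 lE m) Gx van.
  have Ele := energyS (N := N) bump (@subIsetr _ (box l (H / 2 + R0) (ccenter H m)) (domain l)).
  move=> h; have {h} h := le_trans h (ler_wpM2l (sqr_ge0 _) (le_trans Ele E)).
  have e : (mu * (H / 2)) ^+ 2 * (2 * (8 / (3 * H)) ^+ 2 * off_mass) =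
      32 / 9 * mu ^+ 2 * off_mass by field; rewrite gt_eqF.
  rewrite e in h; have := bump_cell 0; rewrite subf0 subr0 expr1n !mul1r => h2.
  have : massq (box l (H / 2) (ccenter H m)) bump = massq (elt l H m) bump by [].
  have : 0 <= mu ^+ 2 * off_mass by exact: mulr_ge0.
  by move=> h3 h4; rewrite h4 in h; lra.
have p2 : (1 < p 0%R)%N by have := p_gt0 0; case: (p 0%R) p1 => [|[]].
have [j [jp jm maxl]] := neighbour_index (ltn_ord (m 0%R)) p2.
(* The index of the neighbour as a dependent function on the one-element type. *)
pose jf (i : 'I_1) : 'I_(p i) := eq_rect_r (fun i => 'I_(p i)) (Ordinal jp) (ord1 i).
pose m' : cell p := finfun jf.
have m'E : m' 0 = j :> nat.
  by rewrite ffunE /jf; rewrite (_ : ord1 0 = erefl) //; exact: eq_irrelevance.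
pose z : 'rV[R]_1 := \row_i ((maxn (m 0%R) j)%:R * H).
have lo : (1 : R) <= (maxn (m 0%R) j)%:R by rewrite ler1n; case: maxl.
have hi : (maxn (m 0%R) j)%:R + 1 <= (p 0%R)%:R :> R by rewrite natr1 ler_nat; case: maxl.
have az : admissible (l := l) H z.
  by move=> i; rewrite mxE lE (ord1 i); apply/andP; split; nra.
(* The neighbour is the left or the right one; [maxn (m 0) j] is the coordinate of
   the common vertex. *)
have nn : ((maxn (m 0%R) j)%:R = (m 0 : nat)%:R :> R /\ (j%:R + 1 = (m 0 : nat)%:R :> R)) \/
  ((maxn (m 0%R) j)%:R = (m 0 : nat)%:R + 1 :> R /\ (j%:R = (m 0 : nat)%:R + 1 :> R)).
  case: jm => e.
    by right; rewrite e (maxn_idPr _) ?leqnSn // -(natr1 (m 0)).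
  by left; rewrite (maxn_idPl _) -e ?leqnSn // natr1.
have sub1 : elt l H m `<=` box l H z.
  apply: boxS => //; first exact: (ccenter_admissible H_gt0 lE).
  by move=> i; rewrite !mxE (ord1 i); case: nn => -[-> _]; split; lra.
have sub2 : elt l H m' `<=` box l H z.
  apply: boxS => //; first exact: (ccenter_admissible H_gt0 lE).
  by move=> i; rewrite !mxE (ord1 i) m'E; case: nn => -[-> jE]; split; nra.
have mm' : m != m'.
  apply/eqP => e; have {}e : m 0 = j :> nat by rewrite -m'E -e.
  by case: jm => [|/esym]; rewrite e => /n_Sn.
have [/andP[mT' _]] := (mass_cell R0_gt0 homog H_gt0 lE isT RH1 m', tt).
move=> _; rewrite expr1 in mT'.
have r1 : R0 <= H by lra.
have [c hc] := poincare_sq R0_gt0 poin bump r1 az.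
have Ele := energyS (N := N) bump (@subIsetr _ (box l (H + R0) z) (domain l)).
have {hc} h := le_trans hc (ler_wpM2l (sqr_ge0 _) (le_trans Ele E)).
have e : (mu * H) ^+ 2 * (2 * (8 / (3 * H)) ^+ 2 * off_mass) =
      128 / 9 * mu ^+ 2 * off_mass by field; rewrite gt_eqF.
rewrite e in h.
have dis z' : elt l H m z' -> elt l H m' z' -> False.
  by move=> h1 h2; move/eqP: mm'; apply; exact: (elt_disj H_gt0 lE h1 h2).
have hs := massq_disjoint (bump - cstf c) sub1 sub2 dis.
have h1 := bump_cell c.
have h2 : c ^+ 2 * massq (elt l H m') (cstf 1 : nodefun N) <=
    massq (elt l H m') (bump - cstf c).
  rewrite /massq mulr_sumr; apply: ler_sum => x /set_mem xm'.
  have b0 : bump x = 0 by apply: bump_out => xm; exact: dis xm xm'.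
  by rewrite [(bump - _) x]ffunE b0 !ffunE add0r sqrrN expr1n mulr1 mulrC.
have q0 : 0 < rho * H by rewrite mulr_gt0.
set q := rho * H in q0 mT mT' *; set S := off_mass in S0 h h1 *.
set M := mu ^+ 2 in m2 h *.
have MS : 0 <= M * S by exact: mulr_ge0.
have [Sq|Sq] := lerP (q / 2) S; first by lra.
have hA : (1 - c) ^+ 2 * (q / 2) + c ^+ 2 * (q / 2) <= 128 / 9 * M * S.
  have a1 : (1 - c) ^+ 2 * (q / 2) <= (1 - c) ^+ 2 * (massq (elt l H m) (cstf 1 : nodefun N) - S).
    by rewrite ler_wpM2l ?sqr_ge0 //; lra.
  have a2 : c ^+ 2 * (q / 2) <= c ^+ 2 * massq (elt l H m') (cstf 1 : nodefun N).
    by rewrite ler_wpM2l ?sqr_ge0 //; lra.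
  by lra.
have : 0 <= (1 - 2 * c) ^+ 2 * q by rewrite mulr_ge0 ?sqr_ge0 // ltW.
by lra.
Qed.

(** If the vertex values [a] and [b] are not nearly opposite, the zero of the linear
    function is at least at [8 / 15], away from the half of the element next to the
    larger value. *)
Lemma line_case (a b t : R) : `|b| <= `|a| -> - (7 / 8) * a ^+ 2 <= a * b ->
  0 <= t <= 2^-1 -> a ^+ 2 / 256 <= (a * (1 - t) + b * t) ^+ 2.
Proof.
have [->|a0] := eqVneq a 0; first by move=> *; rewrite expr0n /= mul0r sqr_ge0.
move=> ba ab /andP[t0 t1].
have a2 : 0 < a ^+ 2 by rewrite exprn_even_gt0.
have h : a ^+ 2 / 16 <= a * (a * (1 - t) + b * t).
  have := ler_wpM2r t0 ab.
  have := ler_wpM2r (ltW a2) t1; lra.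
have h2 : (a ^+ 2 / 16) ^+ 2 <= (a * (a * (1 - t) + b * t)) ^+ 2.
  by rewrite ler_pXn2r ?nnegrE // ?(le_trans _ h) // divr_ge0 // ltW.
by rewrite -(ler_pM2l a2); move: h2; rewrite [X in _ <= X]exprMn; lra.
Qed.

(** If they are nearly opposite, the zero is close to the midpoint, away from both
    outer parts. *)
Lemma line_case' (a b t : R) : `|b| <= `|a| -> a * b <= - (7 / 8) * a ^+ 2 ->
  0 <= t <= 3 / 8 \/ 5 / 8 <= t <= 1 ->
  a ^+ 2 / 256 <= (a * (1 - t) + b * t) ^+ 2.
Proof.
have [->|a0] := eqVneq a 0; first by move=> *; rewrite expr0n /= mul0r sqr_ge0.
move=> ba ab ht.
have a2 : 0 < a ^+ 2 by rewrite exprn_even_gt0.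
have ab2 : - a ^+ 2 <= a * b.
  have : `|a * b| <= a ^+ 2.
    by rewrite normrM -[a ^+ 2]real_normK ?num_real // expr2 ler_wpM2l.
  by rewrite ler_norml => /andP[].
have h2 : (a ^+ 2 / 16) ^+ 2 <= (a * (a * (1 - t) + b * t)) ^+ 2.
  rewrite -[leRHS]real_normK ?num_real // ler_pXn2r ?nnegrE //.
    case: ht => /andP[t0 t1].
      apply: le_trans (ler_norm _).
      by have := ler_wpM2r t0 ab2; have := ler_wpM2r (ltW a2) t1; lra.
    rewrite -normrN; apply: le_trans (ler_norm _).
    have t00 : 0 <= t by lra.
    by have := ler_wpM2r t00 ab; have := ler_wpM2r (ltW a2) t0; lra.
  by rewrite divr_ge0 // ltW.
by rewrite -(ler_pM2l a2); move: h2; rewrite [X in _ <= X]exprMn; lra.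
Qed.

(** Here [tau] is the coordinate that starts at the vertex with the larger value. *)
Lemma line_end (a b : R) (q : nodefun N) (tau : N -> R) (z : 'rV[R]_1) :
  `|b| <= `|a| -> admissible (l := l) (H / 4) z ->
  box l (H / 4) z `<=` elt l H m ->
  (forall x, elt l H m (pos x) -> q x = a * (1 - tau x) + b * tau x) ->
  (forall x, box l (H / 4) z (pos x) -> 0 <= tau x <= 2^-1) ->
  (forall x, off_centre x -> 0 <= tau x <= 3 / 8 \/ 5 / 8 <= tau x <= 1) ->
  a ^+ 2 * (rho * H) <=
    256 * (4 * (128 / 9 * mu ^+ 2) + 2) * massq (elt l H m) q.
Proof.
move=> ba az sub qE th tS.
have HH := H_gt0; have R00 := R0_gt0; have RHl := RH.
have S := off_mass_bound; have m2 : 0 <= mu ^+ 2 := sqr_ge0 mu.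
have q0 := massq_ge0 (elt l H m) q.
have a20 := sqr_ge0 a.
set C := 4 * (128 / 9 * mu ^+ 2) + 2 in S *.
have C2 : 2 <= C by rewrite /C; lra.
have [ab|ab] := lerP (- (7 / 8) * a ^+ 2) (a * b).
  have r4 : R0 <= H / 4 by lra.
  have /andP[mh _] := mass_bounds R0_gt0 homog r4 az.
  rewrite expr1 in mh.
  have h : a ^+ 2 / 256 * massq (box l (H / 4) z) (cstf 1 : nodefun N) <= massq (elt l H m) q.
    apply: le_trans (massqS q sub).
    rewrite /massq mulr_sumr; apply: ler_sum => x /set_mem xz.
    rewrite ffunE expr1n mulr1 mulrC ler_wpM2l ?nmass_ge0 //.
    by rewrite (qE _ (sub _ xz)); apply: line_case => //; exact: th.
  have := ler_wpM2l a20 mh; have := ler_wpM2r q0 C2; lra.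
have h : a ^+ 2 / 256 * off_mass <= massq (elt l H m) q.
  rewrite /massq mulr_sumr [leLHS]big_mkcond [leRHS]big_mkcond; apply: ler_sum => x _.
  have [Sx|_] := ifP; last first.
    by case: ifP => // _; rewrite mulr_ge0 ?nmass_ge0 ?sqr_ge0.
  have mx : pos x \in elt l H m by case/andP: (Sx).
  rewrite mx mulrC ler_wpM2l ?nmass_ge0 //.
  rewrite qE; last exact: set_mem.
  by apply: line_case' => //; [exact: ltW | exact: tS].
have C0 : 0 <= C by lra.
have := ler_wpM2l a20 S; have := ler_wpM2l C0 h; lra.
Qed.

Lemma line_bound (g : {ffun 'I_1 -> bool} -> R) (q : nodefun N) :
  (forall x : N, elt l H m (pos x) -> q x = \sum_b wt H m b (pos x) * g b) ->
  forall b, g b ^+ 2 * (rho * H) <=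
    256 * (4 * (128 / 9 * mu ^+ 2) + 2) * massq (elt l H m) q.
Proof.
move=> qE b; have HH := H_gt0.
pose cb (c : bool) : {ffun 'I_1 -> bool} := [ffun=> c].
have bE (b' : {ffun 'I_1 -> bool}) : b' = cb (b' 0) by apply/ffunP => i; rewrite ffunE (ord1 i).
have qE' x : elt l H m (pos x) ->
    q x = g (cb false) * (1 - line_coord x) + g (cb true) * line_coord x.
  move=> /qE ->; rewrite (reindex cb) /=; last first.
    exists (fun b : {ffun 'I_1 -> bool} => b 0) => [c _|b' _]; first by rewrite ffunE.
    by rewrite -bE.
  by rewrite big_bool /wt !big_ord1 !ffunE /wt1 /= -/(line_coord x); ring.
have gle c c' : `|g (cb c')| <= `|g (cb c)| ->
    g (cb c) ^+ 2 * (rho * H) <= 256 * (4 * (128 / 9 * mu ^+ 2) + 2) * massq (elt l H m) q ->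
    g (cb c') ^+ 2 * (rho * H) <= 256 * (4 * (128 / 9 * mu ^+ 2) + 2) * massq (elt l H m) q.
  move=> h; apply: le_trans; rewrite ler_wpM2r ?mulr_ge0 ?(ltW rho_gt0) ?(ltW HH) //.
  by rewrite -[leLHS]real_normK ?num_real // -[leRHS]real_normK ?num_real // ler_pXn2r ?nnegrE.
have offS x : off_centre x -> 0 <= line_coord x <= 3 / 8 \/ 5 / 8 <= line_coord x <= 1.
  move=> /andP[/set_mem/line_coord_elt/andP[t0 t1] /orP[h|h]]; [left|right];
  by apply/andP.
pose z (c : bool) : 'rV[R]_1 := \row_i (((m 0 : nat)%:R + (if c then 3 / 4 else 4^-1)) * H).
have az c : admissible (l := l) (H / 4) (z c).
  apply: (@cell_admissible _ _ _ _ _ H_gt0 lE m); last by rewrite divr_ge0 // ltW.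
  by move=> i; rewrite mxE (ord1 i); case: c; split; lra.
have sub c : box l (H / 4) (z c) `<=` elt l H m.
  apply: boxS => //; first exact: (ccenter_admissible H_gt0 lE).
  by move=> i; rewrite !mxE (ord1 i); case: c; split; lra.
have zt c x : box l (H / 4) (z c) (pos x) ->
    if c then 2^-1 <= line_coord x <= 1 else 0 <= line_coord x <= 2^-1.
  move=> /box_inside/(_ 0); rewrite mxE line_coordE ler_norml.
  by case: c => /andP[h1 h2]; apply/andP; split; nra.
have [h|h] := lerP `|g (cb true)| `|g (cb false)|.
  have key : g (cb false) ^+ 2 * (rho * H) <=
      256 * (4 * (128 / 9 * mu ^+ 2) + 2) * massq (elt l H m) q.
    apply: (line_end h (az false) (sub false) qE' _ offS) => x /zt; by [].
  by rewrite (bE b); case: (b 0) => //; apply: gle key.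
have key : g (cb true) ^+ 2 * (rho * H) <=
    256 * (4 * (128 / 9 * mu ^+ 2) + 2) * massq (elt l H m) q.
  apply: (line_end (ltW h) (az true) (sub true) (tau := fun x => 1 - line_coord x)) => x.
  - by move=> /qE' ->; ring.
  - by move=> /zt/andP[h1 h2]; apply/andP; split; lra.
  - by move=> /offS[] /andP[h1 h2]; [right|left]; apply/andP; split; lra.
by rewrite (bE b); case: (b 0) => //; apply: gle (ltW h) key.
Qed.

End Line.

(** * Stability of the interpolation operator *)

(** The constant of [vertex_bound]. For [d = 1] it depends on the Poincare constant,
    since there homogeneity alone does not spread the mass over the element. *)
Definition vertex_const {R : realType} (d : nat) (mu : R) : R :=
  if d == 1%N then 256 * (4 * (128 / 9 * mu ^+ 2) + 2)
  else (2 * d%:R) ^+ d / (@corner_gap R d) ^+ 2.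

Section Interpolant.
Context {R : realType}.

Lemma vertex_const_ge0 d (mu : R) : 0 <= vertex_const d mu.
Proof.
rewrite /vertex_const; case: ifP => _; first by have := sqr_ge0 mu; lra.
by rewrite divr_ge0 ?sqr_ge0 // exprn_ge0 // mulr_ge0.
Qed.

Context {d : nat} {l : 'rV[R]_d} (N : network l).
Variables (Gamma : set 'rV[R]_d) (R0 sigma rho mu H : R) (p : 'I_d -> nat).
Hypothesis d_gt0 : (0 < d)%N.
Hypotheses (R0_gt0 : 0 < R0) (rho_gt0 : 0 < rho).
Hypothesis homog : homogeneity N R0 sigma rho.
Hypothesis loc : locality N R0.
Hypothesis dens : boundary_density N Gamma R0.
Hypothesis poin : poincare N R0 mu.
Hypothesis fried : friedrichs N Gamma R0 mu.
Hypothesis H_gt0 : 0 < H.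
Hypothesis p_gt0 : forall i, (0 < p i)%N.
Hypothesis lE : forall i, l 0 i = (p i)%:R * H.
Hypothesis hG : mesh_boundary l H Gamma.
Hypothesis RH : 4 * d%:R * R0 <= H.
Variable B : lagrange_basis l H Gamma.
Variables (Tk : 'I_(nb_nodes B) -> set 'rV[R]_d)
          (psi : 'I_(nb_nodes B) -> nodefun N).
Hypothesis dual : dual_basis Tk psi.
Implicit Types (k j : 'I_(nb_nodes B)) (v w : nodefun N) (m : cell p).

Let R4 : 4 * R0 <= H := RH4 R0_gt0 d_gt0 RH.

Lemma Gamma_node_exists : exists x : N, Gamma (pos x).
Proof.
have nf : ~~ (Ordinal (nb_free_lt B) < nb_free B)%N by rewrite /= ltnn.
by have [m _ [x [Gx _]]] := nonfree_cell H_gt0 p_gt0 lE hG dens R4 nf; exists x.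
Qed.

Lemma vertex_bound m (g : {ffun 'I_d -> bool} -> R) (q : nodefun N) :
  (forall x : N, elt l H m (pos x) -> q x = \sum_b wt H m b (pos x) * g b) ->
  forall b, g b ^+ 2 * (rho * H ^+ d) <= vertex_const d mu * massq (elt l H m) q.
Proof.
move=> qE b; rewrite /vertex_const; case: eqP => d1.
  have Gn := Gamma_node_exists; have [GF _] := hG; clear R4 dual Tk psi B hG dens.
  move: l N Gamma p homog loc poin fried p_gt0 lE m g q qE b Gn GF; rewrite d1.
  move=> l' N' G' p' h1 h2 h3 h4 h5 h6 m g q qE b Gn GF; rewrite expr1.
  have R4' : 4 * R0 <= H by move: RH; rewrite d1 mulr1.
  exact: (line_bound R0_gt0 rho_gt0 h1 h2 h3 h4 GF Gn H_gt0 h5 h6 R4' qE).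
have gap : 0 < @corner_gap R d.
  by apply: corner_gap_gt0 => //; case: (d) d_gt0 d1 => [|[|n]].
have := corner_bound R0_gt0 homog H_gt0 lE d_gt0 RH (ltW gap) qE b.
by rewrite -ler_pdivlMl ?exprn_gt0 // => h; apply: le_trans h _; rewrite mulrC mulrAC.
Qed.

Definition lam k v : R := dot (mass N (Tk k) (psi k)) v.

Lemma Tk_cell k : exists m b, Tk k = elt l H m /\ k = vnode H_gt0 p_gt0 lE B m b.
Proof. by have [h1 h2 _ _] := dual k; exact: dual_cell. Qed.

Lemma lam_phi k j : lam k (varphi N j) = (k == j)%:R.
Proof. by have [_ _ _ h] := dual k; exact: h. Qed.

Lemma mass_psd A : psd_form (fun u v : nodefun N => dot (mass N A u) v).
Proof.
split=> [a u v w|u v|u]; first by rewrite linearP dotPl.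
  by rewrite !dot_mass; apply: eq_bigr => x _; rewrite mulrAC.
by rewrite dot_massq massq_ge0.
Qed.

Lemma lamPl k (a : R) u v : lam k (a *: u + v) = a * lam k u + lam k v.
Proof. by rewrite /lam dotC dotPl !(dotC _ (mass _ _ _)). Qed.

Lemma lam_sum k (I : Type) (r : seq I) (P : pred I) (a : I -> R) (F : I -> nodefun N) :
  lam k (\sum_(i <- r | P i) a i *: F i) = \sum_(i <- r | P i) a i * lam k (F i).
Proof.
apply: (big_ind2 (fun u t => lam k u = t)).
- by rewrite /lam dotC dot0l.
- by move=> u s v t <- <-; have := lamPl k 1 u v; rewrite scale1r mul1r.
- by move=> i _; have := lamPl k (a i) (F i) 0; rewrite addr0 => ->; rewrite {2}/lam dotC dot0l addr0.
Qed.

Lemma cst_phi (c : R) : cstf c = \sum_k c *: varphi (B := B) N k :> nodefun N.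
Proof.
apply/ffunP => x; rewrite sum_ffunE ffunE.
rewrite (eq_bigr (fun k => c * phi k (pos x))) => [|k _]; last by rewrite !ffunE.
by rewrite -mulr_sumr (phi_sum H_gt0 p_gt0 lE) ?mulr1 //; exact: pos_domain.
Qed.

Lemma lam_cst k c : lam k (cstf c) = c.
Proof.
rewrite cst_phi lam_sum (bigD1 k) //= lam_phi eqxx mulr1 big1 ?addr0 // => j jk.
by rewrite lam_phi eq_sym (negPf jk) mulr0.
Qed.

(** Testing the dual function with itself returns its own vertex value, which its
    mass controls. *)
Lemma psi_bound k :
  massq (Tk k) (psi k) * (rho * H ^+ d) <= vertex_const d mu.
Proof.
have q0 : 0 < rho * H ^+ d by rewrite mulr_gt0 // exprn_gt0.
have [_ _ [c cE] _] := dual k; have [m [b [TE kE]]] := Tk_cell k.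
pose a j : R := if mnode j \in elt_vertex l H (Tk k) then c j else 0.
have psiE x : Tk k (pos x) -> psi k x = \sum_j a j * phi j (pos x).
  move=> xT; rewrite cE // big_mkcond; apply: eq_bigr => j _.
  by rewrite /a; case: ifP => _; rewrite ?mul0r // ffunE.
have ak : a k = massq (Tk k) (psi k).
  rewrite -dot_massq -/(lam k (psi k)).
  have -> : lam k (psi k) = lam k (\sum_j a j *: varphi N j).
    rewrite /lam !dot_mass; apply: eq_bigr => x /set_mem xT; congr (_ * _).
    by rewrite psiE // sum_ffunE; apply: eq_bigr => j _; rewrite !ffunE.
  rewrite lam_sum (bigD1 k) //= lam_phi eqxx mulr1 big1 ?addr0 // => j jk.
  by rewrite lam_phi eq_sym (negPf jk) mulr0.
have qE (x : N) : elt l H m (pos x) ->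
    psi k x = \sum_b wt H m b (pos x) * a (vnode H_gt0 p_gt0 lE B m b).
  by move=> mx; rewrite psiE ?TE // (phi_comb H_gt0 p_gt0 lE _ mx).
have := vertex_bound qE b; rewrite -kE ak -TE.
have := massq_ge0 (Tk k) (psi k); set M := massq _ _.
rewrite le0r => /orP[/eqP ->|M0] h.
  by rewrite mul0r; exact: vertex_const_ge0.
by rewrite -(ler_pM2l M0); lra.
Qed.

Lemma lam_bound k v c :
  (lam k v - c) ^+ 2 * (rho * H ^+ d) <=
    vertex_const d mu * massq (Tk k) (v - cstf c).
Proof.
have -> : lam k v - c = lam k (v - cstf c).
  by rewrite [v - _]addrC -[- cstf c]scaleN1r lamPl lam_cst mulN1r addrC.
have h := form_CS (mass_psd (Tk k)) (psi k) (v - cstf c).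
rewrite !dot_massq in h.
have q0 : 0 < rho * H ^+ d by rewrite mulr_gt0 // exprn_gt0.
apply: le_trans (ler_wpM2r (ltW q0) h) _.
by rewrite mulrAC ler_wpM2r ?massq_ge0 // psi_bound.
Qed.

(** The coefficients of the interpolant with respect to the whole basis. *)
Definition coef k v : R := if (k < nb_free B)%N then lam k v else 0.

Lemma interpE v x : interp Tk psi v x = \sum_k coef k v * phi k (pos x).
Proof.
rewrite /interp big_mkcond sum_ffunE; apply: eq_bigr => k _.
by rewrite /coef; case: ifP => _; rewrite !ffunE // mul0r.
Qed.

Lemma interp_sum v : interp Tk psi v = \sum_k coef k v *: varphi N k.
Proof.
by apply/ffunP => x; rewrite interpE sum_ffunE; apply: eq_bigr => k _; rewrite !ffunE.
Qed.

Lemma lam_interp k v : (k < nb_free B)%N -> lam k (interp Tk psi v) = lam k v.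
Proof.
move=> kf; rewrite interp_sum lam_sum (bigD1 k) //= lam_phi eqxx mulr1 /coef kf.
by rewrite big1 ?addr0 // => j jk; rewrite lam_phi eq_sym (negPf jk) mulr0.
Qed.

Lemma interp_idem v : interp Tk psi (interp Tk psi v) = interp Tk psi v.
Proof.
by rewrite {1 3}/interp; apply: eq_bigr => k kf; congr (_ *: _); exact: lam_interp.
Qed.

Lemma interpP (a : R) u v :
  interp Tk psi (a *: u + v) = a *: interp Tk psi u + interp Tk psi v.
Proof.
rewrite /interp scaler_sumr -big_split; apply: eq_bigr => k _.
by rewrite -/(lam k _) lamPl scalerDl scalerA.
Qed.

Lemma interp_vanishes v : vanishes Gamma (interp Tk psi v).
Proof.
move=> x Gx; rewrite interpE big1 // => k _; rewrite /coef; case: ifP => [kf|_].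
  by rewrite (phi_free_Gamma kf (Gamma_domain hG Gx) Gx) mulr0.
by rewrite mul0r.
Qed.

(** Contains every enlarged cube that a chain between two coefficients near [m]
    visits. *)
Definition patch5 m : set 'rV[R]_d :=
  [set z | inside (5 * H) (ccenter H m) z] `&` domain l.

Definition local_energy m v : R := (mu * (H / 2)) ^+ 2 * energy (patch5 m) v.

Lemma local_energy_ge0 m v : 0 <= local_energy m v.
Proof. by apply: mulr_ge0; [exact: sqr_ge0 | exact: energy_ge0]. Qed.

Definition near_centers m : set 'rV[R]_d :=
  [set s | admissible (l := l) (H / 2) s /\ inside (4 * H) (ccenter H m) s].

Lemma near_centers_conv m z z' t : near_centers m z -> near_centers m z' ->
  0 <= t <= 1 -> near_centers m (z + t *: (z' - z)).
Proof.
move=> [a i] [a' i'] t01; split; first exact: admissible_conv.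
move=> j; have := i j; have := i' j; rewrite !mxE !ler_norml.
move=> /andP[h1 h2] /andP[h3 h4]; move/andP: t01 => [t0 t1].
by apply/andP; split; nra.
Qed.

Lemma near_centers_energy m z v : near_centers m z ->
  (mu * (H / 2)) ^+ 2 * energy (box l (H / 2 + R0) z `&` domain l) v <=
  local_energy m v.
Proof.
move=> [_ zm]; rewrite ler_wpM2l ?sqr_ge0 //; apply: energyS => y [/box_inside yz dy].
split=> // i; have := yz i; have := zm i; have := R4; have := R0_gt0.
rewrite !ler_norml => ? ? /andP[h1 h2] /andP[h3 h4]; apply/andP; split; lra.
Qed.

Let r2 : R0 <= H / 2. Proof. by have := R4; have := R0_gt0; lra. Qed.
Let r22 : 2 * R0 <= H / 2. Proof. by have := R4; lra. Qed.

Lemma near_centers_poincare m z v : near_centers m z ->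
  exists c, massq (box l (H / 2) z) (v - cstf c) <= local_energy m v.
Proof.
move=> zm; have [c hc] := poincare_sq R0_gt0 poin v r2 (proj1 zm).
by exists c; apply: le_trans hc (near_centers_energy v zm).
Qed.

Lemma cell_near_centers m m' : inside (4 * H) (ccenter H m) (ccenter H m') ->
  near_centers m (ccenter H m').
Proof. by split=> //; exact: ccenter_admissible. Qed.

Definition coef_const : R := 2 * vertex_const d mu + 512 * 2 ^+ d.

Lemma coef_const_ge0 : 0 <= coef_const.
Proof.
have := vertex_const_ge0 d mu; rewrite /coef_const.
have P0 : (0 : R) <= 2 ^+ d by rewrite exprn_ge0.
by lra.
Qed.

(** All coefficients near a cell are close to one constant. A free coefficient is
    close to the Poincare constant of the cell that defines it. A dropped coefficient is
    zero, and a cell with a boundary node is nearby, on which [v] is close to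
    zero. *)
Lemma coef_near m v : vanishes Gamma v -> exists c,
  massq (elt l H m) (v - cstf c) <= local_energy m v /\
  forall k, inside (2 * H) (ccenter H m) (mnode k) ->
    (coef k v - c) ^+ 2 * (rho * H ^+ d) <= coef_const * local_energy m v.
Proof.
move=> hv; have HH := H_gt0.
have mm : near_centers m (ccenter H m).
  by apply: cell_near_centers => i; rewrite subrr normr0; lra.
have [c hc] := near_centers_poincare v mm; exists c; split=> // k km.
set D := local_energy m v in hc *.
have D0 : 0 <= D by exact: local_energy_ge0.
have cmp m' c' : inside (4 * H) (ccenter H m) (ccenter H m') ->
    massq (elt l H m') (v - cstf c') <= D ->
    (c' - c) ^+ 2 * (rho * H ^+ d) <= 256 * 2 ^+ d * D.
  move=> m'm hc'; have ins : inside (7.+1%:R * (H / 2)) (ccenter H m') (ccenter H m).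
    move=> i; have := m'm i; rewrite distrC => h; apply: le_trans h _; lra.
  have := chain_cst R0_gt0 rho_gt0 homog r22 (fun z (hz : near_centers m z) => proj1 hz)
    (@near_centers_conv m) (fun z hz => near_centers_poincare v hz)
    (cell_near_centers m'm) mm ins hc' hc.
  have e : rho * H ^+ d = rho * (H / 2) ^+ d * 2 ^+ d.
    by rewrite -mulrA -exprMn divfK.
  move=> h; rewrite e [leLHS]mulrA; have h2 : (0 : R) <= 2 ^+ d by rewrite exprn_ge0.
  have e4 : 4 * (7.+1%:R) ^+ 2 = 256 :> R by rewrite -natrX -natrM.
  apply: le_trans (ler_wpM2r h2 h) _; rewrite e4 /D mulrAC; exact: lexx.
have P2 : (0 : R) <= 2 ^+ d by rewrite exprn_ge0.
have A0 := vertex_const_ge0 d mu.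
have PD := mulr_ge0 P2 D0; have AD := mulr_ge0 A0 D0.
rewrite /coef; case: ifPn => kf.
  have [m' [b [TE kE]]] := Tk_cell k.
  have m'm : inside (4 * H) (ccenter H m) (ccenter H m').
    have := km; rewrite kE mnode_vnode => hk i; have := hk i; rewrite !mxE natrD.
    rewrite !ler_norml => /andP[h1 h2]; apply/andP.
    by move: h1 h2; case: (b i) => /= h1 h2; split; lra.
  have [c' hc'] := near_centers_poincare v (cell_near_centers m'm).
  have h1 := cmp m' c' m'm hc'.
  have h2 := lam_bound k v c'.
  have h3 : vertex_const d mu * massq (Tk k) (v - cstf c') <= vertex_const d mu * D.
    by rewrite TE ler_wpM2l.
  have q0 : 0 <= rho * H ^+ d by rewrite mulr_ge0 ?exprn_ge0 ?ltW.
  have h4 : (lam k v - c) ^+ 2 * (rho * H ^+ d) <=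
     2 * ((lam k v - c') ^+ 2 * (rho * H ^+ d)) + 2 * ((c' - c) ^+ 2 * (rho * H ^+ d)).
    set a := lam k v.
    have h : (a - c) ^+ 2 <= 2 * (a - c') ^+ 2 + 2 * (c' - c) ^+ 2.
      by have := sqr_ge0 ((a - c') - (c' - c)); lra.
    by have := ler_wpM2r q0 h; lra.
  by rewrite /coef_const; lra.
have [m' m'k [x [Gx m'x]]] := nonfree_cell H_gt0 p_gt0 lE hG dens R4 kf.
have m'm : inside (4 * H) (ccenter H m) (ccenter H m').
  move=> i; have := km i; have := m'k i.
  rewrite !ler_norml => /andP[h1 h2] /andP[h3 h4]; apply/andP; split; lra.
have f0 : massq (elt l H m') (v - cstf 0) <= D.
  rewrite subf0; apply: le_trans (near_centers_energy v (cell_near_centers m'm)).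
  apply: (friedrichs_sq R0_gt0 fried r2 (ccenter_admissible H_gt0 lE m') _ hv).
  by exists x.
by have := cmp m' 0 m'm f0; rewrite /coef_const; lra.
Qed.

Lemma patch5_overlap v :
  \sum_(m : cell p) local_energy m v <=
    (mu * (H / 2)) ^+ 2 * (12 ^ d)%:R * energy (domain l) v.
Proof.
rewrite -mulr_sumr -mulrA ler_wpM2l ?sqr_ge0 //.
apply: (@energy_overlap _ _ _ N H p H_gt0 5) => m z [zm _] i.
by rewrite distrC; exact: zm.
Qed.

Definition approx_const : R :=
  (2 + 2 * sigma * coef_const) * (mu / 2) ^+ 2 * (12 ^ d)%:R.

Lemma sigma_ge0 : 0 <= sigma.
Proof.
have [m _] := locate H_gt0 p_gt0 lE (pos_domain (projT1 (cid Gamma_node_exists))).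
have := sigma_ge1 R0_gt0 rho_gt0 homog r2 (ccenter_admissible H_gt0 lE m); lra.
Qed.

(** All coefficients of [w] vanish, so the constant that they approximate near a cell
    is small, and it is also the constant of the Poincare inequality there. *)
Lemma interp0_mass w : vanishes Gamma w -> interp Tk psi w = 0 ->
  massq (domain l) w <= approx_const * H ^+ 2 * energy (domain l) w.
Proof.
move=> hw iw.
have cw k : coef k w = 0.
  rewrite /coef; case: ifP => // kf; rewrite -lam_interp // iw.
  by rewrite /lam dotC dot0l.
have q0 : 0 < rho * H ^+ d by rewrite mulr_gt0 // exprn_gt0.
have s0 := sigma_ge0.
have cell_bound m : massq (elt l H m) w <=
    (2 + 2 * sigma * coef_const) * local_energy m w.
  have [c [hc ck]] := coef_near m hw.
  have [k km] : exists k : 'I_(nb_nodes B), inside (2 * H) (ccenter H m) (mnode k).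
    exists (vnode H_gt0 p_gt0 lE B m [ffun=> false]) => i.
    rewrite mnode_vnode !mxE ffunE addn0 ler_norml; have := H_gt0.
    by move=> ?; apply/andP; split; lra.
  have := ck k km; rewrite cw => h1.
  rewrite -[w]subf0; apply: le_trans (massq_shift _ w 0 c) _; rewrite subf0.
  have /andP[_ m1] := mass_cell R0_gt0 homog H_gt0 lE d_gt0 RH m.
  have h2 := ler_wpM2l (sqr_ge0 (0 - c)) m1.
  have h3 := ler_wpM2l s0 h1.
  by lra.
rewrite /massq (sum_cells H_gt0 p_gt0 lE).
apply: le_trans (ler_sum _ (fun m _ => cell_bound m)) _.
rewrite -mulr_sumr.
have c0 : 0 <= 2 + 2 * sigma * coef_const.
  by have := mulr_ge0 s0 coef_const_ge0; lra.
apply: le_trans (ler_wpM2l c0 (patch5_overlap w)) _.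
by rewrite /approx_const; lra.
Qed.

Definition stability_const : R :=
  (2 ^+ d.+1 * d%:R) ^+ 2 * coef_const * sigma * (mu / 2) ^+ 2 * (12 ^ d)%:R.

(** Across an edge, only the deviations of nearby coefficients from a common
    constant contribute, since the basis is a partition of unity. *)
Lemma interp_energy v : vanishes Gamma v ->
  energy (domain l) (interp Tk psi v) <= stability_const * energy (domain l) v.
Proof.
move=> hv.
have q0 : 0 < rho * H ^+ d by rewrite mulr_gt0 // exprn_gt0.
have s0 := sigma_ge0; have HH := H_gt0.
pose K : R := 2 ^+ d.+1 * d%:R.
have K0 : 0 <= K by rewrite mulr_ge0 // exprn_ge0.
have node m x : elt l H m (pos x) -> nenergy (interp Tk psi v) x <=
    K ^+ 2 / H ^+ 2 * (coef_const * local_energy m v / (rho * H ^+ d)) * nmass x.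
  move=> mx; have [c [_ ck]] := coef_near m hv.
  set E := coef_const * local_energy m v / _.
  have E0 : 0 <= E.
    by rewrite divr_ge0 ?(ltW q0) // mulr_ge0 ?coef_const_ge0 ?local_energy_ge0.
  have {}ck k : inside (2 * H) (ccenter H m) (mnode k) ->
      `|coef k v - c| <= Num.sqrt E.
    move=> /ck h; rewrite -sqrtr_sqr ler_sqrt // /E ler_pdivlMr //.
  rewrite /nenergy /nmass [leRHS]mulrCA ler_wpM2l ?invr_ge0 // mulr_sumr.
  apply: ler_sum => y xy; have d0 := dist_gt0 xy.
  rewrite ler_pdivrMr //.
  have dx := @pos_domain _ _ _ N x; have dy := @pos_domain _ _ _ N y.
  have diffE : interp Tk psi v x - interp Tk psi v y =
      \sum_k (coef k v - c) * (phi k (pos x) - phi k (pos y)).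
    rewrite !interpE -sumrB.
    have -> : \sum_k (coef k v - c) * (phi k (pos x) - phi k (pos y)) =
        \sum_k (coef k v * phi k (pos x) - coef k v * phi k (pos y)) -
        c * (\sum_k @phi _ _ _ _ _ B k (pos x) - \sum_k @phi _ _ _ _ _ B k (pos y)).
      by rewrite -sumrB mulr_sumr -sumrB; apply: eq_bigr => k _; ring.
    by rewrite !(phi_sum H_gt0 p_gt0 lE) // subrr mulr0 subr0.
  pose S := ([set k | @phi _ _ _ _ _ B k (pos x) != 0%R] :|:
             [set k | @phi _ _ _ _ _ B k (pos y) != 0%R])%SET.
  have Scard : #|S|%:R <= 2 ^+ d.+1 :> R.
    rewrite -natrX ler_nat expnS mul2n -addnn; apply: leq_trans (leq_card_setU _ _) _.
    by apply: leq_add; exact: (phi_supp_card H_gt0 p_gt0 lE).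
  have Snear k : k \in S -> inside (2 * H) (ccenter H m) (mnode k).
    have xm := elt_inside H_gt0 lE mx.
    have R44 := R4; have R00 := R0_gt0.
    rewrite !inE => /orP[] hk i; have := xm i.
      have := phi_near H_gt0 p_gt0 lE dx hk i.
      rewrite ltr_norml !ler_norml => /andP[h1 h2] /andP[h3 h4]; apply/andP; split; lra.
    have := phi_near H_gt0 p_gt0 lE dy hk i.
    have hxy : `|pos x 0 i - pos y 0 i| < R0.
      by apply: le_lt_trans (loc xy); have := le_enorm (pos x - pos y) i; rewrite !mxE.
    move: hxy; rewrite !ltr_norml !ler_norml => /andP[a1 a2] /andP[h1 h2] /andP[h3 h4].
    by apply/andP; split; lra.
  have h : `|interp Tk psi v x - interp Tk psi v y| <=
      K / H * Num.sqrt E * dist x y.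
    rewrite diffE (bigID (mem S)) /= [X in _ + X]big1 ?addr0; last first.
      move=> k; rewrite !inE negb_or !negbK => /andP[/eqP -> /eqP ->].
      by rewrite subrr mulr0.
    apply: le_trans (ler_norm_sum _ _ _) _.
    apply: (@le_trans _ _ (\sum_(k in S) Num.sqrt E * (d%:R / H * dist x y))).
      apply: ler_sum => k kS; rewrite normrM; apply: ler_pM => //.
        by apply: ck; exact: Snear.
      exact: (phi_lip H_gt0 p_gt0 lE k dx dy).
    rewrite sumr_const -[leLHS]mulr_natl.
    have -> : K / H * Num.sqrt E * dist x y =
       2 ^+ d.+1 * (Num.sqrt E * (d%:R / H * dist x y)) by rewrite /K; ring.
    rewrite ler_wpM2r // mulr_ge0 ?sqrtr_ge0 // mulr_ge0 ?dist_ge0 //.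
    by rewrite divr_ge0 // ltW.
  have -> : K ^+ 2 / H ^+ 2 * E * dist x y * dist x y =
      (K / H * Num.sqrt E * dist x y) ^+ 2.
    by rewrite !exprMn sqr_sqrtr // exprVn; ring.
  rewrite -[leLHS]real_normK ?num_real // ler_pXn2r ?nnegrE //.
  exact: le_trans h.
rewrite {1}/energy (sum_cells H_gt0 p_gt0 lE).
pose E2 m := K ^+ 2 / H ^+ 2 * coef_const * sigma * local_energy m v.
have cell_bound m : \sum_(x : N | pos x \in elt l H m) nenergy (interp Tk psi v) x <= E2 m.
  apply: le_trans (ler_sum _ (fun x mx => node m x (set_mem mx))) _.
  have /andP[_ m1] := mass_cell R0_gt0 homog H_gt0 lE d_gt0 RH m.
  have mE : massq (elt l H m) (cstf 1 : nodefun N) = \sum_(x : N | pos x \in elt l H m) nmass x.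
    by rewrite /massq; apply: eq_bigr => x _; rewrite ffunE expr1n mulr1.
  rewrite -mulr_sumr -mE.
  set a := K ^+ 2 / H ^+ 2 * _.
  have a0 : 0 <= a.
    rewrite mulr_ge0 // ?divr_ge0 ?sqr_ge0 ?(ltW q0) //.
    by rewrite mulr_ge0 ?coef_const_ge0 ?local_energy_ge0.
  apply: le_trans (ler_wpM2l a0 m1) _.
  rewrite le_eqVlt; apply/orP; left; apply/eqP; rewrite /a /E2.
  have rho0 := rho_gt0; have Hd : H ^+ d != 0 by rewrite expf_neq0 // gt_eqF.
  by field; rewrite Hd !gt_eqF.
apply: le_trans (ler_sum _ (fun m _ => cell_bound m)) _.
rewrite -mulr_sumr.
have c0 : 0 <= K ^+ 2 / H ^+ 2 * coef_const * sigma.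
  by rewrite !mulr_ge0 ?coef_const_ge0 // invr_ge0 exprn_ge0 // ltW.
apply: le_trans (ler_wpM2l c0 (patch5_overlap v)) _.
rewrite le_eqVlt; apply/orP; left; apply/eqP; rewrite /stability_const -/K.
by field; rewrite gt_eqF.
Qed.

End Interpolant.

(** * Vector-valued functions and the operator *)

Section FormSum.
Context {R : realType} {E : vectType R} (b : E -> E -> R).

Lemma form_sum_le (I : finType) (A : pred I) (F : I -> E) : psd_form b ->
  b (\sum_(i | A i) F i) (\sum_(i | A i) F i) <=
    #|A|%:R * \sum_(i | A i) b (F i) (F i).
Proof.
move=> hb; rewrite form_suml //; under eq_bigr do rewrite form_sumr //.
have h i j : b (F i) (F j) <= 2^-1 * b (F i) (F i) + 2^-1 * b (F j) (F j).
  by have := form_young hb (F i) (F j) ltr01; rewrite invr1; lra.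
apply: le_trans (ler_sum _ (fun i _ => ler_sum _ (fun j _ => h i j))) _.
set S := \sum_(i | A i) b (F i) (F i).
have -> : \sum_(i | A i) \sum_(j | A j) (2^-1 * b (F i) (F i) + 2^-1 * b (F j) (F j))
    = \sum_(i | A i) (2^-1 * b (F i) (F i) * #|A|%:R + 2^-1 * S).
  apply: eq_bigr => i _; rewrite big_split /= sumr_const -[_ *+ #|A|]mulr_natr; congr (_ + _).
  by rewrite mulr_sumr.
rewrite big_split /= sumr_const -mulr_suml -mulr_sumr -/S -[X in _ + X]mulr_natr.
by rewrite le_eqVlt; apply/orP; left; apply/eqP; lra.
Qed.

End FormSum.

Section Vec.
Context {R : realType} {d : nat} {l : 'rV[R]_d} (N : network l) (n : nat).
Implicit Types (u v w f : vnodefun N n) (x y : N).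

Lemma vdotC u v : vdot u v = vdot v u.
Proof. by apply: eq_bigr => i _; exact: dotC. Qed.

Lemma vdotPl a u v w : vdot (a *: u + v) w = a * vdot u w + vdot v w.
Proof.
rewrite /vdot mulr_sumr -big_split; apply: eq_bigr => i _.
by rewrite !ffunE dotPl.
Qed.

Lemma vdot0l w : vdot 0 w = 0.
Proof. by rewrite /vdot big1 // => i _; rewrite ffunE dot0l. Qed.

Lemma vdot_suml (I : Type) (r : seq I) (P : pred I) (F : I -> vnodefun N n) w :
  vdot (\sum_(i <- r | P i) F i) w = \sum_(i <- r | P i) vdot (F i) w.
Proof.
apply: (big_morph (fun u => vdot u w)) => [u v|]; last exact: vdot0l.
by have := vdotPl 1 u v w; rewrite scale1r mul1r.
Qed.

Lemma vform_psd (A : 'End(vnodefun N n)) :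
  (forall u v, vdot (A u) v = vdot u (A v)) -> (forall v, 0 <= vdot (A v) v) ->
  psd_form (fun u v => vdot (A u) v).
Proof.
move=> sym pos; split=> // [a u v w|u v]; first by rewrite linearP vdotPl.
by rewrite sym vdotC.
Qed.

Lemma vdot_cw (A : 'End(nodefun N)) v :
  vdot (cw n A v) v = \sum_i dot (A (v i)) (v i).
Proof. by apply: eq_bigr => i _; rewrite lfunE ffunE. Qed.

Definition venergy v : R := \sum_i energy (domain l) (v i).

Lemma vdot_lap v : vdot (cw n (lap N (domain l)) v) v = venergy v.
Proof. by rewrite vdot_cw; apply: eq_bigr => i _; exact: dot_energy. Qed.

Lemma vdot_mass v :
  vdot (cw n (mass N (domain l)) v) v = \sum_i massq (domain l) (v i).
Proof. by rewrite vdot_cw; apply: eq_bigr => i _; exact: dot_massq. Qed.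

(** A connected network with an edge has an edge at every node. *)
Lemma nmass_gt0 : 0 < massq (domain l) (cstf 1 : nodefun N) -> forall x, 0 < nmass x.
Proof.
move=> M0.
have adj_gt0 x y : adj x y -> 0 < nmass x.
  move=> xy; rewrite mulr_gt0 ?invr_gt0 // (bigD1 y) //=.
  by rewrite ltr_wpDr ?dist_gt0 // sumr_ge0 // => z _; exact: dist_ge0.
have [x0 x00] : exists x0 : N, 0 < nmass x0.
  apply: contrapT => h; move: M0; rewrite /massq big1 ?ltxx // => x _.
  suff -> : nmass x = 0 by rewrite mul0r.
  by apply/eqP; rewrite eq_le nmass_ge0 andbT leNgt; apply/negP => ?; apply: h; exists x.
move=> x; have [->//|xx0] := eqVneq x x0.
have /connectP[[|y s] /= hp e] := adj_connected x x0.
  by rewrite e eqxx in xx0.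
by case/andP: hp => xy _; exact: adj_gt0 xy.
Qed.

(** Cauchy-Schwarz in the mass form, after writing [f = M g]. *)
Lemma minv_normP : (forall x : N, 0 < nmass x) -> forall f v,
  vdot f v <= minv_norm f * Num.sqrt (\sum_i massq (domain l) (v i)).
Proof.
move=> m0 f v; pose M := cw n (mass N (domain l)).
have Mv u i x : M u i x = nmass x * u i x.
  rewrite lfunE ffunE /mass sum_lfunE sum_ffunE (bigD1 x) /=; last first.
    by apply/mem_set/pos_domain.
  rewrite mass_atE ffunE eqxx [X in _ + X]big1 ?addr0 // => y /andP[_ yx].
  by rewrite mass_atE ffunE eq_sym (negPf yx).
have ker : lker M == 0%VS.
  rewrite -subv0; apply/subvP => u; rewrite memv_ker memv0 => /eqP Mu.
  apply/eqP/ffunP => i; apply/ffunP => x; rewrite !ffunE.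
  have := Mv u i x; rewrite Mu !ffunE => /esym/eqP.
  by rewrite mulf_eq0 gt_eqF // => /eqP.
pose g := (M^-1)%VF f.
have fE : f = M g by rewrite /g lker0_lfunVK.
have sym u w : vdot (M u) w = vdot u (M w).
  apply: eq_bigr => i _; rewrite /dot; apply: eq_bigr => x _.
  by rewrite !Mv mulrCA mulrA.
have psd : psd_form (fun u w => vdot (M u) w).
  apply: vform_psd => // w; rewrite vdot_mass sumr_ge0 // => i _; exact: massq_ge0.
have e : vsemin (M^-1)%VF f = Num.sqrt (vdot (M g) g).
  by rewrite /vsemin -/g fE vdotC.
rewrite /minv_norm e -(vdot_mass v) {1}fE -sqrtrM ?(form_ge0 psd) //.
apply: le_trans (ler_norm _) _; rewrite -sqrtr_sqr ler_sqrt.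
  exact: (form_CS psd g v).
by apply: mulr_ge0; exact: (form_ge0 psd).
Qed.

End Vec.

Section Splitting.
Context {R : realType} {d : nat} {l : 'rV[R]_d} (N : network l) (n : nat).
Variables (K : 'End(vnodefun N n)) (Kx : N -> 'End(vnodefun N n)).
Hypothesis KS : local_splitting K Kx.
Implicit Types (u v w : vnodefun N n) (x : N).

Definition kform u v : R := vdot (K u) v.
Definition kxform x u v : R := vdot (Kx x u) v.

Lemma kxform_psd x : psd_form (kxform x).
Proof. by have [_ /(_ x)[h1 h2 _ _]] := KS; exact: vform_psd. Qed.

Lemma kformE u v : kform u v = \sum_x kxform x u v.
Proof. by have [KE _] := KS; rewrite /kform KE sum_lfunE vdot_suml. Qed.

Lemma KlocE T u v : vdot (Kloc Kx T u) v = \sum_(x | pos x \in T) kxform x u v.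
Proof. by rewrite /Kloc sum_lfunE vdot_suml. Qed.

Lemma psd_sum (I : finType) (A : pred I) (b : I -> vnodefun N n -> vnodefun N n -> R) :
  (forall i, psd_form (b i)) -> psd_form (fun u v => \sum_(i | A i) b i u v).
Proof.
move=> hb; split=> [a u v w|u v|u].
- rewrite mulr_sumr -big_split; apply: eq_bigr => i _; exact: (formPl (hb i)).
- by apply: eq_bigr => i _; exact: (formC (hb i)).
- by apply: sumr_ge0 => i _; exact: (form_ge0 (hb i)).
Qed.

Lemma kform_psd : psd_form kform.
Proof.
rewrite (_ : kform = fun u v => \sum_x kxform x u v).
  by apply: psd_sum => x; exact: kxform_psd.
by apply/funext => u; apply/funext => v; exact: kformE.
Qed.

Lemma Kloc_psd T : psd_form (fun u v => vdot (Kloc Kx T u) v).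
Proof.
rewrite (_ : (fun u v => _) = fun u v => \sum_(x | pos x \in T) kxform x u v).
  by apply: psd_sum => x; exact: kxform_psd.
by apply/funext => u; apply/funext => v; exact: KlocE.
Qed.

Lemma Kloc_le T v : vdot (Kloc Kx T v) v <= kform v v.
Proof.
rewrite KlocE kformE big_mkcond; apply: ler_sum => x _.
by case: ifP => // _; exact: (form_ge0 (kxform_psd x)).
Qed.

Lemma vseminK v : vsemin K v ^+ 2 = kform v v.
Proof. by rewrite /vsemin sqr_sqrtr // (form_ge0 kform_psd). Qed.

Lemma kxform0 x v : (forall y i, y \in star x -> v i y = 0) ->
  forall u, kxform x v u = 0.
Proof.
move=> v0 u; have [_ /(_ x)[_ _ h _]] := KS.
rewrite /kxform (h v 0) ?linear0 ?vdot0l // => y i ys.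
by rewrite v0 // !ffunE.
Qed.

Lemma star_near R0 x y : locality N R0 -> 0 < R0 -> y \in star x ->
  inside R0 (pos x) (pos y).
Proof.
move=> loc R00; rewrite inE => /orP[/eqP ->|xy] i.
  by rewrite subrr normr0 ltW.
apply: ltW; apply: le_lt_trans (loc _ _ xy).
by have := le_enorm (pos x - pos y) i; rewrite !mxE distrC.
Qed.

End Splitting.

(** * The localized corrections *)

Section Localization.
Context {R : realType} {d : nat} {l : 'rV[R]_d} (N : network l) (n : nat).
Variables (Gamma : set 'rV[R]_d) (R0 H : R) (p : 'I_d -> nat).
Hypothesis R0_gt0 : 0 < R0.
Hypothesis loc : locality N R0.
Hypothesis H_gt0 : 0 < H.
Hypothesis p_gt0 : forall i, (0 < p i)%N.
Hypothesis lE : forall i, l 0 i = (p i)%:R * H.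
Hypothesis hG : mesh_boundary l H Gamma.
Hypothesis R4 : 4 * R0 <= H.
Variable B : lagrange_basis l H Gamma.
Variables (Tk : 'I_(nb_nodes B) -> set 'rV[R]_d)
          (psi : 'I_(nb_nodes B) -> nodefun N).
Hypothesis dual : dual_basis Tk psi.
Variables (K : 'End(vnodefun N n)) (Kx : N -> 'End(vnodefun N n)).
Hypothesis KS : local_splitting K Kx.
Hypothesis K_unique : unique_solvability Gamma K.
Implicit Types (u v w : vnodefun N n) (j : 'I_(nb_nodes B)) (k : nat) (m : cell p).

Notation b := (kform K).
Notation W := (inW (n := n) Tk psi).
Notation Wj := (inWj (n := n) Tk psi).
Notation vI := (vinterp (n := n) Tk psi).

Let bP : psd_form b := kform_psd KS.

Lemma vanishes_submodule : submodule (vvanishes (N := N) (n := n) Gamma).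
Proof.
split=> [i x Gx|a u v hu hv i x Gx]; first by rewrite !ffunE.
by rewrite !ffunE (hu i x Gx) (hv i x Gx) scaler0 addr0.
Qed.

Lemma vinterpP a u v : vI (a *: u + v) = a *: vI u + vI v.
Proof. by apply/ffunP => i; rewrite !ffunE interpP. Qed.

Lemma vinterp0 : vI 0 = 0.
Proof. by have := vinterpP (-1) 0 0; rewrite scaler0 addr0 scaleN1r addNr. Qed.

Lemma vinterpD u v : vI (u + v) = vI u + vI v.
Proof. by have := vinterpP 1 u v; rewrite !scale1r. Qed.

Lemma vinterpB u v : vI (u - v) = vI u - vI v.
Proof. by rewrite addrC -scaleN1r vinterpP scaleN1r addrC. Qed.

Lemma vinterp_sum (I : Type) (r : seq I) (P : pred I) (F : I -> vnodefun N n) :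
  vI (\sum_(i <- r | P i) F i) = \sum_(i <- r | P i) vI (F i).
Proof. by apply: (big_morph vI); [exact: vinterpD | exact: vinterp0]. Qed.

Lemma vinterp_idem v : vI (vI v) = vI v.
Proof. by apply/ffunP => i; rewrite !ffunE (interp_idem dual). Qed.

Lemma vinterp_vanishes v : vvanishes Gamma (vI v).
Proof. by move=> i; rewrite ffunE; exact: interp_vanishes. Qed.

Lemma W_submodule : submodule W.
Proof.
have [v0 vP] := vanishes_submodule.
split=> [|a u v [hu iu] [hv iv]]; first by split; [|exact: vinterp0].
by split; [exact: vP | rewrite vinterpP iu iv scaler0 addr0].
Qed.

(** A function without energy solves the problem with right-hand side zero, whose
    solution is unique. *)
Lemma V_definite v : vvanishes Gamma v -> b v v = 0 -> v = 0.
Proof.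
move=> hv v0; have [u [_ uniq]] := K_unique 0.
have [z0 _] := vanishes_submodule.
have e1 : u = v.
  by apply: uniq; split=> // w _; rewrite vdot0l; exact: (form_eq0l bP w v0).
have e2 : u = 0 by apply: uniq; split=> // w _; rewrite linear0.
by rewrite -e1.
Qed.

Lemma W_definite v : W v -> b v v = 0 -> v = 0.
Proof. by move=> [hv _]; exact: V_definite. Qed.

Lemma Wj_W j v : Wj j v -> W v.
Proof.
move=> [z [hz _] ->]; split; last by rewrite vinterpB vinterp_idem subrr.
exact: (submoduleB vanishes_submodule hz (@vinterp_vanishes z)).
Qed.

Lemma Wj_submodule j : submodule (Wj j).
Proof.
have [v0 vP] := vanishes_submodule.
split=> [|a u v [z [hz sz] ->] [z' [hz' sz'] ->]].
  exists 0; last by rewrite vinterp0 subrr.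
  by split=> // x i _; rewrite !ffunE.
exists (a *: z + z'); last by rewrite vinterpP scalerBr opprD addrACA.
split; first exact: vP.
by move=> x i hx; rewrite !ffunE sz // sz' // scaler0 addr0.
Qed.

Lemma patch_pointP j z : patch l H [set mnode j] z <->
  exists m, elt l H m z /\ inside (H / 2) (ccenter H m) (mnode j).
Proof.
split=> [/(patchP H_gt0 p_gt0 lE)[m [mz [y my cy]]]|[m [mz mj]]].
  exists m; split=> //; suff -> : mnode j = y by [].
  apply/rowP => i; apply/eqP; rewrite -subr_eq0 -normr_le0; apply/ler_addgt0Pl => e e0.
  move: cy => /closure_rowP/(_ e e0)[y' -> /(_ i)].
  by rewrite addr0 distrC => /ltW.
apply/(patchP H_gt0 p_gt0 lE); exists m; split=> //; exists (mnode j) => //.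
exact: subset_closure.
Qed.

(** Interpolation enlarges the support of a function around a mesh node by one
    layer of cells only, since a coefficient is computed on the cell of its node. *)
Lemma Wj_support j v i (x : N) : Wj j v -> v i x != 0 ->
  inside (2 * H) (mnode j) (pos x).
Proof.
move=> [z [_ sz] ->]; have HH := H_gt0.
have zpatch t i' : z i' t != 0 -> patch l H [set mnode j] (pos t).
  by move=> zt; apply: contrapT => nt; rewrite sz ?eqxx // in zt.
rewrite !ffunE => h.
have [zx|zx] := eqVneq (z i x) 0; last first.
  have /patch_pointP[m [mx mj]] := zpatch _ _ zx.
  move=> t; have := elt_inside H_gt0 lE mx t; have := mj t.
  by rewrite !ler_norml => /andP[a1 a2] /andP[a3 a4]; apply/andP; split; lra.
have {h} : interp Tk psi (z i) x != 0.
  by apply: contraNneq h => ->; rewrite zx subrr.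
rewrite (interpE Tk psi) => h.
have [k hk] : exists k : 'I_(nb_nodes B), coef Tk psi k (z i) * phi k (pos x) != 0.
  apply: contrapT => nk; move/eqP: h; apply; rewrite big1 // => k _.
  by apply/eqP/negPn/negP => ?; apply: nk; exists k.
have /andP[ck pk] : (coef Tk psi k (z i) != 0) && (phi k (pos x) != 0).
  by move: hk; rewrite mulf_eq0 negb_or.
have xk := phi_near H_gt0 p_gt0 lE (@pos_domain _ _ _ N x) pk.
have [m [b [TE kE]]] := Tk_cell H_gt0 p_gt0 lE dual k.
have [t [tT zt]] : exists t : N, Tk k (pos t) /\ z i t != 0.
  apply: contrapT => nt; move: ck; rewrite /coef; case: ifP => _; last by rewrite eqxx.
  rewrite /lam dot_mass big1 ?eqxx // => t /set_mem tT.
  suff -> : z i t = 0 by rewrite mulr0.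
  by apply/eqP/negPn/negP => ?; apply: nt; exists t.
have /patch_pointP[m' [m't m'j]] := zpatch _ _ zt.
have mm : m = m' by apply: (elt_disj H_gt0 lE _ m't); rewrite -TE.
rewrite -mm in m'j => s; have := m'j s; have := xk s.
have : inside (H / 2) (ccenter H m) (mnode k).
  rewrite kE mnode_vnode => s'; rewrite !mxE natrD ler_norml.
  by case: (b s') => /=; apply/andP; split; lra.
move=> /(_ s); rewrite ltr_norml !ler_norml => /andP[a1 a2] /andP[a3 a4] /andP[a5 a6].
by apply/andP; split; lra.
Qed.

(** The basis is a partition of unity and the interpolant of [w] vanishes, so the
    given decomposition reproduces [w]. *)
Lemma partition_decomposition w : W w ->
  (forall j, Wj j (pmul (varphi N j) w - vI (pmul (varphi N j) w))) /\
  w = \sum_(j < nb_nodes B) (pmul (varphi N j) w - vI (pmul (varphi N j) w)).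
Proof.
move=> [hw iw]; split=> [j|].
  exists (pmul (varphi N j) w) => //; split=> [i x Gx|x i nx].
    by rewrite !ffunE hw // mulr0.
  rewrite !ffunE; have [->|pj] := eqVneq (phi j (pos x)) 0; first by rewrite mul0r.
  case: nx; apply/patch_pointP.
  have dx := @pos_domain _ _ _ N x.
  have [m mx] := locate H_gt0 p_gt0 lE dx; exists m; split=> //.
  have [b ->] := node_near_vtx H_gt0 p_gt0 lE (elt_inside H_gt0 lE mx)
    (phi_near H_gt0 p_gt0 lE dx pj).
  by apply/(closure_elt H_gt0 lE); exact: vtx_closure.
rewrite sumrB -vinterp_sum.
have -> : \sum_(j < nb_nodes B) pmul (varphi N j) w = w.
  apply/ffunP => i; apply/ffunP => x; rewrite sum_ffunE sum_ffunE.
  rewrite (eq_bigr (fun j => phi j (pos x) * w i x)) => [|j _]; last by rewrite !ffunE.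
  by rewrite -mulr_suml (phi_sum H_gt0 p_gt0 lE) ?mul1r //; exact: pos_domain.
by rewrite iw subr0.
Qed.

Definition kloc m v w : R := vdot (Kloc Kx (elt l H m) v) w.

Lemma kloc_sum v w : \sum_m kloc m v w = b v w.
Proof.
rewrite /kloc; under eq_bigr do rewrite KlocE.
rewrite -(sum_cells H_gt0 p_gt0 lE) (kformE KS); apply: eq_bigl => x.
by apply/mem_set/pos_domain.
Qed.

Lemma ideal_corrector v : exists q : cell p -> vnodefun N n,
  forall m, W (q m) /\ forall w, W w -> b (q m) w = kloc m v w.
Proof.
have h m : exists q, W q /\ forall w, W w -> b q w = kloc m v w.
  have [|q Wq qE] := riesz bP W_submodule W_definite (g := kloc m v).
    by move=> a u w; rewrite /kloc vdotC vdotPl !(vdotC _ (Kloc _ _ _)).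
  by exists q.
by have [q hq] := choice h; exists q.
Qed.

Section Iterates.
Variables (C1 C2 : R).
Hypothesis hC : decomposition_constants K Tk psi C1 C2.
Variable P : 'I_(nb_nodes B) -> vnodefun N n -> vnodefun N n.
Hypothesis hP : subspace_proj b Wj P.

Notation S := (correction_step C2 P).

Let C1_gt0 : 0 < C1. Proof. by case: hC. Qed.
Let C2_gt0 : 0 < C2. Proof. by case: hC. Qed.

Lemma iter_contract e nu : W e -> W (iter nu S e) /\
  b (iter nu S e) (iter nu S e) <= (expR (- (C1 * C2)^-1) ^+ nu) ^+ 2 * b e e.
Proof.
apply: (correction_iter_contract bP Wj_W hP W_submodule C1_gt0 C2_gt0).
  move=> wj hwj; have Ws : W (\sum_j wj j).
    by apply: (submodule_sum _ W_submodule) => j _; exact: Wj_W (hwj j).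
  have [_ _ h] := hC; have [h1 _] := h _ Ws.
  have := h1 wj hwj (erefl _); rewrite (vseminK KS).
  by under [X in _ <= C2 * X]eq_bigr do rewrite (vseminK KS).
move=> w Ww; have [h1 h2] := partition_decomposition Ww.
exists (fun j => pmul (varphi N j) w - vI (pmul (varphi N j) w)); split=> //.
have [_ _ h] := hC; have [_] := h _ Ww; under eq_bigr do rewrite (vseminK KS).
by rewrite (vseminK KS).
Qed.

(** A bound for the distance from the centre of a cell to the support of the
    approximation after [nu] steps. *)
Definition radius (nu : nat) : R := (5 * nu%:R + 2^-1) * H.

(** The form at the node [x] sees only values at [x] and its neighbours; two such
    nodes are at most [2 * R0 <= H / 2] apart. *)
Lemma far_kxform r c v j w (x : N) :
  (forall i (y : N), v i y != 0 -> inside r c (pos y)) -> Wj j w ->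
  ~ inside (r + 3 * H) c (mnode j) -> kxform Kx x v w = 0.
Proof.
move=> sv hw far; have HH := H_gt0; have RR := R4; have R00 := R0_gt0.
have [[i [y [ys vy]]]|nv] := pselect (exists i (y : N), y \in star x /\ v i y != 0); last first.
  apply: (kxform0 KS) => y i ys; apply/eqP/negPn/negP => ?; apply: nv.
  by exists i, y.
rewrite (formC (kxform_psd KS x)); apply: (kxform0 KS) => z i' zs.
apply/eqP/negPn/negP => wz; apply: far => t.
have h1 := sv _ _ vy t; have h2 := Wj_support hw wz t.
have h3 := star_near loc R0_gt0 ys t; have h4 := star_near loc R0_gt0 zs t.
move: h1 h2 h3 h4; rewrite !ler_norml.
move=> /andP[a1 a2] /andP[a3 a4] /andP[a5 a6] /andP[a7 a8].
by apply/andP; split; lra.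
Qed.

(** One step moves the support by the overlap of the patches, at most five layers
    of cells: a correction on the patch of [mnode j] vanishes unless the patch is
    coupled to the cell [m] or to the current support. *)
Lemma iterate_support m v q nu : W q -> (forall w, W w -> b q w = kloc m v w) ->
  forall i (x : N), (q - iter nu S q) i x != 0 ->
    inside (radius nu) (ccenter H m) (pos x).
Proof.
move=> Wq qE; have HH := H_gt0; have RR := R4; have R00 := R0_gt0.
elim: nu => [|nu IH] i x; first by rewrite /= subrr !ffunE eqxx.
set e := iter nu S q in IH *.
have -> : q - iter nu.+1 S q = (q - e) + C2^-1 *: \sum_j P j e.
  by rewrite iterS -/e /correction_step opprB addrA addrAC.
have far j : ~ inside (radius nu + 3 * H) (ccenter H m) (mnode j) -> P j e = 0.
  move=> nj; apply: (subspace_proj_eq0 Wj_W W_definite hP) => w hw.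
  have -> : e = q - (q - e) by rewrite opprB addrCA subrr addr0.
  rewrite (formBl bP) qE; last exact: Wj_W hw.
  rewrite (kformE KS) [X in _ - X]big1 => [|y _]; last exact: far_kxform IH hw nj.
  rewrite subr0 /kloc KlocE big1 // => y /set_mem my.
  rewrite (formC (kxform_psd KS y)); apply: (kxform0 KS) => z i' zs.
  apply/eqP/negPn/negP => wz; apply: nj => t.
  have h1 := elt_inside H_gt0 lE my t; have h2 := Wj_support hw wz t.
  have h3 := star_near loc R0_gt0 zs t.
  have nu0 : 0 <= 5 * nu%:R * H by rewrite mulr_ge0 // ltW.
  move: h1 h2 h3; rewrite /radius !ler_norml.
  move=> /andP[a1 a2] /andP[a3 a4] /andP[a5 a6].
  by apply/andP; split; lra.
have [qx|qx] := eqVneq ((q - e) i x) 0; last first.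
  move=> _ t; have := IH i x qx t; rewrite /radius -(natr1 nu) => h.
  by apply: le_trans h _; lra.
have [Px|Px] := pselect (exists j, P j e i x != 0).
  move=> _; have [j Pj] := Px.
  have nj : inside (radius nu + 3 * H) (ccenter H m) (mnode j).
    by apply: contrapT => /far Pj0; move: Pj; rewrite Pj0 !ffunE eqxx.
  have Wjj : Wj j (P j e) by have [] := hP j e.
  move=> t; have := Wj_support Wjj Pj t; have := nj t.
  rewrite /radius -(natr1 nu) !ler_norml => /andP[a1 a2] /andP[a3 a4].
  by apply/andP; split; lra.
rewrite [((_ + _) : vnodefun N n) i]ffunE ffunE qx add0r ffunE ffunE sum_ffunE sum_ffunE.
rewrite big1 ?scaler0 ?eqxx // => j _.
by apply/eqP/negPn/negP => ?; apply: Px; exists j.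
Qed.

(** Six layers are reserved per step, because passing from the distance of nodes to
    the indices of their cells costs up to one layer more than [radius] shows. *)
Lemma iterate_inWloc m v q k : W q -> (forall w, W w -> b q w = kloc m v w) ->
  inWloc Tk psi (patchn l H k (elt l H m)) (q - iter (k %/ 6) S q).
Proof.
move=> Wq qE; have HH := H_gt0; split.
  by apply: (submoduleB W_submodule Wq); exact: (proj1 (iter_contract _ Wq)).
move=> x i nx; apply/eqP/negPn/negP => h; apply: nx.
have xr := iterate_support Wq qE h.
have [m' m'x] := locate H_gt0 p_gt0 lE (@pos_domain _ _ _ N x).
have n6 : (6 * (k %/ 6) <= k)%N by rewrite mulnC leq_trunc_div.
have [n0|n0] := posnP (k %/ 6).
  by move: h; rewrite n0 /= subrr !ffunE eqxx.
apply: (patchn_cell H_gt0 p_gt0 lE _ m'x) => t.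
have := xr t; have := elt_inside H_gt0 lE m'x t.
rewrite /radius !mxE !ler_norml => /andP[a1 a2] /andP[a3 a4].
set a := nat_of_ord (m' t) in a1 a2 *; set c := nat_of_ord (m t) in a3 a4 *.
set s := (k %/ 6)%N in a3 a4 n0 n6 *.
have b1 : a%:R <= (c + (5 * s + 1))%:R :> R.
  by rewrite -(ler_pM2r HH) natrD natrD natrM; lra.
have b2 : c%:R <= (a + (5 * s + 1))%:R :> R.
  by rewrite -(ler_pM2r HH) natrD natrD natrM; lra.
move: b1 b2 n0 n6; rewrite !ler_nat; clearbody a c s; clear; lia.
Qed.

Lemma iter_step_sum (F : cell p -> vnodefun N n) nu :
  iter nu S (\sum_m F m) = \sum_m iter nu S (F m).
Proof.
elim: nu => [//|nu IH]; rewrite iterS IH.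
have SD := correction_stepD bP C2 Wj_submodule Wj_W W_definite hP.
by apply: (big_morph S SD); apply/(addrI (S 0)); rewrite -SD !addr0.
Qed.

(** At a node, only the boundedly many functions whose patch comes close to it
    contribute to the energy of the sum. *)
Lemma patchn_overlap k (z : cell p -> vnodefun N n) :
  (forall m, supported (patchn l H k (elt l H m)) (z m)) ->
  b (\sum_m z m) (\sum_m z m) <= ((k.+1).*2.+2 ^ d)%:R * \sum_m b (z m) (z m).
Proof.
move=> sz; have HH := H_gt0; have RR := R4; have R00 := R0_gt0.
rewrite (kformE KS); under [X in _ <= _ * X]eq_bigr do rewrite (kformE KS).
rewrite [X in _ <= _ * X]exchange_big mulr_sumr /=; apply: ler_sum => x _.
have hx := kxform_psd KS x.
pose A : pred (cell p) := fun m => cell_near H k.+1 (pos x) m.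
have z0 (m : cell p) : ~~ A m -> forall u, kxform Kx x (z m) u = 0.
  move=> nA; apply: (kxform0 KS) => y i ys; apply/eqP/negPn/negP => zy.
  move/negP: nA; apply; apply/asboolP => t.
  have py : patchn l H k (elt l H m) (pos y).
    by apply: contrapT => ny; move: zy; rewrite (sz m y i ny) eqxx.
  have := patchn_inside H_gt0 p_gt0 lE py t; have := star_near loc R0_gt0 ys t.
  rewrite -(natr1 k) !ler_norml => /andP[a1 a2] /andP[a3 a4].
  by apply/andP; split; lra.
have red u : kxform Kx x (\sum_m z m) u = kxform Kx x (\sum_(m | A m) z m) u.
  rewrite !(form_suml hx) [LHS](bigID A) /= [X in _ + X]big1 ?addr0 // => m nA.
  exact: z0.
rewrite red (formC hx) red.
apply: le_trans (form_sum_le _ _ hx) _.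
have s0 (Q : pred (cell p)) : 0 <= \sum_(m | Q m) kxform Kx x (z m) (z m).
  by apply: sumr_ge0 => m _; exact: (form_ge0 hx).
apply: ler_pM => //.
  by rewrite ler_nat; exact: card_cell_near.
by rewrite [leRHS](bigID A) /= lerDl s0.
Qed.

(** The localized correctors [qk] are the best approximations of the ideal ones
    [q], so they are closer to the iterates than the ideal ones are; the difference
    to the iterates is local and overlaps finitely, while the errors of the
    iterates add up to the error of one iteration for the sum. *)
Lemma localization_error v (q qk : cell p -> vnodefun N n) k : vvanishes Gamma v ->
  (forall m, W (q m) /\ forall w, W w -> b (q m) w = kloc m v w) ->
  (forall m, inWloc Tk psi (patchn l H k (elt l H m)) (qk m) /\
     forall w, inWloc Tk psi (patchn l H k (elt l H m)) w ->
       b (qk m) w = kloc m v w) ->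
  Num.sqrt (b (\sum_m (q m - qk m)) (\sum_m (q m - qk m))) <=
    (1 + Num.sqrt (((k.+1).*2.+2 ^ d)%:R)) *
    expR (- (C1 * C2)^-1) ^+ (k %/ 6) * Num.sqrt (b v v).
Proof.
move=> hv hq hqk; set nu := (k %/ 6)%N; set th := expR _ ^+ nu.
have th0 : 0 <= th by rewrite exprn_ge0 // expR_ge0.
pose e m := iter nu S (q m).
pose z m := (q m - qk m) - e m.
have -> : \sum_m (q m - qk m) = \sum_m e m + \sum_m z m.
  by rewrite -big_split; apply: eq_bigr => m _; rewrite /z [RHS]addrC subrK.
apply: le_trans (form_normD bP _ _) _; rewrite !mulrDl mul1r; apply: lerD.
  rewrite -iter_step_sum.
  have WQ : W (\sum_m q m).
    by apply: (submodule_sum _ W_submodule) => m _; exact: (proj1 (hq m)).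
  have QE w : W w -> b (\sum_m q m) w = b v w.
    move=> Ww; rewrite (form_suml bP) -kloc_sum; apply: eq_bigr => m _.
    exact: (proj2 (hq m)).
  have [_ h] := iter_contract nu WQ.
  have QQ : b (\sum_m q m) (\sum_m q m) <= b v v.
    have h1 := form_CS bP v (\sum_m q m); rewrite -QE // in h1.
    have := form_ge0 bP (\sum_m q m); rewrite le0r => /orP[/eqP ->|Q0].
      exact: (form_ge0 bP).
    by rewrite -(ler_pM2r Q0) -expr2.
  rewrite -[th]ger0_norm // -sqrtr_sqr -sqrtrM ?sqr_ge0 // ler_sqrt.
    by apply: le_trans h _; rewrite ler_wpM2l ?sqr_ge0.
  by rewrite mulr_ge0 ?sqr_ge0 // (form_ge0 bP).
have zloc m : inWloc Tk psi (patchn l H k (elt l H m)) (z m).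
  have [Wq qE] := hq m; have [[Wqk sqk] _] := hqk m.
  have [Wx sx] := iterate_inWloc k Wq qE.
  have -> : z m = (q m - e m) - qk m by rewrite /z addrAC.
  split; first exact: (submoduleB W_submodule Wx Wqk).
  move=> x i nx; have h1 := sx x i nx; have h2 := sqk x i nx.
  rewrite [((_ - _) : vnodefun N n) i]ffunE ffunE.
  by rewrite h1 add0r ffunE ffunE h2 oppr0.
have zz m : b (z m) (z m) <= th ^+ 2 * kloc m v v.
  have [Wq qE] := hq m; have [_ qkE] := hqk m.
  have [_ he] := iter_contract nu Wq.
  have zE : b (z m) (z m) = - b (e m) (z m).
    rewrite {1}/z (formBl bP) (formBl bP) qE; last exact: (proj1 (zloc m)).
    by rewrite (qkE _ (zloc m)) subrr sub0r.
  have ze : b (z m) (z m) <= b (e m) (e m).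
    have h1 := form_CS bP (e m) (z m).
    have := form_ge0 bP (z m); rewrite le0r => /orP[/eqP ->|z0].
      exact: (form_ge0 bP).
    by rewrite -(ler_pM2r z0) -expr2; apply: le_trans h1; rewrite zE sqrrN.
  have qq : b (q m) (q m) <= kloc m v v.
    have h1 := form_CS (Kloc_psd KS (elt l H m)) v (q m).
    rewrite -/(kloc m v (q m)) -/(kloc m v v) -qE // in h1.
    have h2 := Kloc_le KS (elt l H m) (q m).
    have k0 : 0 <= kloc m v v by exact: (form_ge0 (Kloc_psd KS (elt l H m))).
    have h3 := le_trans h1 (ler_wpM2l k0 h2).
    have := form_ge0 bP (q m); rewrite le0r => /orP[/eqP -> //|q0].
    by rewrite -(ler_pM2r q0) -expr2.
  apply: le_trans ze _; apply: le_trans he _.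
  by rewrite ler_wpM2l ?sqr_ge0.
have h1 := @patchn_overlap k z (fun m => proj2 (zloc m)).
have h2 : \sum_m b (z m) (z m) <= th ^+ 2 * b v v.
  rewrite -(kloc_sum v v) mulr_sumr; apply: ler_sum => m _; exact: zz.
set Nk := (_ ^ d)%:R in h1 *.
have Nk0 : 0 <= Nk :> R by [].
rewrite -{1}[th]ger0_norm // -sqrtr_sqr -mulrA -sqrtrM ?sqr_ge0 // -sqrtrM // ler_sqrt.
  by apply: le_trans h1 _; rewrite ler_wpM2l.
by rewrite !mulr_ge0 ?sqr_ge0 // (form_ge0 bP).
Qed.

End Iterates.
End Localization.

(** * The error estimate *)

Section Assembly.
Context {R : realType}.

Lemma span_submodule (E : vectType R) (P : E -> Prop) (X : seq E) :
  submodule P -> (forall x, x \in X -> P x) -> forall v, v \in <<X>>%VS -> P v.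
Proof.
move=> hP hX v vX; rewrite (coord_span (vX : v \in <<in_tuple X>>%VS)).
apply: submodule_sum => // i _.
by apply: submoduleZ => //; apply: hX; exact: mem_nth.
Qed.

(** [x] is the energy of the solution of a problem whose right-hand side is bounded
    by [F] in a norm with square [A], which the energy in turn controls. *)
Lemma sqrt_dual_bound (x F A E c a : R) : 0 <= x -> 0 <= F -> 0 < a ->
  0 <= E -> E <= x / a -> x <= F * Num.sqrt A -> A <= c * E ->
  Num.sqrt x <= Num.sqrt (`|c| / a) * F.
Proof.
move=> x0 F0 a0 E0 Ex xF Ax.
have c0 : 0 <= `|c| / a by rewrite divr_ge0 // ltW.
have h : Num.sqrt A <= Num.sqrt (`|c| / a) * Num.sqrt x.
  rewrite -sqrtrM // ler_wsqrtr //; apply: le_trans Ax _.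
  apply: (@le_trans _ _ (`|c| * E)); first by rewrite ler_wpM2r // ler_norm.
  by rewrite -mulrA (mulrC a^-1) ler_wpM2l.
have := sqrtr_ge0 x; rewrite le0r => /orP[/eqP ->|s0].
  by rewrite mulr_ge0 // sqrtr_ge0.
rewrite -(ler_pM2r s0) -expr2 sqr_sqrtr //; apply: le_trans xF _.
by apply: le_trans (ler_wpM2l F0 h) _; lra.
Qed.

Lemma sqrt_natX (k d : nat) :
  Num.sqrt ((k ^ d)%:R : R) = k%:R `^ (d%:R / 2).
Proof. by rewrite powRrM powR12_sqrt ?powR_ge0 // powR_mulrn // natrX. Qed.

(** Rounding the number of iterations down costs one contraction factor. *)
Lemma rate_bound (c : R) k : 0 < c ->
  expR (- c) ^+ (k %/ 6) <= expR c * expR (- (k%:R * (6^-1 * c))).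
Proof.
move=> c0; rewrite -expRM_natl -expRD ler_expR.
have h : k%:R <= 6 * (k %/ 6)%:R + 6 :> R.
  by rewrite -natrM -natrD ler_nat {1}(divn_eq k 6); have := ltn_pmod k (isT : (0 < 6)%N); lia.
by rewrite mulrN; nra.
Qed.

Lemma overlap_bound k d : (0 < d)%N -> (1 <= k)%N ->
  1 + Num.sqrt (((k.+1).*2.+2 ^ d)%:R : R) <=
    (1 + Num.sqrt ((6 ^ d)%:R)) * k%:R `^ (d%:R / 2).
Proof.
move=> d0 k1; rewrite mulrDl mul1r; apply: lerD.
  by rewrite -sqrt_natX -[leLHS]sqrtr1 ler_wsqrtr // ler1n expn_gt0 k1.
rewrite -sqrt_natX -sqrtrM // ler_wsqrtr // -natrM ler_nat -expnMn.
by rewrite leq_exp2r //; lia.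
Qed.

End Assembly.

(* The constant [C] is chosen after the domain [0,l_1] x ... x [0,l_d] and
   before the network, the boundary segment, the mesh and the operator. *)
Theorem theorem4p8 (R : realType)
    (C1 : R -> R -> nat -> R -> R -> R) (C2 : R -> R -> nat -> R)
    (d : nat) (d_gt0 : (0 < d)%N)
    (l : 'rV[R]_d) (l_gt0 : forall i, 0 < l 0 i) :
  exists C : R -> R -> R -> R -> R,
  forall (N : network l) (Gamma : set 'rV[R]_d) (R0 sigma rho mu H : R)
    (B : lagrange_basis l H Gamma)
    (Tk : 'I_(nb_nodes B) -> set 'rV[R]_d)
    (psi : 'I_(nb_nodes B) -> nodefun N)
    (n : nat) (alpha beta : R)
    (K : 'End(vnodefun N n)) (Kx : N -> 'End(vnodefun N n))
    (k : nat) (Q : set 'rV[R]_d -> vnodefun N n -> vnodefun N n)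
    (f u uH : vnodefun N n),
  network_assumptions N Gamma R0 sigma rho ->
  friedrichs N Gamma R0 mu ->
  poincare N R0 mu ->
  (forall i, exists p : nat, l 0 i = p%:R * H) ->
  mesh_boundary l H Gamma ->
  4 * d%:R * R0 <= H ->
  dual_basis Tk psi ->
  (1 <= n)%N ->
  operator_assumptions Gamma alpha beta K Kx ->
  decomposition_constants K Tk psi
    (C1 alpha beta d mu sigma) (C2 alpha beta d) ->
  solves Gamma K f u ->
  (1 <= k)%N ->
  is_corrector K Kx Tk psi k Q ->
  lod_solution K B Q f uH ->
  vsemin K (u - uH) <=
    C alpha beta mu sigma * (k%:R `^ (d%:R / 2)) *
    (H + expR (- (k%:R * (6 * C1 alpha beta d mu sigma * C2 alpha beta d)^-1))) *
    minv_norm f.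
Proof.
have [CF hCF] := global_friedrichs d_gt0 l_gt0.
pose c7 alpha mu sigma := Num.sqrt (`|@approx_const R d sigma mu| / alpha).
pose cF alpha mu sigma := Num.sqrt (`|CF sigma mu| / alpha).
pose c6 alpha beta mu sigma := Num.sqrt (`|beta * @stability_const R d sigma mu| / alpha).
exists (fun alpha beta mu sigma => c7 alpha mu sigma +
  (1 + Num.sqrt ((6 ^ d)%:R)) *
  expR ((C1 alpha beta d mu sigma * C2 alpha beta d)^-1) *
  c6 alpha beta mu sigma * cF alpha mu sigma).
move=> N Gamma R0 sigma rho mu H B Tk psi n alpha beta K Kx k Q f u uH.
move=> [R00 rho0 [homog loc dens _]] fried poin hp hG RH dual _ [SE KS KU] hC.
move=> [uV uE] k1 hQ [uHl uHE].
set A1 := C1 _ _ _ _ _ in hC *; set A2 := C2 _ _ _ in hC *.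
have [al0 _ SEb] := SE; have [A10 A20 _] := hC.
have d1 : (1 : R) <= d%:R by rewrite ler1n.
have H0 : 0 < H by apply: lt_le_trans RH; rewrite !mulr_gt0 // ltr0n.
have [p lE] := choice hp.
have p0 i : (0 < p i)%N.
  by have := l_gt0 i; rewrite lE lt0n; apply: contraTneq => ->; rewrite mul0r ltxx.
have R4 : 4 * R0 <= H := RH4 R00 d_gt0 RH.
have Gn := Gamma_node_exists d_gt0 R00 dens H0 p0 lE hG RH B.
have lR i : 4 * R0 <= l 0 i.
  apply: le_trans R4 _; rewrite lE ler_peMl ?(ltW H0) //.
  by rewrite ler1n.
have bP := kform_psd KS.
have nv v : vsemin K v = Num.sqrt (kform K v v) by [].
have Vsub := @vanishes_submodule R d l N n Gamma.
have Wsub := W_submodule n Tk psi.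
have energy_le v : vvanishes Gamma v -> venergy v <= kform K v v / alpha.
  move=> hv; have /andP[h _] := SEb v hv; rewrite vdot_lap in h.
  by rewrite ler_pdivlMr // mulrC.
have M0 : forall x : N, 0 < nmass x.
  apply: nmass_gt0; have [x0 _] := Gn.
  have [m mx] := locate H0 p0 lE (pos_domain x0).
  have /andP[h _] := mass_cell R00 homog H0 lE d_gt0 RH m.
  apply: lt_le_trans (le_trans h (massqS _ _)); first by rewrite mulr_gt0 // exprn_gt0.
  by move=> z; exact: elt_domain.
have F0 : 0 <= minv_norm f by exact: sqrtr_ge0.
set F := minv_norm f in F0 *.
have dualb v : vdot f v <= F * Num.sqrt (\sum_i massq (domain l) (v i)).
  exact: minv_normP.
have venergy_ge0 (v : vnodefun N n) : 0 <= venergy v.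
  by apply: sumr_ge0 => i _; exact: energy_ge0.
have u_bound : Num.sqrt (kform K u u) <= cF alpha mu sigma * F.
  apply: (sqrt_dual_bound (form_ge0 bP u) F0 al0 (venergy_ge0 u) (energy_le u uV)
    (A := \sum_i massq (domain l) (u i)) (c := CF sigma mu)).
    by apply: le_trans (dualb u); rewrite -uE.
  rewrite /venergy mulr_sumr; apply: ler_sum => i _.
  exact: (hCF N Gamma R0 sigma rho mu R00 rho0 homog poin fried lR Gn _ (uV i)).
pose v := vinterp Tk psi u.
have vV : vvanishes Gamma v by exact: vinterp_vanishes.
have v_bound : Num.sqrt (kform K v v) <= c6 alpha beta mu sigma * Num.sqrt (kform K u u).
  rewrite -sqrtrM ?divr_ge0 ?(ltW al0) // ler_wsqrtr //.
  have /andP[_ h] := SEb v vV; apply: le_trans h _; rewrite vdot_lap.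
  have be0 : 0 <= beta by case: SE => _ h _; apply: le_trans h; exact: ltW.
  have h : venergy v <= @stability_const R d sigma mu * venergy u.
    rewrite /venergy mulr_sumr; apply: ler_sum => i _; rewrite ffunE.
    exact: (interp_energy d_gt0 R00 rho0 homog loc dens poin fried H0 p0 lE hG RH dual (uV i)).
  apply: le_trans (ler_wpM2l be0 h) _; rewrite mulrA.
  apply: (@le_trans _ _ (`|beta * @stability_const R d sigma mu| * venergy u)).
    by rewrite ler_wpM2r // ler_norm.
  by rewrite -mulrA (mulrC alpha^-1) ler_wpM2l // energy_le.
have [q hq] := ideal_corrector p Tk psi KS KU v.
pose T m := elt l H (p := p) m.
pose I := ('I_n * 'I_(nb_nodes B))%type.
pose free (t : I) := (t.2 < nb_free B)%N.
pose a (t : I) := coef Tk psi t.2 (u t.1).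
have vE : v = \sum_(t | free t) a t *: vphi N t.
  apply/ffunP => i; rewrite ffunE interp_sum sum_ffunE.
  rewrite (eq_bigr (fun t : I => if t.1 == i then a t *: varphi N t.2 else 0)) => [|t _]; last first.
    by rewrite !ffunE eq_sym; case: ifP => // _; rewrite scaler0.
  rewrite -big_mkcondr /=.
  rewrite (eq_bigl (fun t : I => pred1 i t.1 && (t.2 < nb_free B)%N)) => [|t]; last first.
    by rewrite andbC.
  rewrite -(pair_big_dep (pred1 i) (fun _ (j : 'I_(nb_nodes B)) => (j < nb_free B)%N)
    (fun i' (j : 'I_(nb_nodes B)) => coef Tk psi j (u i') *: varphi N j)) /=.
  rewrite big_pred1_eq [LHS](bigID (fun j : 'I_(nb_nodes B) => (j < nb_free B)%N)) /=.
  rewrite [X in _ + X]big1 ?addr0 // => j /negPf jf.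
  by rewrite /coef jf scale0r.
have phiV t : free t -> vvanishes Gamma (vphi N t).
  move=> ft i x Gx; rewrite ffunE; case: ifP => _; last by rewrite ffunE.
  by rewrite ffunE (phi_free_Gamma ft (Gamma_domain hG Gx) Gx).
(* The localized correctors of [v], by linearity from those of the basis. *)
pose qk m := \sum_(t | free t) a t *: Q (T m) (vphi N t).
have QT m t : free t -> _ := fun ft => hQ (T m) (vphi N t) (elt_mesh H0 p0 lE m) (phiV t ft).
have hqk m : inWloc Tk psi (patchn l H k (T m)) (qk m) /\
    forall w, inWloc Tk psi (patchn l H k (T m)) w -> kform K (qk m) w = kloc H Kx m v w.
  split=> [|w hw].
    split=> [|x i nx].
      apply: (submodule_sum _ Wsub) => t ft; apply: submoduleZ => //.
      by have [[]] := QT m t ft.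
    rewrite sum_ffunE sum_ffunE big1 // => t ft; rewrite !ffunE.
    by have [[_ ->]] := QT m t ft; rewrite ?scaler0.
  rewrite /qk (form_suml bP) /kloc vE (form_suml (Kloc_psd KS (T m))).
  apply: eq_bigr => t ft; rewrite (formZl bP) (formZl (Kloc_psd KS (T m))).
  by have [_ h] := QT m t ft; congr (_ * _); exact: h.
have [P hP] := subspace_proj_exists bP (Wj_submodule n Tk psi) (Wj_W hG dual)
  (W_definite KS KU).
have locerr := localization_error R00 loc H0 p0 lE hG R4 dual KS KU hC hP vV hq hqk.
pose vl := v - \sum_m qk m.
have vlE : vl = \sum_(t | free t) a t *: (vphi N t - \sum_m Q (T m) (vphi N t)).
  under eq_bigr do rewrite scalerBr; rewrite sumrB -vE /vl; congr (_ - _).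
  by rewrite exchange_big; apply: eq_bigr => t _; rewrite scaler_sumr.
have vl_lod : vl \in lod_space B Q.
  rewrite vlE; apply: memv_suml => t ft; apply: memvZ; apply: memv_span.
  apply/mapP; exists t; first by rewrite mem_filter mem_enum andbT.
  by rewrite (fsum_mesh H0 p0 lE).
have lodV x : x \in lod_space B Q -> vvanishes Gamma x.
  apply: (span_submodule (P := vvanishes Gamma)) => // y /mapP[t].
  rewrite mem_filter => /andP[ft _] ->; rewrite (fsum_mesh H0 p0 lE).
  apply: (submoduleB Vsub (phiV t ft)); apply: (submodule_sum _ Vsub) => m _.
  by have [[[]]] := QT m t ft.
have galerkin x : x \in lod_space B Q -> kform K (u - uH) x = 0.
  move=> xl; rewrite (formBl bP) /kform (uE x (lodV x xl)) (uHE x xl).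
  by rewrite subrr.
(* Galerkin orthogonality makes [uH] at least as good as [vl]. *)
have best : kform K (u - uH) (u - uH) <= kform K (u - vl) (u - vl).
  have e : kform K (u - uH) (u - uH) = kform K (u - uH) (u - vl).
    have -> : u - vl = (u - uH) + (uH - vl) by rewrite addrA subrK.
    by rewrite [RHS](formDr bP) (galerkin (uH - vl)) ?addr0 // memvB.
  have h := form_CS bP (u - uH) (u - vl); rewrite -e in h.
  have := form_ge0 bP (u - uH); rewrite le0r => /orP[/eqP ->|e0].
    exact: (form_ge0 bP).
  by move: h; rewrite expr2 (ler_pM2l e0).
pose w0 := u - v + \sum_m q m.
have w0W : inW Tk psi w0.
  apply: (submoduleD Wsub); last first.
    by apply: (submodule_sum _ Wsub) => m _; exact: (proj1 (hq m)).
  split; first exact: (submoduleB Vsub uV vV).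
  by rewrite vinterpB (vinterp_idem dual) subrr.
have w0E w : inW Tk psi w -> kform K w0 w = vdot f w.
  move=> Ww; rewrite (formDl bP) (formBl bP) (form_suml bP).
  rewrite (eq_bigr (fun m => kloc H Kx m v w)) => [|m _]; last exact: (proj2 (hq m)).
  by rewrite (kloc_sum H0 p0 lE KS) subrK; exact: uE (proj1 Ww).
have w0_bound : Num.sqrt (kform K w0 w0) <= c7 alpha mu sigma * H * F.
  have := sqrt_dual_bound (form_ge0 bP w0) F0 al0 (venergy_ge0 w0)
    (energy_le w0 (proj1 w0W)) (A := \sum_i massq (domain l) (w0 i))
    (c := @approx_const R d sigma mu * H ^+ 2).
  have -> : Num.sqrt (`|@approx_const R d sigma mu * H ^+ 2| / alpha) = c7 alpha mu sigma * H.
    rewrite normrM (ger0_norm (sqr_ge0 H)) mulrAC sqrtrM; last first.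
      by rewrite divr_ge0 // ltW.
    by rewrite sqrtr_sqr (gtr0_norm H0).
  apply; first by apply: le_trans (dualb w0); rewrite w0E.
  rewrite /venergy mulr_sumr; apply: ler_sum => i _.
  apply: (interp0_mass d_gt0 R00 rho0 homog loc dens poin fried H0 p0 lE hG RH dual).
    exact: (proj1 w0W i).
  by have [_ /ffunP/(_ i)] := w0W; rewrite !ffunE.
have split_err : u - vl = w0 - \sum_m (q m - qk m).
  by rewrite sumrB /w0 /vl !opprB -[RHS]addrA [X in _ = _ + X]addrC subrK addrA addrAC.
rewrite nv; apply: (@le_trans _ _ (Num.sqrt (kform K w0 w0) +
    Num.sqrt (kform K (\sum_m (q m - qk m)) (\sum_m (q m - qk m))))).
  apply: (le_trans (ler_wsqrtr best)); rewrite split_err.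
  apply: le_trans (form_normD bP w0 _) _; rewrite lerD2l -scaleN1r.
  by rewrite (formZl bP) (formZr bP) mulrA mulrNN !mul1r.
apply: le_trans (lerD w0_bound locerr) _.
have A12 : 0 < (A1 * A2)^-1 by rewrite invr_gt0 mulr_gt0.
have rate := rate_bound k A12.
have ov := overlap_bound (R := R) d_gt0 k1.
set kd := k%:R `^ _ in ov *.
have kd1 : 1 <= kd by rewrite /kd -sqrt_natX -[leLHS]sqrtr1 ler_wsqrtr // ler1n expn_gt0 k1.
have -> : (6 * A1 * A2)^-1 = 6^-1 * (A1 * A2)^-1 by rewrite -mulrA invfM.
set x := expR (- (k%:R * _)) in rate *; set y := expR (A1 * A2)^-1 in rate *.
set th := expR _ ^+ _ in rate *.
have [x0 y0 th0] : [/\ 0 <= x, 0 <= y & 0 <= th].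
  by split; rewrite ?exprn_ge0 // expR_ge0.
set r6 := 1 + Num.sqrt _ in ov *.
set n6 := 1 + Num.sqrt _ in ov *.
have s7 : 0 <= c7 alpha mu sigma by exact: sqrtr_ge0.
have s6 : 0 <= c6 alpha beta mu sigma by exact: sqrtr_ge0.
have sF : 0 <= cF alpha mu sigma by exact: sqrtr_ge0.
have vb : Num.sqrt (kform K v v) <= c6 alpha beta mu sigma * cF alpha mu sigma * F.
  by apply: le_trans v_bound _; rewrite -mulrA ler_wpM2l.
set c67 := c6 _ _ _ _ * _ in vb *.
have c670 : 0 <= c67 by exact: mulr_ge0.
have r60 : 0 <= r6 by rewrite addr_ge0 ?sqrtr_ge0.
have n60 : 0 <= n6 by rewrite addr_ge0 ?sqrtr_ge0.
have step : r6 * th * Num.sqrt (kform K v v) <= n6 * kd * (y * x) * (c67 * F).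
  apply: ler_pM; [exact: mulr_ge0 | exact: sqrtr_ge0| | exact: vb].
  by apply: ler_pM.
apply: le_trans (lerD (lexx _) step) _.
have -> : n6 * y * c6 alpha beta mu sigma * cF alpha mu sigma = n6 * y * c67.
  by rewrite -mulrA.
set c := n6 * y * c67; have c0 : 0 <= c by rewrite !mulr_ge0.
have -> : n6 * kd * (y * x) * (c67 * F) = c * kd * x * F by rewrite /c; ring.
have kd0 : 0 <= kd by exact: le_trans kd1.
set s := c7 _ _ _ in s7 *.
have h1 : s * H * F <= s * kd * H * F.
  by rewrite ler_wpM2r // ler_wpM2r ?(ltW H0) // ler_peMr.
have h2 : 0 <= s * kd * x * F by rewrite !mulr_ge0.
have h3 : 0 <= c * kd * H * F by rewrite !mulr_ge0 // ltW.
by lra.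
Qed.
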